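(* Let $C \subset [0,1]$ be a Cantor set with $\dim_{\mathcal H}(C) = 1$ and $\mathcal H^1(C) = 0$, and let $$ \Omega_2 = (-1,1)^2 \setminus \{(x,y)\,:\,|y| \le \operatorname{dist}(x,C),\ 0\le x \le 1\}\subset\mathbb{R}^2 . $$ Then $\Omega_2$ is a $W^{1,1}$-extension domain and its set $\mathcal T_{\Omega_2}$ of two-sided boundary points satisfies $$ \dim_{\mathcal H}(\mathcal T_{\Omega_2}) = 1. $$
   Context: $\dim_{\mathcal H}$ and $\mathcal H^1$ denote Hausdorff dimension and $1$-dimensional Hausdorff measure. A Cantor set is a nonempty, compact, perfect, totally disconnected set. A domain $\Omega\subset\mathbb{R}^n$ is a $W^{1,p}$-extension domain if there exist a constant $C\ge1$ and a (not necessarily linear) operator $E\colon W^{1,p}(\Omega)\to W^{1,p}(\mathbb{R}^n)$ such that $Eu|_\Omega=u$ and $\|Eu\|_{W^{1,p}(\mathbb{R}^n)}\le C\|u\|_{W^{1,p}(\Omega)}$ for all $u\in W^{1,p}(\Omega)$, where $W^{1,p}(\Omega)$ is the usual (non-homogeneous) Sobolev space. A point $x\in\partial\Omega$ is called two-sided if there exists $R>0$ such that for all $r\in(0,R)$ there exist disjoint connected components $\Omega_r^1$ and $\Omega_r^2$ of $\Omega\cap B(x,r)$ that are nested: $\Omega_s^i\subset\Omega_r^i$ for $0<s<r<R$ and $i\in\{1,2\}$. The set of two-sided points of $\partial\Omega$ is denoted $\mathcal{T}_\Omega$. *)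

(* Defs.v *)
From mathcomp Require Import all_boot all_order all_algebra.
From mathcomp Require Import all_classical all_reals all_analysis.

Set Implicit Arguments.
Unset Strict Implicit.
Unset Printing Implicit Defensive.
Import Order.TTheory GRing.Theory Num.Theory.
Import numFieldNormedType.Exports.
Local Open Scope classical_set_scope.
Local Open Scope ring_scope.

(* The topology of [R * R] is that of R^2, but its library norm is the sup
   norm: metric notions (balls, diameters, gradient lengths) go through [dist2]
   and [enorm] instead. *)
Definition enorm (R : realType) (z : R * R) : R :=
  Num.sqrt (z.1 ^+ 2 + z.2 ^+ 2).

Definition dist1 (R : realType) (x y : R) : R := `|x - y|.

Definition dist2 (R : realType) (z w : R * R) : R := enorm (z - w).

(* The values are meant for nonempty [A]; [inf set0 = 0]. *)
Definition dist_to (R : realType) (x : R) (A : set R) : R :=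
  inf [set dist1 x a | a in A].

Section Hausdorff.
Context (R : realType) (T : Type) (d : T -> T -> R).
Local Open Scope ereal_scope.

(* Adjoining [0] makes the diameter of the empty set [0]. *)
Definition diam (U : set T) : \bar R :=
  ereal_sup ([set 0] `|` [set (d z.1 z.2)%:E | z in U `*` U]).

(* [0 `^ 0 = 1], so an empty set must be singled out in order to contribute
   nothing when [s = 0]. *)
Definition hausdorff_term (s : R) (U : set T) : \bar R :=
  if `[< U = set0 >] then 0 else diam U `^ s.

Definition hausdorff_cover (delta : R) (A : set T) : set (nat -> set T) :=
  [set U | A `<=` \bigcup_i U i /\ forall i, diam (U i) <= delta%:E].

Definition hausdorff_premeasure (s delta : R) (A : set T) : \bar R :=
  ereal_inf [set \sum_(i <oo) hausdorff_term s (U i)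
            | U in hausdorff_cover delta A].

(* No normalising factor: it would be [1] for [s = 1], and for the other [s] it
   affects neither the nullity of the measure nor the dimension. *)
Definition hausdorff_measure (s : R) (A : set T) : \bar R :=
  ereal_sup [set hausdorff_premeasure s delta A
            | delta in [set delta : R | (0 < delta)%R]].

Definition hausdorff_dim (A : set T) : \bar R :=
  ereal_inf [set s%:E | s in [set s : R |
    (0 <= s)%R /\ hausdorff_measure s A = 0]].

End Hausdorff.

Definition cantor_set (T : topologicalType) (A : set T) :=
  [/\ A !=set0, compact A, perfect_set A & totally_disconnected A].

Section Sobolev.
Context (R : realType).
Implicit Types (Omega : set (R * R)) (u : R * R -> R) (p : \bar R).

Definition mu2 : {measure set (measurableTypeR R * measurableTypeR R) -> \bar R}
  := (@lebesgue_measure R \x @lebesgue_measure R)%E.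

Definition e1 : R * R := (1, 0).
Definition e2 : R * R := (0, 1).

Fixpoint Ck (k : nat) (phi : R * R -> R) : Prop :=
  if k is k'.+1 then
    [/\ continuous phi,
        (forall z, derivable phi z e1), (forall z, derivable phi z e2),
        Ck k' ('D_e1 phi) & Ck k' ('D_e2 phi)]
  else continuous phi.

Definition test_function Omega (phi : R * R -> R) : Prop :=
  [/\ forall k, Ck k phi,
      compact (closure [set z | phi z != 0]) &
      closure [set z | phi z != 0] `<=` Omega].

Definition loc_integrable Omega u : Prop :=
  measurable_fun (Omega : set (measurableTypeR R * measurableTypeR R)) u /\
  forall K, K `<=` Omega -> compact K -> mu2.-integrable K (EFin \o u).

Definition weak_partial Omega (v : R * R) u (g : R * R -> R) : Prop :=
  forall phi, test_function Omega phi ->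
    (\int[mu2]_(z in Omega) (u z * 'D_v phi z)%:E =
     - \int[mu2]_(z in Omega) (g z * phi z)%:E)%E.

Definition is_weak_gradient Omega u (G : R * R -> R * R) : Prop :=
  [/\ loc_integrable Omega (fst \o G), loc_integrable Omega (snd \o G),
      weak_partial Omega e1 u (fst \o G) & weak_partial Omega e2 u (snd \o G)].

(* A choice of the weak gradient, which is unique up to null sets. *)
Definition weak_gradient Omega u : R * R -> R * R :=
  xget (cst 0) [set G | is_weak_gradient Omega u G].

Definition Lp_norm p Omega u : \bar R :=
  'N[mu2]_p[EFin \o (u \_ Omega)]%E.

(* Functions are defined on the whole plane but only their values on [Omega]
   matter. *)
Definition W1p_norm p Omega u : \bar R :=
  (Lp_norm p Omega u + Lp_norm p Omega (@enorm R \o weak_gradient Omega u))%E.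

Definition W1p p Omega : set (R * R -> R) :=
  [set u | [/\ loc_integrable Omega u,
      exists G, is_weak_gradient Omega u G & (W1p_norm p Omega u < +oo)%E]].

Definition domain Omega : Prop := [/\ open Omega, Omega !=set0 & connected Omega].

(* Elements of the Sobolev spaces are classes modulo null sets: the last
   clause says that [E] is well defined on classes. *)
Definition W1p_extension_domain p Omega : Prop :=
  domain Omega /\
  exists (C : R) (E : (R * R -> R) -> (R * R -> R)),
    1 <= C /\
    (forall u, W1p p Omega u ->
      [/\ W1p p [set: R * R] (E u), (E u = u %[ae mu2 in Omega]) &
          (W1p_norm p [set: R * R] (E u) <= C%:E * W1p_norm p Omega u)%E]) /\
    (forall u v, W1p p Omega u -> W1p p Omega v -> u = v %[ae mu2 in Omega] ->
      E u = E v %[ae mu2]).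

End Sobolev.

Section TwoSided.
Context (R : realType).
Implicit Types (Omega A : set (R * R)) (z : R * R).

Definition eball z (r : R) : set (R * R) := [set w | dist2 z w < r].

Definition boundary Omega : set (R * R) := closure Omega `\` interior Omega.

Definition is_component A (D : set (R * R)) : Prop :=
  exists2 z, A z & D = connected_component A z.

Definition two_sided Omega : set (R * R) :=
  [set x | boundary Omega x /\
    exists2 r0 : R, 0 < r0 &
    exists D1 D2 : R -> set (R * R),
      (forall r, 0 < r < r0 ->
        [/\ is_component (Omega `&` eball x r) (D1 r),
            is_component (Omega `&` eball x r) (D2 r) &
            D1 r `&` D2 r = set0]) /\
      (forall s r, 0 < s -> s < r -> r < r0 ->
        D1 s `<=` D1 r /\ D2 s `<=` D2 r)].

End TwoSided.

Definition Omega2 (R : realType) (C : set R) : set (R * R) :=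
  (`]-1, 1[ `*` `]-1, 1[) `\`
  [set z | `|z.2| <= dist_to z.1 C /\ 0 <= z.1 <= 1].

(* Main.v *)
From HB Require Import structures.
Require Import Defs.
From mathcomp Require Import all_boot all_order all_algebra.
From mathcomp Require Import all_classical all_reals all_analysis.
From mathcomp Require Import measurable_realfun.
From mathcomp Require Import ring lra.
Set Implicit Arguments.
Unset Strict Implicit.
Unset Printing Implicit Defensive.
Import Order.TTheory GRing.Theory Num.Theory.
Import numFieldNormedType.Exports.
Local Open Scope classical_set_scope.
Local Open Scope ring_scope.

(** Let [F x = dist(x, C)], and let [u_L] be the extension by reflections to the
    whole plane of the restriction of [u] to the left half of the square. Then
    [r = u - u_L] vanishes on the left half, and it remains to extend it across
    the graphs of [F] and [- F]. Below the graph of [F], [r] is replaced by its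
    reflection in the graph, multiplied by a cutoff [H] that vanishes at depth
    [d x = dist(x, C u {0}) <= F x]; the extensions from above and from below
    therefore do not interfere, and their sum is extended from the square to the
    plane. The derivatives of [H] are of size [1 / d] on a layer of height [d], and
    the integral of [|r| / d] over such a layer is at most a multiple of that of
    [|d_y r|], because [r (x, y)] is minus the integral of [d_y r (x, .)] above [y].
    Where [d] vanishes nothing is extended: that set is null since [H^1(C) = 0].

    The points [(x, 0)] with [x] in [C], [0 < x < 1], are two-sided, and the
    boundary is a finite union of Lipschitz curves, whence the dimension. *)

(** * Real-valued integrals *)

(** Reflecting a test function in a Lipschitz graph destroys its smoothness, and no values of [u] on
    the graph are at hand. The gradient is therefore tested in two directions. Vertically, [u] is a
    tail integral of its derivative on almost every column, and integration by parts is done column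
    by column. Tangentially, [F] and [d] are replaced by smooth approximations, and the test
    function is cut off at height about [1 / (n + 1)] over the graph; the cutoff is constant along
    the tangent, so its steep derivative never appears. The limit is taken by dominated convergence,
    and Hardy's inequality supplies the majorant: this fixes the rates 8 and 2 of the
    approximations. Rademacher's theorem is replaced by the fact that a distance function on the
    line is locally affine off a null set. Subtracting [u_L] decouples the two sides of the slit:
    above and below, the remainder vanishes for [x < 0], where [u] itself joins the two sides. The
    operator may be nonlinear, so it is obtained by a choice that depends on the class of [u]
    only. *)

Section Integral.
Context d (T : measurableType d) (R : realType) (mu : {measure set T -> \bar R}).
Implicit Types f g : T -> R.

Lemma aeS (P Q : set T) : {ae mu, forall x, P x} -> (forall x, P x -> Q x) ->
  {ae mu, forall x, Q x}.
Proof. by move=> hP PQ; apply: filterS hP. Qed.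

Lemma aeS2 (P P' Q : set T) : {ae mu, forall x, P x} ->
  {ae mu, forall x, P' x} -> (forall x, P x -> P' x -> Q x) ->
  {ae mu, forall x, Q x}.
Proof. by move=> hP hP' PQ; apply: filterS2 hP hP'. Qed.

Lemma aeS3 (P P' P2 Q : set T) : {ae mu, forall x, P x} ->
  {ae mu, forall x, P' x} -> {ae mu, forall x, P2 x} ->
  (forall x, P x -> P' x -> P2 x -> Q x) ->
  {ae mu, forall x, Q x}.
Proof. by move=> hP hP' hP2 PQ; apply: filterS3 hP hP' hP2. Qed.

Definition L1 f := mu.-integrable setT (EFin \o f).
Definition Int f : R := Rintegral mu setT f.

Lemma L1_meas f : L1 f -> measurable_fun setT f.
Proof. by move=> /integrableP[/measurable_EFinP]. Qed.

Lemma L1_le f g : measurable_fun setT f -> L1 g ->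
  (forall x, `|f x| <= `|g x|) -> L1 f.
Proof.
move=> mf ig fg; apply: (le_integrable measurableT _ _ ig).
  exact/measurable_EFinP.
by move=> x _ /=; rewrite lee_fin.
Qed.

Lemma L1_ae_le f g : measurable_fun setT f -> L1 g ->
  {ae mu, forall x, `|f x| <= `|g x|} -> L1 f.
Proof.
move=> mf ig fg; apply/integrableP; split; first exact/measurable_EFinP.
move/integrableP : ig => [mg]; apply: le_lt_trans.
apply: ae_ge0_le_integral => //.
- by apply: measurableT_comp => //; exact/measurable_EFinP.
- by apply: measurableT_comp => //.
- by apply: filterS fg => x h _ /=; rewrite lee_fin.
Qed.

Lemma L1D f g : L1 f -> L1 g -> L1 (fun x => f x + g x).
Proof. by move=> hf hg; exact: (integrableD measurableT hf hg). Qed.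

Lemma L1N f : L1 f -> L1 (fun x => - f x).
Proof. by move=> /integrableN; apply: eq_integrable. Qed.

Lemma L1B f g : L1 f -> L1 g -> L1 (fun x => f x - g x).
Proof. by move=> hf hg; apply: L1D => //; exact: L1N. Qed.

Lemma L1Z k f : L1 f -> L1 (fun x => k * f x).
Proof.
by move=> hf; exact: (integrableZl measurableT k hf).
Qed.

Lemma L1_norm f : L1 f -> L1 (fun x => `|f x|).
Proof.
move=> hf; apply: (L1_le _ hf) => [|x]; last by rewrite normr_id.
by apply: measurableT_comp => //; exact: L1_meas.
Qed.

Lemma L1M f g M : L1 f -> measurable_fun setT g -> (forall x, `|g x| <= M) ->
  L1 (fun x => g x * f x).
Proof.
move=> hf mg gM; apply: (@L1_le _ (fun x => M * f x)); last first.
- move=> x; rewrite !normrM ler_wpM2r//; apply: le_trans (gM x) (ler_norm _).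
- exact: L1Z.
- by apply: measurable_funM => //; exact: L1_meas.
Qed.

Lemma L10 : L1 (cst 0).
Proof. exact: integrable0. Qed.

Lemma IntD f g : L1 f -> L1 g -> Int (fun x => f x + g x) = Int f + Int g.
Proof. by move=> hf hg; rewrite /Int RintegralD. Qed.

Lemma IntB f g : L1 f -> L1 g -> Int (fun x => f x - g x) = Int f - Int g.
Proof. by move=> hf hg; rewrite /Int RintegralB. Qed.

Lemma IntZ k f : L1 f -> Int (fun x => k * f x) = k * Int f.
Proof. by move=> hf; rewrite /Int RintegralZl. Qed.

Lemma IntN f : L1 f -> Int (fun x => - f x) = - Int f.
Proof.
move=> hf; rewrite -mulN1r -IntZ//; congr Int.
by apply/funext => x; rewrite mulN1r.
Qed.

Lemma Int0 : Int (cst 0) = 0.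
Proof. by rewrite /Int /Rintegral/= integral0. Qed.

Lemma Int_ge0 f : (forall x, 0 <= f x) -> 0 <= Int f.
Proof. by move=> f0; apply: Rintegral_ge0. Qed.

Lemma le_Int f g : L1 f -> L1 g -> (forall x, f x <= g x) -> Int f <= Int g.
Proof. by move=> hf hg fg; apply: le_Rintegral. Qed.

Lemma le_norm_Int f : L1 f -> `|Int f| <= Int (fun x => `|f x|).
Proof. by move=> hf; apply: le_normr_Rintegral. Qed.

Lemma EInt f : L1 f -> (\int[mu]_x (f x)%:E = (Int f)%:E)%E.
Proof. by move=> hf; rewrite /Int /Rintegral fineK//; exact: integrable_fin_num. Qed.

Lemma Int_ae f g : measurable_fun setT f -> measurable_fun setT g ->
  {ae mu, forall x, f x = g x} -> Int f = Int g.
Proof.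
move=> mf mg fg; rewrite /Int /Rintegral; congr fine.
apply: ae_eq_integral => //; [exact/measurable_EFinP|exact/measurable_EFinP|].
by apply: filterS fg => x /= -> _.
Qed.

Lemma L1_ae f g : L1 f -> measurable_fun setT g ->
  {ae mu, forall x, f x = g x} -> L1 g.
Proof.
by move=> hf mg fg; apply: (L1_ae_le mg hf); apply: filterS fg => x ->.
Qed.

Lemma Int_dct (f_ : nat -> T -> R) f g :
  (forall n, measurable_fun setT (f_ n)) -> measurable_fun setT f ->
  {ae mu, forall x, f_ ^~ x @ \oo --> f x} -> L1 g ->
  {ae mu, forall x n, `|f_ n x| <= g x} ->
  L1 f /\ (fun n => Int (f_ n)) @ \oo --> Int f.
Proof.
move=> mf_ mf ff ig fg.
have [] := @dominated_convergence _ _ _ mu _ measurableT (fun n x => (f_ n x)%:E)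
  (fun x => (f x)%:E) (fun x => (g x)%:E).
- by move=> n; apply/measurable_EFinP.
- exact/measurable_EFinP.
- by apply: filterS ff => x h _; apply: cvg_EFin => //; exact: nearW.
- exact: ig.
- by apply: filterS fg => x h n _; rewrite lee_fin.
move=> i _ h; split=> //; rewrite /Int /Rintegral.
apply: fine_cvg; rewrite fineK//; exact: integrable_fin_num.
Qed.

End Integral.

(** * Fubini, reflections and the coordinate swap in the plane *)

Section Plane.
Context (R : realType).
Local Notation T1 := (measurableTypeR R).
Local Notation lm := (@lebesgue_measure R).
Local Notation mu2 := (mu2 R).
Implicit Types f g : R * R -> R.

Lemma nbhs_boxP (x y : R) (A : set (R * R)) : nbhs (x, y) A <->
  exists2 r : R, 0 < r & forall x' y', `|x - x'| < r -> `|y - y'| < r -> A (x', y').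
Proof.
split=> [/nbhs_ballP[r /= r0 rA]|[r r0 rA]].
  by exists r => // x' y' hx hy; apply: rA.
by apply/nbhs_ballP; exists r => //= -[x' y'] [/= hx hy]; exact: rA.
Qed.

(** The measurable sets here are those of the product structure; an open set is the countable union
    of the rational boxes that it contains. *)
Lemma open2_measurable (A : set (R * R)) : open A ->
  measurable (A : set (T1 * T1)).
Proof.
move=> oA.
pose box (a b c e : rat) : set (T1 * T1) :=
  `]ratr a, ratr b[%classic `*` `]ratr c, ratr e[%classic.
pose D a b c e := if pselect (box a b c e `<=` A) then box a b c e else set0.
have -> : A = \bigcup_a \bigcup_b \bigcup_c \bigcup_e D a b c e.
  apply/seteqP; split => [[x y] Axy|z [a _ [b _ [c _ [e _]]]]]; last first.
    by rewrite /D; case: pselect => // h /h.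
  have : nbhs (x, y) A by apply: open_nbhs_nbhs.
  move=> /nbhs_boxP[r r0 rA].
  have rat_btw (s : R) : exists a b : rat, s - r < ratr a < s /\ s < ratr b < s + r.
    have : s - r < s by lra.
    move=> /rat_in_itvoo[a]; rewrite in_itv/= => ha.
    have : s < s + r by lra.
    move=> /rat_in_itvoo[b]; rewrite in_itv/= => hb.
    by exists a, b.
  have [a [b [/andP[a1 a2] /andP[b1 b2]]]] := rat_btw x.
  have [c [e [/andP[c1 c2] /andP[e1 e2]]]] := rat_btw y.
  exists a => //; exists b => //; exists c => //; exists e => //.
  rewrite /D; case: pselect => h; first by split; rewrite /= in_itv/= ?a2 ?c2.
  exfalso; apply: h => -[x' y'] [/=]; rewrite !in_itv/= => /andP[? ?] /andP[? ?].
  by apply: rA; rewrite ltr_norml; lra.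
have mD a b c e : measurable (D a b c e).
  rewrite /D; case: pselect => /= [_|_ //].
  by apply: measurableX; exact: measurable_itv.
by do 4 (apply: bigcupT_measurable_rat; intro).
Qed.

Lemma closed2_measurable (A : set (R * R)) : closed A ->
  measurable (A : set (T1 * T1)).
Proof. by move/closed_openC/open2_measurable/measurableC; rewrite setCK. Qed.

Lemma compact2_measurable (A : set (R * R)) : compact A ->
  measurable (A : set (T1 * T1)).
Proof.
by move=> /compact_closed h; apply: closed2_measurable; apply: h; exact: norm_hausdorff.
Qed.

Lemma cont2_measurable f : continuous f -> measurable_fun setT (f : T1 * T1 -> R).
Proof.
move=> /continuousP cf; apply: (measurability _ (RGenOpens.measurableE R)).
move=> _ [_ [a [b ->] <-]]; rewrite setTI.
by apply: open2_measurable; apply: cf; exact: interval_open.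
Qed.

Lemma fibx_measurable f x : measurable_fun setT (f : T1 * T1 -> R) ->
  measurable_fun setT (fun y : T1 => f (x, y)).
Proof. by move=> mf; exact: measurableT_comp. Qed.

Lemma L1_fiber f : L1 mu2 f -> {ae lm, forall x, L1 lm (fun y => f (x, y))}.
Proof. by move=> hf; exact: (ae_integrable1 hf). Qed.

Lemma L1_marg f : L1 mu2 f -> L1 lm (fun x => Int lm (fun y => f (x, y))).
Proof.
move=> hf; have h := integrable_fubini_F hf.
apply/integrableP; split.
  apply/measurable_EFinP; apply: measurableT_comp (measurable_int _ h) => //.
move/integrableP : h => [mF]; apply: le_lt_trans.
apply: ge0_le_integral => //.
- by apply: measurableT_comp => //; apply/measurable_EFinP; apply: measurableT_comp mF.
- by apply: measurableT_comp.
move=> x _ /=; rewrite /Int /Rintegral /fubini_F/=.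
by case: (\int[_]_y _)%E => [r||] //=; rewrite leey.
Qed.

Lemma Int2 f : L1 mu2 f -> Int mu2 f = Int lm (fun x => Int lm (fun y => f (x, y))).
Proof.
move=> hf; rewrite {1}/Int /Rintegral -(integral12_prod_meas1 hf).
congr fine; apply: ae_eq_integral => //.
- exact: measurable_fubini_F hf.
- by apply/measurable_EFinP; exact: L1_meas (L1_marg hf).
apply: (aeS (integrable_ae measurableT (integrable_fubini_F hf))) => x h _ /=.
by rewrite /Int /Rintegral fineK//; apply: h.
Qed.

Lemma L1_tonelli f (g : R -> R) : measurable_fun setT (f : T1 * T1 -> R) ->
  {ae lm, forall x, L1 lm (fun y => f (x, y))} -> L1 lm g ->
  {ae lm, forall x, Int lm (fun y => `|f (x, y)|) <= g x} -> L1 mu2 f.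
Proof.
move=> mf ff ig fg; have mf' := (measurable_EFinP _ _).2 mf.
apply/(integrable12ltyP lm lm mf').
move/integrableP : ig => [mg]; apply: le_lt_trans.
have mff : measurable_fun setT (abse \o (EFin \o f) : T1 * T1 -> \bar R).
  exact: measurableT_comp.
apply: ae_ge0_le_integral => //.
- by move=> x _; apply: integral_ge0.
- by apply: (@measurable_fun_fubini_tonelli_F _ _ _ _ _ lm (abse \o (EFin \o f)) mff) => z; exact: abse_ge0.
- exact: measurableT_comp.
- apply: (aeS2 ff fg) => x h1 h2 _ /=.
  rewrite (EInt (L1_norm h1)) lee_fin; exact: le_trans (ler_norm _).
Qed.

(** Tonelli: the integral of [|f|] is an iterated integral whose inner part vanishes for almost
    every [x]. *)
Lemma fiber_ae0 f : measurable_fun setT (f : T1 * T1 -> R) ->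
  {ae lm, forall x, {ae lm, forall y, f (x, y) = 0}} ->
  {ae mu2, forall z, f z = 0}.
Proof.
move=> mf h.
suff : ae_eq mu2 setT (EFin \o f) (cst 0%E).
  by move=> h1; apply: (aeS h1) => z /(_ Logic.I) [].
have mf' : measurable_fun setT (EFin \o f : T1 * T1 -> \bar R) by exact/measurable_EFinP.
apply/(ae_eq_integral_abs mu2 measurableT) => //.
have mff : measurable_fun setT (abse \o (EFin \o f) : T1 * T1 -> \bar R).
  exact: measurableT_comp.
rewrite [LHS](@fubini_tonelli1 _ _ _ _ _ lm lm _ mff)//.
rewrite (ae_eq_integral (cst 0%E)) ?integral0//.
  by apply: (@measurable_fun_fubini_tonelli_F _ _ _ _ _ lm _ mff) => z; exact: abse_ge0.
apply: (aeS h) => x hx _; rewrite /fubini_F/=.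
rewrite (ae_eq_integral (cst 0%E)) ?integral0//.
  apply/measurable_EFinP; exact: (measurableT_comp (@normr_measurable R setT) (fibx_measurable x mf)).
by apply: (aeS hx) => y /= -> _; rewrite normr0.
by move=> z; exact: abse_ge0.
Qed.

Lemma ae_fstP (A : set R) : {ae lm, forall x, A x} -> {ae mu2, forall z, A z.1}.
Proof.
move=> [N [mN N0 AN]]; exists (N `*` setT); split.
- exact: measurableX.
- by rewrite [LHS](product_measure1E lm lm mN measurableT) [X in (X * _)%E]N0 mul0e.
- by move=> z /= h; split => //; apply: AN.
Qed.

Lemma ge0_integral_preserving d (T : measurableType d)
    (mu : {measure set T -> \bar R}) (phi : T -> T) (f : T -> \bar R) :
  measurable_fun setT phi -> (forall A, measurable A -> mu (phi @^-1` A) = mu A) ->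
  measurable_fun setT f -> (forall y, 0 <= f y)%E ->
  (\int[mu]_y f (phi y) = \int[mu]_y f y)%E.
Proof.
move=> mphi pmu mf f0.
have := @ge0_integral_pushforward _ _ _ _ _ _ mphi mu setT f measurableT mf.
rewrite preimage_setT => <- //.
by apply: eq_measure_integral => A mA _; rewrite -(pmu _ mA).
Qed.

(** By uniqueness of Lebesgue measure it suffices to compare half-open intervals; a reflected one is
    closed at the other end but has the same length. *)
Lemma lebesgue_measure_refl (c : R) (A : set T1) : measurable A ->
  lm ((fun y => c - y) @^-1` A) = lm A.
Proof.
move=> mA.
have mphi : measurable_fun setT ((fun y => c - y) : T1 -> T1).
  by apply: measurable_funB.
pose phi_mixin := isMeasurableFun.Build _ _ _ _ _ mphi.
pose phi : {mfun T1 >-> T1} := HB.pack ((fun y => c - y) : T1 -> T1) phi_mixin.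
apply/esym/(@lebesgue_measure_unique _ (pushforward lm phi)) => //= _ [[a b]] _ <-.
rewrite /pushforward (_ : _ @^-1` _ = `[c - b, c - a[%classic); last first.
  by apply/seteqP; split => x /=; rewrite !in_itv/=; lra.
rewrite !lebesgue_measure_itv/= !lte_fin.
have -> : (c - b < c - a) = (a < b) by rewrite ltrD2l ltrN2.
by case: ifP => // _; congr EFin; ring.
Qed.

Definition refl (F : R -> R) (z : R * R) : R * R := (z.1, 2 * F z.1 - z.2).

Lemma measurable_refl (F : R -> R) : measurable_fun setT (F : T1 -> R) ->
  measurable_fun setT (refl F : T1 * T1 -> T1 * T1).
Proof.
move=> mF; apply: measurable_fun_pair => //.
apply: measurable_funB => //; apply: measurable_funM => //.
exact: measurableT_comp.
Qed.

(** On each vertical line [refl F] is a reflection of that line, so the sections keep their length;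
    the regularity of [F] in [x] does not enter. *)
Lemma refl_mu2 (F : R -> R) (A : set (T1 * T1)) : measurable_fun setT (F : T1 -> R) ->
  measurable A -> mu2 (refl F @^-1` A) = mu2 A.
Proof.
move=> mF mA; rewrite /mu2 /product_measure1; apply: eq_integral => x _ /=.
rewrite -[RHS](lebesgue_measure_refl (2 * F x)); last exact: measurable_xsection.
by congr lm; apply/seteqP; split => y; rewrite /xsection/= !inE.
Qed.

Lemma L1_refl (F : R -> R) f : measurable_fun setT (F : T1 -> R) ->
  L1 mu2 f -> L1 mu2 (fun z => f (refl F z)).
Proof.
move=> mF hf; have mr := measurable_refl mF; have mf := L1_meas hf.
apply/integrableP; split.
  by apply/measurable_EFinP; exact: (measurableT_comp mf mr).
move/integrableP : hf => [mf']; apply: le_lt_trans.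
rewrite (@ge0_integral_preserving _ _ mu2 (refl F) (fun z => `|(f z)%:E|)%E)//.
- by move=> A mA; apply: refl_mu2.
- exact: measurableT_comp.
Qed.

Lemma Int_refl (F : R -> R) f : measurable_fun setT (F : T1 -> R) ->
  L1 mu2 f -> Int mu2 (fun z => f (refl F z)) = Int mu2 f.
Proof.
move=> mF hf; have mr := measurable_refl mF; have mf := L1_meas hf.
have h0 g : L1 mu2 g -> (forall z, 0 <= g z) ->
    Int mu2 (fun z => g (refl F z)) = Int mu2 g.
  move=> hg g0; rewrite /Int /Rintegral; congr fine.
  apply: (@ge0_integral_preserving _ _ mu2 (refl F) (EFin \o g)) => //.
  - by move=> A mA; apply: refl_mu2.
  - by apply/measurable_EFinP; exact: (L1_meas hg).
have hn := L1_norm hf.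
have hp : L1 mu2 (fun z => `|f z| + f z) by exact: L1D.
(* Invariance is known for nonnegative integrands, and [g] is the difference of [|g| + g] and
   [|g|]. *)
have e g : L1 mu2 g -> Int mu2 g = Int mu2 (fun z => `|g z| + g z) - Int mu2 (fun z => `|g z|).
  move=> hg; have hgn := L1_norm hg.
  rewrite -IntB//; last exact: L1D.
  by congr Int; apply/funext => z; rewrite addrC addKr.
rewrite (e _ hf) (e _ (L1_refl mF hf)).
rewrite (h0 (fun z => `|f z| + f z)) ?(h0 (fun z => `|f z|))// => z.
by have := ler_norm (- f z); rewrite normrN; lra.
Qed.

Definition swp (z : R * R) : R * R := (z.2, z.1).

Lemma measurable_swp : measurable_fun setT (swp : T1 * T1 -> T1 * T1).
Proof. by apply: measurable_fun_pair. Qed.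

(** The two orders of integration in Tonelli's theorem differ by the swap. *)
Lemma ge0_integral_swp (f : T1 * T1 -> \bar R) :
  measurable_fun setT f -> (forall y, 0 <= f y)%E ->
  (\int[mu2]_y f (swp y) = \int[mu2]_y f y)%E.
Proof.
move=> mf f0; rewrite [RHS](@fubini_tonelli1 _ _ _ _ _ lm lm _ mf)//.
have mfs := measurableT_comp mf measurable_swp.
by rewrite [LHS](@fubini_tonelli2 _ _ _ _ _ lm lm _ mfs)// => z; exact: f0.
Qed.

Lemma L1_swp f : L1 mu2 f -> L1 mu2 (fun z => f (swp z)).
Proof.
move=> hf; have mr := measurable_swp; have mf := L1_meas hf.
apply/integrableP; split.
  by apply/measurable_EFinP; exact: (measurableT_comp mf mr).
move/integrableP : hf => [mf']; apply: le_lt_trans.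
rewrite (@ge0_integral_swp (fun z => `|(f z)%:E|)%E)//; exact: measurableT_comp.
Qed.

Lemma Int_swp f : L1 mu2 f -> Int mu2 (fun z => f (swp z)) = Int mu2 f.
Proof.
move=> hf; rewrite /Int /Rintegral -(integral12_prod_meas1 hf).
by rewrite -(integral21_prod_meas1 (L1_swp hf)).
Qed.

End Plane.

(** * Smooth functions and mollification *)

Section Smooth.
Context (R : realType).
Local Notation e1 := (e1 R).
Local Notation e2 := (e2 R).

Lemma is_derive_cvgP (V : normedModType R) (f : V -> R) (x v : V) (l : R) :
  is_derive x v f l <->
  h^-1 * (f (h *: v + x) - f x) @[h --> 0^'] --> l.
Proof.
split=> [[df <-]|h]; first exact: df.
have df : derivable f x v by apply/cvg_ex; exists l.
by apply: DeriveDef => //; apply/cvg_lim.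
Qed.

(** Moves a directional derivative to one variable, where the chain rule and the mean value theorem
    are available; the partial derivatives are the case of lines through an axis. *)
Lemma is_derive_line (V : normedModType R) (f : V -> R) (x v : V) (l : R) (t : R) :
  is_derive (t *: v + x) v f l <-> is_derive t (1:R) (fun s : R => f (s *: v + x)) l.
Proof.
rewrite !is_derive_cvgP; split; apply: cvg_trans; apply: near_eq_cvg;
  near=> h;
  by rewrite (_ : h *: (1 : R) = h) ?scalerDl ?addrA//; exact: mulr1.
Unshelve. all: by end_near. Qed.

Lemma is_derive_cvg_line (V : normedModType R) (f : V -> R) (x v : V) (l : R) :
  is_derive x v f l -> f (h *: v + x) @[h --> 0^'] --> f x.
Proof.
move=> h; have /is_derive_line : is_derive (0 *: v + x) v f l by rewrite scale0r add0r.
move=> [/derivable1_diffP/differentiable_continuous + _].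
move=> /(_ _); rewrite /continuous_at scale0r add0r => h1.
by move=> A /h1; exact: nbhs_dnbhs.
Qed.

Lemma e1_line (t : R) (w : R * R) : t *: e1 + w = (t + w.1, w.2).
Proof.
rewrite [LHS]surjective_pairing; congr pair => /=; last by rewrite scaler0 add0r.
by congr (_ + _); exact: mulr1.
Qed.

Lemma e2_line (t : R) (w : R * R) : t *: e2 + w = (w.1, t + w.2).
Proof.
rewrite [LHS]surjective_pairing; congr pair => /=; first by rewrite scaler0 add0r.
by congr (_ + _); exact: mulr1.
Qed.

Lemma is_derive_e1 (f : R * R -> R) (w : R * R) l :
  is_derive w e1 f l <-> is_derive w.1 (1:R) (fun x => f (x, w.2)) l.
Proof.
rewrite -{1}[w](_ : w.1 *: e1 + (0, w.2) = w); last first.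
  by rewrite e1_line addr0; case: w.
rewrite is_derive_line; suff -> : (fun s => f (s *: e1 + (0, w.2))) = fun x => f (x, w.2) by [].
by apply/funext => s; rewrite e1_line addr0.
Qed.

Lemma is_derive_e2 (f : R * R -> R) (w : R * R) l :
  is_derive w e2 f l <-> is_derive w.2 (1:R) (fun y => f (w.1, y)) l.
Proof.
rewrite -{1}[w](_ : w.2 *: e2 + (w.1, 0) = w); last first.
  by rewrite e2_line addr0; case: w.
rewrite is_derive_line; suff -> : (fun s => f (s *: e2 + (w.1, 0))) = fun x => f (w.1, x) by [].
by apply/funext => s; rewrite e2_line addr0.
Qed.

Lemma MVT1 (f df : R -> R) (a b : R) : (forall x, is_derive x (1:R) f (df x)) ->
  exists2 c, `|c - a| <= `|b - a| & f b - f a = df c * (b - a).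
Proof.
move=> h.
have cf (i : interval R) : {within [set` i], continuous f}.
  apply: continuous_subspaceT => x.
  by apply: differentiable_continuous; apply/derivable1_diffP; case: (h x).
have [ab|ba] := leP a b.
  have [c hc E] := MVT_segment ab (fun x _ => h x) (cf `[a, b]).
  by exists c => //; move: hc; rewrite in_itv/= => hc; rewrite !ger0_norm; lra.
have [c hc E] := MVT_segment (ltW ba) (fun x _ => h x) (cf `[b, a]).
exists c; first by move: hc; rewrite in_itv/= => hc; rewrite !ler0_norm; lra.
by rewrite -opprB E -mulrN opprB.
Qed.

(* A partial difference quotient of a C^1 function is continuous when extended by
   the partial derivative on the diagonal: this gives the chain rule without
   passing through the Frechet differential. *)
Lemma is_derive_comp2 (V : normedModType R) (phi phi1 phi2 : R * R -> R)
    (p q : V -> R) (z v : V) dp dq :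
  (forall w, is_derive w e1 phi (phi1 w)) -> continuous phi1 ->
  (forall w, is_derive w e2 phi (phi2 w)) ->
  is_derive z v p dp -> is_derive z v q dq ->
  is_derive z v (fun z => phi (p z, q z))
    (phi1 (p z, q z) * dp + phi2 (p z, q z) * dq).
Proof.
move=> h1 c1 h2 hp hq.
pose theta (w : R * R) := if w.1 == p z then phi1 w
  else (phi w - phi (p z, w.2)) / (w.1 - p z).
have thetaE w : phi w - phi (p z, w.2) = theta w * (w.1 - p z).
  rewrite /theta; case: eqP => [<-|/eqP ne]; first by rewrite -surjective_pairing !subrr mulr0.
  by rewrite divfK// subr_eq0.
have ctheta : theta w @[w --> (p z, q z)] --> phi1 (p z, q z).
  apply/cvgrPdist_lt => e e0.
  have /cvgrPdist_lt/(_ _ e0)/nbhs_boxP[r r0 hr] := c1 (p z, q z).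
  apply/nbhs_boxP; exists r => // x y hx hy.
  rewrite /theta/=; case: eqP => [->|/eqP ne]; first by apply: hr => //; rewrite subrr normr0.
  have [c cle ->] := @MVT1 (fun s => phi (s, y)) (fun s => phi1 (s, y)) (p z) x
    (fun s => (is_derive_e1 phi (s, y) _).1 (h1 (s, y))).
  rewrite mulfK ?subr_eq0//; apply: hr => //.
  by rewrite distrC; apply: le_lt_trans cle _; rewrite distrC.
apply/is_derive_cvgP.
have hpl := is_derive_cvg_line hp; have hql := is_derive_cvg_line hq.
have hq' : is_derive z v (fun z' => phi (p z, q z')) (phi2 (p z, q z) * dq).
  have := (is_derive_e2 phi (p z, q z) _).1 (h2 (p z, q z)) => /= hb.
  have z0 : 0 *: v + z = z by rewrite scale0r add0r.
  rewrite -{1}z0; apply/is_derive_line.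
  apply: (@is_derive1_comp _ (fun y => phi (p z, y)) (fun s => q (s *: v + z))).
    by rewrite z0.
  have hq0 : is_derive (0 *: v + z) v q dq by rewrite z0.
  exact: ((is_derive_line q z v dq 0).1 hq0).
have cth : theta (p (h *: v + z), q (h *: v + z)) @[h --> 0^'] --> phi1 (p z, q z).
  apply: (@cvg_comp _ _ _ (fun h => (p (h *: v + z), q (h *: v + z))) theta _ _ _ _ ctheta).
  exact: (cvg_pair hpl hql).
have hc := cvgD (cvgM cth ((is_derive_cvgP _ _ _ _).1 hp)) ((is_derive_cvgP _ _ _ _).1 hq').
rewrite (_ : (fun h => _) = (fun h =>
  theta (p (h *: v + z), q (h *: v + z)) * (h^-1 * (p (h *: v + z) - p z)) +
  h^-1 * (phi (p z, q (h *: v + z)) - phi (p z, q z)))); first exact: hc.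
apply/funext => h; rewrite mulrCA -thetaE/= -mulrDr; congr (_ * _).
by rewrite addrA subrK.
Qed.

Definition smooth2 (phi : R * R -> R) := forall k, Ck k phi.

(* [g] is C^infinity: it lies in a set of functions closed under differentiation. *)
Definition smooth1 (g : R -> R) := exists2 S : set (R -> R), S g &
  forall f, S f -> exists2 f', S f' & forall x, is_derive x (1:R) f (f' x).

Lemma smooth1_derive g : smooth1 g ->
  exists2 g', smooth1 g' & forall x, is_derive x (1:R) g (g' x).
Proof. by move=> [S Sg hS]; have [g' Sg' h] := hS _ Sg; exists g' => //; exists S. Qed.

Lemma smooth1_derivable g x : smooth1 g -> is_derive x (1:R) g ((derive1 g) x).
Proof.
move=> /smooth1_derive[g' _ h]; rewrite derive1E; case: (h x) => d _.
exact: derivableP.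
Qed.

Lemma smooth1_derive1 g : smooth1 g -> smooth1 (derive1 g).
Proof.
move=> /smooth1_derive[g' s h]; suff -> : (derive1 g) = g' by [].
by apply/funext => x; rewrite derive1E; case: (h x).
Qed.

Lemma smooth1_continuous g : smooth1 g -> continuous g.
Proof.
move=> sg x; apply: differentiable_continuous; apply/derivable1_diffP.
by case: (smooth1_derivable x sg).
Qed.

Lemma smooth2_continuous phi : smooth2 phi -> continuous phi.
Proof. by move=> h; exact: (h 0%N). Qed.

Lemma smooth2_D1 phi : smooth2 phi -> smooth2 ('D_e1 phi).
Proof. by move=> h k; have [] := h k.+1. Qed.

Lemma smooth2_D2 phi : smooth2 phi -> smooth2 ('D_e2 phi).
Proof. by move=> h k; have [] := h k.+1. Qed.

Lemma smooth2_derive1 phi z : smooth2 phi -> is_derive z e1 phi ('D_e1 phi z).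
Proof. by move=> h; have [] := h 1%N => _ h1 _ _ _; exact: derivableP. Qed.

Lemma smooth2_derive2 phi z : smooth2 phi -> is_derive z e2 phi ('D_e2 phi z).
Proof. by move=> h; have [] := h 1%N => _ _ h1 _ _; exact: derivableP. Qed.

(** A syntax of smooth functions. Both partial derivatives of a member are members again
    ([Sm_derive]), so that all the conditions [Ck k] follow by one induction on [k], without
    formulas for higher derivatives. *)
Inductive Sm : (R * R -> R) -> Prop :=
| Sm_smooth2 phi : smooth2 phi -> Sm phi
| Sm_cst c : Sm (cst c)
| Sm_fst : Sm fst
| Sm_snd : Sm snd
| Sm_add f g : Sm f -> Sm g -> Sm (fun z => f z + g z)
| Sm_mul f g : Sm f -> Sm g -> Sm (fun z => f z * g z)
| Sm_inv f : (forall z, f z != 0) -> Sm f -> Sm (fun z => (f z)^-1)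
| Sm_comp1 g f : smooth1 g -> Sm f -> Sm (fun z => g (f z))
| Sm_comp2 phi p q : smooth2 phi -> Sm p -> Sm q -> Sm (fun z => phi (p z, q z)).

Lemma Sm_continuous f : Sm f -> continuous f.
Proof.
elim=> {f}.
- by move=> phi; exact: smooth2_continuous.
- by move=> c; exact: cst_continuous.
- by move=> z; exact: cvg_fst.
- by move=> z; exact: cvg_snd.
- by move=> f g _ cf _ cg z; apply: cvgD; [exact: cf|exact: cg].
- by move=> f g _ cf _ cg z; apply: cvgM; [exact: cf|exact: cg].
- by move=> f f0 _ cf z; apply: cvgV; [exact: f0|exact: cf].
- by move=> g f sg _ cf z; apply: continuous_comp; [exact: cf|exact: smooth1_continuous].
- move=> phi p q sphi _ cp _ cq z.
  apply: (@continuous_comp _ _ _ (fun z => (p z, q z)) phi).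
    exact: (cvg_pair (cp z) (cq z)).
  exact: smooth2_continuous.
Qed.

Lemma Sm_derive f : Sm f -> exists f1 f2 : R * R -> R, [/\ Sm f1, Sm f2,
  forall z, is_derive z e1 f (f1 z) & forall z, is_derive z e2 f (f2 z)].
Proof.
elim=> {f}.
- move=> phi h; exists ('D_e1 phi), ('D_e2 phi); split.
  + exact/Sm_smooth2/smooth2_D1.
  + exact/Sm_smooth2/smooth2_D2.
  + by move=> z; exact: smooth2_derive1.
  + by move=> z; exact: smooth2_derive2.
- by move=> c; exists (cst 0), (cst 0); split; try exact: Sm_cst; move=> z; exact: is_derive_cst.
- exists (cst 1), (cst 0); split; try exact: Sm_cst; move=> z; rewrite /cst.
  + by apply/is_derive_e1; exact: is_derive_id.
  + by apply/is_derive_e2; exact: is_derive_cst.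
- exists (cst 0), (cst 1); split; try exact: Sm_cst; move=> z; rewrite /cst.
  + by apply/is_derive_e1; exact: is_derive_cst.
  + by apply/is_derive_e2; exact: is_derive_id.
- move=> f g _ [f1 [f2 [? ? hf1 hf2]]] _ [g1 [g2 [? ? hg1 hg2]]].
  exists (fun z => f1 z + g1 z), (fun z => f2 z + g2 z); split; try exact: Sm_add.
  + by move=> z; exact: (is_deriveD (hf1 z) (hg1 z)).
  + by move=> z; exact: (is_deriveD (hf2 z) (hg2 z)).
- move=> f g sf [f1 [f2 [? ? hf1 hf2]]] sg [g1 [g2 [? ? hg1 hg2]]].
  exists (fun z => f z * g1 z + g z * f1 z), (fun z => f z * g2 z + g z * f2 z).
  split; try by apply: Sm_add; exact: Sm_mul.
  + by move=> z; exact: (is_deriveM (hf1 z) (hg1 z)).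
  + by move=> z; exact: (is_deriveM (hf2 z) (hg2 z)).
- move=> f f0 sf [f1 [f2 [? ? hf1 hf2]]].
  exists (fun z => -1 * ((f z)^-1 * (f z)^-1 * f1 z)), (fun z => -1 * ((f z)^-1 * (f z)^-1 * f2 z)).
  split; try by do ?apply: Sm_mul => //; (exact: Sm_cst || exact: Sm_inv).
  + move=> z; apply/is_derive_e1; have := (is_derive_e1 _ _ _).1 (hf1 z) => h.
    have hne : f (z.1, z.2) != 0 := f0 _.
    have := @is_deriveV _ (fun x => f (x, z.2)) _ _ _ hne h => /is_derive_eq; apply.
    by rewrite -surjective_pairing mulN1r -invfM -expr2 scaleNr.
  + move=> z; apply/is_derive_e2; have := (is_derive_e2 _ _ _).1 (hf2 z) => h.
    have hne : f (z.1, z.2) != 0 := f0 _.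
    have := @is_deriveV _ (fun x => f (z.1, x)) _ _ _ hne h => /is_derive_eq; apply.
    by rewrite -surjective_pairing mulN1r -invfM -expr2 scaleNr.
- move=> g f sg sf [f1 [f2 [? ? hf1 hf2]]].
  exists (fun z => (derive1 g) (f z) * f1 z), (fun z => (derive1 g) (f z) * f2 z); split.
  + by apply: Sm_mul => //; apply: Sm_comp1 => //; exact: smooth1_derive1.
  + by apply: Sm_mul => //; apply: Sm_comp1 => //; exact: smooth1_derive1.
  + move=> z; apply/is_derive_e1; have := (is_derive_e1 _ _ _).1 (hf1 z) => h.
    apply: (@is_derive1_comp _ g (fun x => f (x, z.2))) => //.
    rewrite -surjective_pairing; exact: (smooth1_derivable (f z) sg).
  + move=> z; apply/is_derive_e2; have := (is_derive_e2 _ _ _).1 (hf2 z) => h.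
    apply: (@is_derive1_comp _ g (fun x => f (z.1, x))) => //.
    rewrite -surjective_pairing; exact: (smooth1_derivable (f z) sg).
- move=> phi p q sphi sp [p1 [p2 [? ? hp1 hp2]]] sq [q1 [q2 [? ? hq1 hq2]]].
  exists (fun z => 'D_e1 phi (p z, q z) * p1 z + 'D_e2 phi (p z, q z) * q1 z),
    (fun z => 'D_e1 phi (p z, q z) * p2 z + 'D_e2 phi (p z, q z) * q2 z); split.
  + apply: Sm_add; (apply: Sm_mul; last done).
    * exact: (Sm_comp2 (smooth2_D1 sphi) sp sq).
    * exact: (Sm_comp2 (smooth2_D2 sphi) sp sq).
  + apply: Sm_add; (apply: Sm_mul; last done).
    * exact: (Sm_comp2 (smooth2_D1 sphi) sp sq).
    * exact: (Sm_comp2 (smooth2_D2 sphi) sp sq).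
  + move=> z; exact: (is_derive_comp2 (fun w => smooth2_derive1 w sphi)
      (smooth2_continuous (smooth2_D1 sphi)) (fun w => smooth2_derive2 w sphi) (hp1 z) (hq1 z)).
  + move=> z; exact: (is_derive_comp2 (fun w => smooth2_derive1 w sphi)
      (smooth2_continuous (smooth2_D1 sphi)) (fun w => smooth2_derive2 w sphi) (hp2 z) (hq2 z)).
Qed.

Lemma Sm_Ck f : Sm f -> smooth2 f.
Proof.
move=> sf k; elim: k f sf => [|k IH] f sf /=; first exact: Sm_continuous.
have [f1 [f2 [s1 s2 h1 h2]]] := Sm_derive sf.
have -> : 'D_e1 f = f1 by apply/funext => z; case: (h1 z).
have -> : 'D_e2 f = f2 by apply/funext => z; case: (h2 z).
split; [exact: Sm_continuous| | |exact: IH|exact: IH].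
- by move=> z; case: (h1 z).
- by move=> z; case: (h2 z).
Qed.

End Smooth.

(** * A smooth step function *)

Section Step.
Context (R : realType).
Implicit Types (x y : R) (p : {poly R}).

Lemma near_lt x a : x < a -> \forall y \near x, y < a.
Proof. by move=> xa; apply: (open_nbhs_nbhs (conj (@open_lt R a) xa)). Qed.

Lemma near_gt x a : a < x -> \forall y \near x, a < y.
Proof. by move=> xa; apply: (open_nbhs_nbhs (conj (@open_gt R a) xa)). Qed.

(** The power [n] is universally quantified so that the induction on [p] can absorb the factor [y]
    of each new monomial; the constant term is controlled by the exponential series. With [n = 2]
    this makes [pflat p] differentiable at 0. *)
Lemma poly_le_expR p n : exists2 K, 0 <= K & forall y, 1 <= y -> `|p.[y]| * y ^+ n <= K * expR y.
Proof.
elim/poly_ind: p n => [|p c IH] n; first by exists 0 => // y _; rewrite horner0 normr0 !mul0r.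
have [K K0 hK] := IH n.+1.
exists (K + `|c| * n.+1`!%:R).
  by rewrite addr_ge0// mulr_ge0.
move=> y y1; have y0 : 0 <= y by lra.
rewrite hornerMXaddC; apply: (@le_trans _ _ ((`|p.[y]| * y + `|c|) * y ^+ n)).
  rewrite ler_wpM2r ?exprn_ge0//; apply: le_trans (ler_normD _ _) _.
  by rewrite normrM (ger0_norm y0).
rewrite !mulrDl -mulrA -exprS lerD ?hK//.
rewrite -mulrA ler_wpM2l//.
have := expR_ge1Dxn n y0 => h.
have h2 : y ^+ n.+1 <= n.+1`!%:R * expR y.
  rewrite mulrC -ler_pdivrMr ?ltr0n ?fact_gt0//; apply: le_trans h; lra.
by apply: le_trans h2; rewrite exprS ler_peMl// exprn_ge0.
Qed.

(** The classical flat function [exp (- 1 / x)], multiplied by a polynomial in [1 / x] so that the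
    family is closed under differentiation: differentiating replaces [p] by [X^2 (p - p')]. *)
Definition pflat p x := if 0 < x then p.[x^-1] * expR (- x^-1) else 0.

Lemma is_derive_pflat p x :
  is_derive x (1:R) (pflat p) (pflat ('X^2 * (p^`() - p) * -1) x).
Proof.
have [x0|x0|x0] := ltgtP 0 x.
- pose g (y : R) := p.[y^-1] * expR (- y^-1).
  have xn0 : x != 0 by rewrite gt_eqF.
  have hV := @is_deriveV R id x 1 1 xn0 (is_derive_id _ _).
  have hh y : is_derive y (1:R) (horner p) (p^`().[y]).
    have -> : p^`().[y] = derive1 (horner p) y by rewrite -derivE.
    by rewrite derive1E; apply: derivableP; exact: derivable_horner.
  have hp : is_derive x (1:R) (fun y => p.[y^-1]) (p^`().[x^-1] * (- x ^- 2 *: 1)).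
    apply: (@is_derive1_comp _ (horner p) (fun y => y^-1)) => //.
  have he : is_derive x (1:R) (fun y => expR (- y^-1)) (expR (- x^-1) * (- (- x ^- 2 *: 1))).
    exact: (@is_derive1_comp _ expR (fun y => - y^-1)).
  have hg := is_deriveM hp he.
  apply: (@near_eq_is_derive _ _ _ g).
    near=> y; rewrite /pflat/g ifT//; near: y; exact: near_gt.
  move/is_derive_eq : hg; apply.
  rewrite /pflat x0 !hornerE -exprVn.
  rewrite /GRing.scale/=; ring.
- apply: (@near_eq_is_derive _ _ _ (cst 0)).
    near=> y; rewrite /pflat ifF//; apply/negbTE; rewrite -leNgt; apply: ltW; near: y; exact: near_lt.
  rewrite /pflat ifF; first exact: is_derive_cst.
  by apply/negbTE; rewrite -leNgt ltW.
- rewrite -x0; apply/is_derive_cvgP.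
  have p0 q : pflat q 0 = 0 by rewrite /pflat ltxx.
  rewrite !p0.
  have [K K0 hK] := poly_le_expR p 2.
  apply/cvgrPdist_le => e e0; near=> h.
  rewrite sub0r normrN (_ : h *: (1 : R) = h) ?addr0; last exact: mulr1.
  rewrite subr0 /pflat; case: ifPn => [h0|_]; last by rewrite mulr0 normr0 ltW.
  have h1 : h <= 1 by apply: ltW; near: h; apply: nbhs_dnbhs; apply: near_lt.
  rewrite !normrM (gtr0_norm (expR_gt0 _)) gtr0_norm ?invr_gt0//.
  have hV1 : 1 <= h^-1 by rewrite invf_ge1.
  have := hK _ hV1; set q := `|_|; set E := expR _ => hq.
  have E0 : 0 < E by exact: expR_gt0.
  rewrite expRN -/E.
  have -> : h^-1 * (q * E^-1) = (q * h^-1 ^+ 2 * E^-1) * h.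
    by rewrite expr2; field; rewrite !gt_eqF.
  apply: (@le_trans _ _ (K * h)).
    by apply: ler_wpM2r; [exact: ltW|rewrite ler_pdivrMr].
  have : h <= e / (K + 1).
    apply: ltW; near: h; apply: nbhs_dnbhs; apply: near_lt; rewrite divr_gt0//; lra.
  rewrite ler_pdivlMr; last by lra.
  by rewrite mulrDr mulr1 mulrC => hh; lra.
Unshelve. all: by end_near. Qed.

Lemma smooth1_pflat p : smooth1 (pflat p).
Proof.
exists [set f | exists p, f = pflat p]; first by exists p.
move=> _ [q ->]; exists (pflat ('X^2 * (q^`() - q) * -1)); first by eexists.
by move=> x; exact: is_derive_pflat.
Qed.

Lemma Sm_smooth1 (f : R * R -> R) c : Sm f -> smooth1 (fun x => f (x, c)).
Proof.
move=> sf; exists [set g | exists2 f, Sm f & g = fun x => f (x, c)]; first by exists f.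
move=> _ [h sh ->]; have [h1 [_ [s1 _ d1 _]]] := Sm_derive sh.
exists (fun x => h1 (x, c)); first by exists h1.
by move=> x; apply: ((is_derive_e1 h (x, c) _).1 (d1 _)).
Qed.

Definition flat x := pflat 1 x.

Lemma flat_gt0 x : 0 < x -> 0 < flat x.
Proof. by move=> x0; rewrite /flat /pflat x0 hornerE mul1r expR_gt0. Qed.

Lemma flat_le0 x : x <= 0 -> flat x = 0.
Proof. by move=> x0; rewrite /flat /pflat ltNge x0. Qed.

Lemma flat_ge0 x : 0 <= flat x.
Proof. by have [/flat_le0->//|/flat_gt0/ltW] := leP x 0. Qed.

(** The smooth step from 0 for [x <= 0] to 1 for [x >= 1]; the denominator is positive because [x]
    or [1 - x] is. *)
Definition sigma x := flat x / (flat x + flat (1 - x)).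

Lemma sigma_den_gt0 x : 0 < flat x + flat (1 - x).
Proof.
have [x0|x0] := leP x 0; last by rewrite ltr_pwDl ?flat_gt0 ?flat_ge0.
by rewrite ltr_wpDl ?flat_ge0 ?flat_gt0//; lra.
Qed.

Lemma sigma_le0 x : x <= 0 -> sigma x = 0.
Proof. by move=> x0; rewrite /sigma flat_le0// mul0r. Qed.

Lemma sigma_ge1 x : 1 <= x -> sigma x = 1.
Proof.
move=> x1; rewrite /sigma [flat (1 - x)]flat_le0 ?addr0; last by lra.
by rewrite divff// gt_eqF// flat_gt0//; lra.
Qed.

Lemma sigma_ge0 x : 0 <= sigma x.
Proof. by rewrite /sigma divr_ge0 ?flat_ge0// ltW// sigma_den_gt0. Qed.

Lemma sigma_le1 x : sigma x <= 1.
Proof. by rewrite /sigma ler_pdivrMr ?sigma_den_gt0// mul1r lerDl flat_ge0. Qed.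

Lemma Sm_flat (f : R * R -> R) : Sm f -> Sm (fun z => flat (f z)).
Proof. by move=> sf; apply: (@Sm_comp1 _ flat) => //; exact: smooth1_pflat. Qed.

Lemma smooth1_sigma : smooth1 sigma.
Proof.
have -> : sigma = fun x => (fun z : R * R => flat z.1 * (flat z.1 + flat (1 + -1 * z.1))^-1) (x, 0).
  by apply/funext => x /=; rewrite mulN1r.
have s1 : Sm (fun z : R * R => flat z.1) by apply: Sm_flat; exact: Sm_fst.
have s2 : Sm (fun z : R * R => flat (1 + -1 * z.1)).
  apply: (@Sm_flat (fun z => 1 + -1 * z.1)).
  apply: (@Sm_add _ (cst 1) (fun z => -1 * z.1)); first exact: Sm_cst.
  by apply: (@Sm_mul _ (cst (-1))); [exact: Sm_cst|exact: Sm_fst].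
apply: (@Sm_smooth1 (fun z : R * R => flat z.1 * (flat z.1 + flat (1 + -1 * z.1))^-1)).
apply: Sm_mul => //; apply: Sm_inv; last exact: Sm_add.
by move=> z; rewrite gt_eqF// mulN1r sigma_den_gt0.
Qed.

Definition dsigma : R -> R := derive1 sigma.

Lemma smooth1_dsigma : smooth1 dsigma.
Proof. exact: smooth1_derive1 smooth1_sigma. Qed.

Lemma is_derive_sigma x : is_derive x (1:R) sigma (dsigma x).
Proof. exact: smooth1_derivable smooth1_sigma. Qed.

Lemma dsigma_lt0 x : x < 0 -> dsigma x = 0.
Proof.
move=> x0; have h : is_derive x (1:R) sigma 0.
  apply: (@near_eq_is_derive _ _ _ (cst 0)).
  by near=> y; rewrite sigma_le0//; apply: ltW; near: y; exact: near_lt.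
by rewrite /dsigma derive1E; case: h.
Unshelve. all: by end_near. Qed.

Lemma dsigma_gt1 x : 1 < x -> dsigma x = 0.
Proof.
move=> x0; have h : is_derive x (1:R) sigma 0.
  apply: (@near_eq_is_derive _ R R (cst (1:R))).
  by near=> y; rewrite sigma_ge1//; apply: ltW; near: y; exact: near_gt.
by rewrite /dsigma derive1E; case: h.
Unshelve. all: by end_near. Qed.

Lemma dsigma_bounded : exists2 K, 0 <= K & forall x, `|dsigma x| <= K.
Proof.
have c : continuous dsigma by exact: smooth1_continuous smooth1_dsigma.
have : compact (dsigma @` `[0, 1]).
  apply: continuous_compact; first exact: continuous_subspaceT.
  exact: segment_compact.
move=> /compact_bounded[M [_ hM]].
exists (Num.max 0 M + 1); first by rewrite addr_ge0 ?le_max ?lexx.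
have M1 : 0 <= Num.max 0 M by rewrite le_max lexx.
move=> x; have [x0|x0] := ltP x 0; first by rewrite dsigma_lt0// normr0; lra.
have [x1|x1] := ltP 1 x; first by rewrite dsigma_gt1// normr0; lra.
have MM : M < Num.max 0 M + 1.
  by apply: (@le_lt_trans _ _ (Num.max 0 M)); [rewrite le_max lexx orbT|rewrite ltrDl].
by apply: (hM _ MM); exists x => //=; rewrite in_itv/= x0 x1.
Qed.

End Step.

(** * Mollification of 1-Lipschitz functions on the line *)

Section Mollify.
Context (R : realType).
Local Notation T1 := (measurableTypeR R).
Local Notation lm := (@lebesgue_measure R).
Implicit Types f g F : R -> R.

Lemma L1_supp f (a b M : R) : measurable_fun setT (f : T1 -> R) ->
  (forall x, `|f x| <= M) -> (forall x, x < a \/ b < x -> f x = 0) -> L1 lm f.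
Proof.
move=> mf fM f0.
have i1 : L1 lm (\1_(`[a, b]%classic) : R -> R).
  apply/integrableP; split; first exact/measurable_EFinP.
  under eq_integral do rewrite gee0_abs ?lee_fin//.
  rewrite integral_indic//= setIT lebesgue_measure_itv/=.
  by case: ifP; rewrite ltry.
apply: (L1_le mf (L1Z M i1)) => x.
rewrite indicE; case: (boolP (x \in `[a, b]%classic)) => [_|].
  by rewrite mulr1; apply: le_trans (fM x) (ler_norm _).
rewrite notin_setE /= in_itv/= => /negP; rewrite negb_and -!ltNge => /orP h.
by rewrite f0// normr0.
Qed.

Lemma cont_supp_bounded f (a b : R) : continuous f ->
  (forall x, x < a \/ b < x -> f x = 0) -> exists2 M, 0 <= M & forall x, `|f x| <= M.
Proof.
move=> cf f0.
have : compact (f @` `[a, b]).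
  by apply: continuous_compact; [exact: continuous_subspaceT|exact: segment_compact].
move=> /compact_bounded[M [_ hM]].
have M1 : 0 <= Num.max 0 M by rewrite le_max lexx.
exists (Num.max 0 M + 1); first by rewrite addr_ge0.
have MM : M < Num.max 0 M + 1.
  by apply: (@le_lt_trans _ _ (Num.max 0 M)); [rewrite le_max lexx orbT|rewrite ltrDl].
move=> x; have [x0|x0] := ltP x a; first by rewrite f0 ?normr0; [lra|left].
have [x1|x1] := ltP b x; first by rewrite f0 ?normr0; [lra|right].
by apply: (hM _ MM); exists x => //=; rewrite in_itv/= x0 x1.
Qed.

Lemma L1_cont_supp f (a b : R) : continuous f ->
  (forall x, x < a \/ b < x -> f x = 0) -> L1 lm f.
Proof.
move=> cf f0; have [M _ hM] := cont_supp_bounded cf f0.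
by apply: (L1_supp _ hM f0); exact: continuous_measurable_fun.
Qed.

Lemma Int_itv f (a b : R) : (forall x, x < a \/ b < x -> f x = 0) ->
  Int lm f = Rintegral lm `[a, b] f.
Proof.
move=> f0; rewrite Rintegral_mkcond; congr Int; apply/funext => x.
rewrite patchE; case: ifPn => //; rewrite notin_setE /= in_itv/= => /negP.
by rewrite negb_and -!ltNge => /orP h; rewrite f0.
Qed.

Lemma Int_derive (G g : R -> R) (a b : R) : a < b ->
  (forall x, is_derive x (1:R) G (g x)) -> continuous g ->
  (forall x, x < a \/ b < x -> g x = 0) -> Int lm g = G b - G a.
Proof.
move=> ab dG cg g0; rewrite (Int_itv g0) /Rintegral.
have cG x : {for x, continuous G}.
  by apply: differentiable_continuous; apply/derivable1_diffP; case: (dG x).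
rewrite (@continuous_FTC2 _ g G)//.
- exact: continuous_subspaceT.
- split.
  + by move=> x _; case: (dG x).
  + by apply: cvg_at_right_filter; exact: cG.
  + by apply: cvg_at_left_filter; exact: cG.
- by move=> x _; rewrite derive1E; case: (dG x).
Qed.

Definition conv F (rho : R -> R) (x : R) : R := Int lm (fun s => F s * rho (x - s)).

Lemma conv_cont_supp (F rho : R -> R) (x : R) : continuous F -> continuous rho ->
  (forall t, t < -1 \/ 1 < t -> rho t = 0) ->
  continuous (fun s => F s * rho (x - s)) /\
  (forall s, s < x - 1 \/ x + 1 < s -> F s * rho (x - s) = 0).
Proof.
move=> cF cr r0; split.
  move=> s; apply: cvgM; first exact: cF.
  apply: continuous_comp; last exact: cr.
  by apply: cvgB; [exact: cvg_cst|exact: cvg_id].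
by move=> s h; rewrite r0 ?mulr0//; lra.
Qed.

Lemma is_derive_conv F (rho rho' : R -> R) (x : R) : continuous F ->
  (forall t, is_derive t (1:R) rho (rho' t)) -> continuous rho' ->
  (forall t, t < -1 \/ 1 < t -> rho t = 0) -> (forall t, t < -1 \/ 1 < t -> rho' t = 0) ->
  is_derive x (1:R) (conv F rho) (conv F rho' x).
Proof.
move=> cF dr cr' r0 r'0.
have cr : continuous rho.
  by move=> t; apply: differentiable_continuous; apply/derivable1_diffP; case: (dr t).
have [K K0 hK] := cont_supp_bounded cr' r'0.
have df s y : is_derive y (1:R) (fun y => F s * rho (y - s)) (F s * rho' (y - s)).
  have h1 : is_derive y (1:R) (fun y => rho (y - s)) (rho' (y - s) * 1).
    apply: (@is_derive1_comp _ rho (fun y => y - s)).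
    by apply: is_derive_eq; rewrite subr0.
  have := @is_deriveZ _ _ _ _ (F s) _ _ _ h1 => /is_derive_eq; apply.
  by rewrite mulr1.
(* A majorant valid for all [y] within distance 1 of [x]: then [rho' (y - s)] vanishes unless [s]
   lies in [[x - 2, x + 2]]. *)
pose G s := K * `|F s| * \1_(`[x - 2, x + 2]%classic) s : R.
have cG : continuous (fun s => `|F s|).
  by move=> s; apply: continuous_comp; [exact: cF|exact: norm_continuous].
have iG : L1 lm G.
  have [M [_ hM]] : bounded_set ((fun s => `|F s|) @` `[x - 2, x + 2]).
    apply: compact_bounded; apply: continuous_compact; last exact: segment_compact.
    exact: continuous_subspaceT.
  have M1 : 0 <= Num.max 0 M by rewrite le_max lexx.
  have MM : M < Num.max 0 M + 1.
    by apply: (@le_lt_trans _ _ (Num.max 0 M)); [rewrite le_max lexx orbT|rewrite ltrDl].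
  apply: (@L1_supp _ (x - 2) (x + 2) (K * (Num.max 0 M + 1))).
  - apply: measurable_funM => //; apply: measurable_funM => //.
    exact: continuous_measurable_fun.
  - move=> s; rewrite /G indicE; case: (boolP (s \in _)) => [|_]; last first.
      by rewrite mulr0 normr0 mulr_ge0// addr_ge0.
    rewrite inE => hs; rewrite mulr1 normrM (ger0_norm K0) ler_wpM2l//.
    by apply: (hM _ MM); exists s.
  - move=> s hs; rewrite /G indicE memNset ?mulr0//= in_itv/=; lra.
have Ix : (`]x - 1, x + 1[%classic : set R) x by rewrite /= in_itv/=; lra.
have hi y : (`]x - 1, x + 1[%classic : set R) y -> L1 lm (fun s => F s * rho (y - s)).
  by move=> _; have [c s0] := conv_cont_supp y cF cr r0; exact: L1_cont_supp c s0.
have hd y s : (`]x - 1, x + 1[%classic : set R) y -> setT s -> derivable (fun y => F s * rho (y - s)) y 1.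
  by move=> _ _; case: (df s y).
have d1E y s : partial1of2 (fun y s => F s * rho (y - s)) y s = F s * rho' (y - s).
  by rewrite partial1of2E; case: (df s y).
have hb y s : (`]x - 1, x + 1[%classic : set R) y -> setT s ->
    `|partial1of2 (fun y s => F s * rho (y - s)) y s| <= G s.
  rewrite d1E /= in_itv/= => hy _; rewrite /G indicE.
  case: (boolP (s \in _)) => [_|].
    by rewrite mulr1 normrM mulrC ler_wpM2r.
  rewrite notin_setE/= in_itv/= => /negP; rewrite negb_and -!ltNge => /orP hs.
  by rewrite r'0 ?mulr0 ?normr0//; lra.
have G0 s : 0 <= G s by rewrite /G !mulr_ge0.
have h1 := @derivable_under_integral R _ _ lm _ setT measurableT x _ _ Ix hi hd G G0 iG hb.
have h2 := @differentiation_under_integral R _ _ lm _ setT measurableT x _ _ Ix hi hd G G0 iG hb.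
apply: DeriveDef; first exact: h1.
rewrite -derive1E [LHS]h2; congr Int; apply/funext => s; exact: d1E.
Qed.

Lemma smooth1_scale g (k c : R) : smooth1 g -> smooth1 (fun t => c * g (k * t)).
Proof.
move=> sg; apply: (@Sm_smooth1 _ (fun z => c * g (k * z.1)) 0).
apply: (@Sm_mul _ (cst c)); first exact: Sm_cst.
apply: (@Sm_comp1 _ g (fun z => k * z.1)) => //.
by apply: (@Sm_mul _ (cst k)); [exact: Sm_cst|exact: Sm_fst].
Qed.

Lemma derive1_supp g (a b : R) : (forall x, x < a \/ b < x -> g x = 0) ->
  forall x, x < a \/ b < x -> derive1 g x = 0.
Proof.
move=> g0 x hx; have h : is_derive x (1:R) g 0.
  apply: (@near_eq_is_derive _ R R (cst (0:R))).
  case: hx => hx; near=> y; rewrite g0//; [left|right]; near: y.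
    exact: near_lt.
  exact: near_gt.
by rewrite derive1E; case: h.
Unshelve. all: by end_near. Qed.

Lemma smooth1_conv F (rho : R -> R) : continuous F -> smooth1 rho ->
  (forall t, t < -1 \/ 1 < t -> rho t = 0) -> smooth1 (conv F rho).
Proof.
move=> cF sr r0.
exists [set f | exists r, [/\ smooth1 r, (forall t, t < -1 \/ 1 < t -> r t = 0) & f = conv F r]].
  by exists rho.
move=> _ [r [sr' r'0 ->]]; exists (conv F (derive1 r)).
  by exists (derive1 r); split; [exact: smooth1_derive1|exact: derive1_supp|].
move=> x; apply: is_derive_conv => //.
- by move=> t; exact: smooth1_derivable.
- by apply: smooth1_continuous; exact: smooth1_derive1.
- exact: derive1_supp.
Qed.

Lemma Int_indic (a b : R) : a <= b ->
  L1 lm (\1_(`[a, b]%classic) : R -> R) /\ Int lm (\1_(`[a, b]%classic) : R -> R) = b - a.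
Proof.
move=> ab.
have e : (\int[lm]_x (\1_(`[a, b]%classic : set T1) x)%:E = (b - a)%:E)%E.
  rewrite integral_indic//= setIT lebesgue_measure_itv/= lte_fin.
  by case: ltgtP ab => // ->; rewrite subrr.
split; last by rewrite /Int /Rintegral e.
apply/integrableP; split; first exact/measurable_EFinP.
by under eq_integral do rewrite gee0_abs ?lee_fin//; rewrite e ltry.
Qed.

Lemma is_derive_lin (N t : R) : is_derive t (1:R) (fun t => N * t) N.
Proof.
apply/is_derive_cvgP.
have e : (fun h : R => h^-1 * (N * (h *: (1:R) + t) - N * t)) = (fun h => if h == 0 then 0 else N).
  apply/funext => h; rewrite -mulrBr addrK mulrCA; case: eqP => [->|/eqP h0].
    by rewrite invr0 mul0r mulr0.
  by rewrite (_ : h *: (1:R) = h) ?mulVf ?mulr1//; exact: mulr1.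
rewrite e; apply: cvg_near_cst; near=> h; rewrite ifF//; apply/negbTE.
by near: h; exact: nbhs_dnbhs_neq.
Unshelve. all: by end_near. Qed.

Lemma continuous_refl_comp (k : R -> R) (x : R) : continuous k ->
  continuous (fun s : R => k (x - s)).
Proof.
move=> ck s; apply: (@continuous_comp R R R (fun s => x - s) k); last exact: ck.
by apply: cvgB; [exact: cvg_cst|exact: cvg_id].
Qed.

(** The kernel is the derivative of the step [sigma (N t)]: it lives on [[0, 1 / N]] and has mass 1
    by the fundamental theorem of calculus. *)
Definition rhoN (N t : R) : R := N * dsigma (N * t).

Definition drhoN (N t : R) : R := N * (N * derive1 (@dsigma R) (N * t)).

Lemma is_derive_refl g dg (x s : R) : is_derive (x - s) (1:R) g dg ->
  is_derive s (1:R) (fun s => g (x - s)) (- dg).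
Proof.
move=> h; have h2 : is_derive s (1:R) (fun s => x - s) (-1).
  have := is_deriveD (is_derive_cst x s (1:R)) (is_derive_lin (-1) s).
  rewrite add0r (_ : cst x + _ = fun s => x - s)//.
  by apply/funext => t; rewrite fctE mulN1r.
by have := @is_derive1_comp _ g (fun s => x - s) s dg (-1) h h2; rewrite mulrN1.
Qed.

Section fixN.
Variables (F : R -> R) (N K : R).
Hypotheses (N1 : 1 <= N) (lipF : forall x y, `|F x - F y| <= `|x - y|).
Hypotheses (K0 : 0 <= K) (hK : forall t, `|@dsigma R t| <= K)
  (hK2 : forall t, `|derive1 (@dsigma R) t| <= K).

Lemma lip_continuous : continuous F.
Proof.
have N1' := N1.
move=> x; apply/cvgrPdist_lt => e e0; apply/nbhs_ballP; exists e => //= y /= h.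
exact: le_lt_trans (lipF _ _) h.
Qed.

Lemma dsigma_supp t : t < 0 \/ 1 < t -> @dsigma R t = 0.
Proof. by case; [exact: dsigma_lt0|exact: dsigma_gt1]. Qed.

Lemma smooth1_rhoN : smooth1 (rhoN N).
Proof. by apply: (@smooth1_scale (@dsigma R)); exact: smooth1_dsigma. Qed.

Lemma is_derive_rhoN t : is_derive t (1:R) (rhoN N) (drhoN N t).
Proof.
have N1' := N1.
have h1 : is_derive t (1:R) (fun t => dsigma (N * t)) (derive1 (@dsigma R) (N * t) * N).
  apply: (@is_derive1_comp _ (@dsigma R) (fun t => N * t)).
    exact: (smooth1_derivable (N * t) (@smooth1_dsigma R)).
  exact: is_derive_lin.
have := @is_deriveZ _ _ _ _ N _ _ _ h1 => /is_derive_eq; apply.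
by rewrite /drhoN [N * derive1 _ _]mulrC.
Qed.

Lemma Nt_supp t : t < 0 \/ N^-1 < t -> N * t < 0 \/ 1 < N * t.
Proof.
have N1' := N1.
have N0 : 0 < N := lt_le_trans ltr01 N1.
case=> h; [left; by rewrite pmulr_rlt0|right].
by rewrite mulrC -ltr_pdivrMr// div1r.
Qed.

Lemma rhoN_supp t : t < 0 \/ N^-1 < t -> rhoN N t = 0.
Proof. by move=> /Nt_supp h; rewrite /rhoN dsigma_supp ?mulr0. Qed.

Lemma drhoN_supp t : t < 0 \/ N^-1 < t -> drhoN N t = 0.
Proof.
have N1' := N1.
by move=> /Nt_supp h; rewrite /drhoN (derive1_supp dsigma_supp) ?mulr0.
Qed.

Lemma invN_le1 : 0 < N^-1 <= 1.
Proof. have N1' := N1; by rewrite invr_gt0 invf_le1; lra. Qed.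

Lemma supp1 t : t < -1 \/ 1 < t -> t < 0 \/ N^-1 < t.
Proof. by have := invN_le1; move=> /andP[? ?]; case; [left|right]; lra. Qed.

Lemma continuous_drhoN : continuous (drhoN N).
Proof.
have N1' := N1.
have -> : drhoN N = derive1 (rhoN N).
  by apply/funext => t; rewrite derive1E; case: (is_derive_rhoN t).
by apply: smooth1_continuous; apply: smooth1_derive1; exact: smooth1_rhoN.
Qed.

Lemma Int_rhoN x : Int lm (fun s => rhoN N (x - s)) = 1.
Proof.
have N1' := N1.
have c := smooth1_continuous smooth1_rhoN.
apply: (etrans (@Int_derive (fun s => - sigma (N * (x - s))) _ (x - 1) (x + 1) _ _ _ _)); last 1 first.
- rewrite [sigma (N * (x - (x + 1)))]sigma_le0; last by nra.
  rewrite [sigma _]sigma_ge1; lra.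
- lra.
- move=> s; have h : is_derive (x - s) (1:R) (fun t => sigma (N * t)) (dsigma (N * (x - s)) * N).
    apply: (@is_derive1_comp _ (@sigma R) (fun t => N * t)); first exact: is_derive_sigma.
    exact: is_derive_lin.
  have := is_deriveN (is_derive_refl h) => /is_derive_eq; apply.
  by rewrite opprK mulrC.
- exact: continuous_refl_comp.
- by move=> s h; apply: rhoN_supp; apply: supp1; lra.
Qed.

Lemma Int_drhoN x : Int lm (fun s => drhoN N (x - s)) = 0.
Proof.
have N1' := N1.
apply: (etrans (@Int_derive (fun s => - rhoN N (x - s)) (fun s => drhoN N (x - s)) (x - 2) (x + 2) _ _ _ _)); last 1 first.
- by rewrite !rhoN_supp ?subrr//; apply: supp1; lra.
- lra.
- move=> s; have := is_deriveN (is_derive_refl (is_derive_rhoN (x - s))).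
  by rewrite opprK.
- by apply: continuous_refl_comp; exact: continuous_drhoN.
- by move=> s h; apply: drhoN_supp; apply: supp1; lra.
Qed.

(** Integration by parts: the function [- (s - x) rhoN (x - s)] of [s] has compact support, so its
    derivative, the present integrand minus the kernel, has integral zero, and the kernel has mass
    1. *)
Lemma Int_drhoN_id x : Int lm (fun s => (s - x) * drhoN N (x - s)) = 1.
Proof.
have N1' := N1.
have cl : continuous (fun s => s - x) by move=> s; apply: cvgB; [exact: cvg_id|exact: cvg_cst].
pose g s := (s - x) * drhoN N (x - s) - rhoN N (x - s).
have cd : continuous (fun s => (s - x) * drhoN N (x - s)).
  move=> s; apply: cvgM; first exact: cl.
  exact: (continuous_refl_comp continuous_drhoN).
have cro : continuous (fun s => rhoN N (x - s)).
  exact: (continuous_refl_comp (smooth1_continuous smooth1_rhoN)).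
have sd s : s < x - 2 \/ x + 2 < s -> (s - x) * drhoN N (x - s) = 0.
  by move=> h; rewrite drhoN_supp ?mulr0//; apply: supp1; lra.
have sr s : s < x - 2 \/ x + 2 < s -> rhoN N (x - s) = 0.
  by move=> h; rewrite rhoN_supp//; apply: supp1; lra.
have : Int lm g = 0.
  apply: (etrans (@Int_derive (fun s => (s - x) * - rhoN N (x - s)) g (x - 2) (x + 2) _ _ _ _)); last 1 first.
  - by rewrite !rhoN_supp ?oppr0 ?mulr0 ?subr0//; apply: supp1; lra.
  - lra.
  - move=> s; have h1 := is_deriveN (is_derive_refl (is_derive_rhoN (x - s))).
    have h2 : is_derive s (1:R) (fun s => s - x) 1.
      by apply: is_derive_eq; rewrite subr0.
    have := is_deriveM h2 h1 => /is_derive_eq; apply.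
    by rewrite opprK /GRing.scale/= mulr1.
  - by move=> s; apply: cvgB; [exact: cd|exact: cro].
  - by move=> s h; rewrite /g sd// sr// subrr.
rewrite IntB; [|exact: L1_cont_supp cd sd|exact: L1_cont_supp cro sr].
by rewrite Int_rhoN => /eqP; rewrite subr_eq0 => /eqP.
Qed.

(** Once [F x] is subtracted, the integrand is at most [B / N] by the Lipschitz condition, on an
    interval of length [1 / N]. The kernel of mass 1 is bounded by [N K] and gives the error
    [K / N]; its derivative, of mass 0, is bounded by [N^2 K] and gives the bound [K] for the
    slopes. *)
Lemma Int_kernel_le (k : R -> R) (B c x : R) : continuous k ->
  (forall t, t < 0 \/ N^-1 < t -> k t = 0) -> (forall t, `|k t| <= B) ->
  Int lm (fun s => k (x - s)) = c ->
  `|conv F k x - F x * c| <= B * N^-1 * N^-1.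
Proof.
have N1' := N1.
move=> ck k0 kB <-.
have /andP[iN0 iN1] := invN_le1.
have ck' : continuous (fun s => k (x - s)).
  exact: continuous_refl_comp.
have sk s : s < x - 2 \/ x + 2 < s -> k (x - s) = 0.
  by move=> h; apply: k0; apply: supp1; lra.
have L1k := L1_cont_supp ck' sk.
have L1F : L1 lm (fun s => F s * k (x - s)).
  apply: (@L1_cont_supp _ (x - 2) (x + 2)); last by move=> s h; rewrite sk ?mulr0.
  by move=> s; apply: cvgM; [exact: lip_continuous|exact: ck'].
rewrite /conv -(IntZ _ L1k) -IntB//; last exact: L1Z.
have L1B : L1 lm (fun s => F s * k (x - s) - F x * k (x - s)) by apply: L1B => //; exact: L1Z.
apply: le_trans (le_norm_Int L1B) _.
have xx : x - N^-1 <= x by lra.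
have [L1i Ii] := Int_indic xx.
have -> : B * N^-1 * N^-1 = Int lm (fun s => (B * N^-1) * \1_(`[x - N^-1, x]%classic) s).
  by rewrite IntZ// Ii; congr (_ * _); lra.
have B0 : 0 <= B by apply: le_trans (kB 0).
apply: le_Int; [exact: L1_norm|exact: L1Z|] => s.
rewrite -mulrBl normrM.
have [h|h] := boolP ((x - N^-1 <= s) && (s <= x)).
  rewrite indicE mem_set ?mulr1; last by rewrite /= in_itv/=.
  rewrite mulrC ler_pM//; apply: le_trans (lipF _ _) _; rewrite ler_norml; lra.
have R0 : 0 <= B * N^-1 * \1_(`[x - N^-1, x]%classic) s :> R.
  by rewrite !mulr_ge0// ltW.
rewrite k0 ?normr0 ?mulr0//.
by move: h; rewrite negb_and -!ltNge => /orP[]; lra.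
Qed.

Lemma smooth1_moll : smooth1 (conv F (rhoN N)).
Proof.
have N1' := N1.
apply: smooth1_conv; [exact: lip_continuous|exact: smooth1_rhoN|].
by move=> t h; apply: rhoN_supp; exact: supp1.
Qed.

Lemma moll_approx x : `|conv F (rhoN N) x - F x| <= K * N^-1.
Proof.
have N1' := N1.
have N0 : 0 < N := lt_le_trans ltr01 N1.
have hb t : `|rhoN N t| <= N * K.
  by rewrite /rhoN normrM (gtr0_norm N0) ler_pM2l.
have := @Int_kernel_le (rhoN N) (N * K) 1 x (smooth1_continuous smooth1_rhoN) rhoN_supp hb (Int_rhoN x).
by rewrite mulr1 [N * K]mulrC mulfK ?gt_eqF.
Qed.

Lemma derive_moll x : derive1 (conv F (rhoN N)) x = conv F (drhoN N) x.
Proof.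
have N1' := N1.
have h : is_derive x (1:R) (conv F (rhoN N)) (conv F (drhoN N) x).
  apply: is_derive_conv; [exact: lip_continuous|exact: is_derive_rhoN|exact: continuous_drhoN| |].
    by move=> t h; apply: rhoN_supp; exact: supp1.
  by move=> t h; apply: drhoN_supp; exact: supp1.
by rewrite derive1E; case: h.
Qed.

Lemma moll_derive_bound x : `|derive1 (conv F (rhoN N)) x| <= K.
Proof.
have N1' := N1.
have N0 : 0 < N := lt_le_trans ltr01 N1.
rewrite derive_moll.
have hb t : `|drhoN N t| <= N * (N * K).
  by rewrite /drhoN !normrM (gtr0_norm N0) ler_pM2l// ler_pM2l.
have := @Int_kernel_le (drhoN N) (N * (N * K)) 0 x continuous_drhoN drhoN_supp hb (Int_drhoN x).
by rewrite mulr0 subr0 (_ : _ / _ / _ = K)//; field; rewrite gt_eqF.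
Qed.

(** The derived kernel has mass 0 and first moment 1, so it reproduces the slope of an affine
    function exactly. Almost everywhere convergence of the slopes thus becomes eventual equality. *)
Lemma moll_derive_affine x a :
  (forall y, `|y - x| <= N^-1 -> F y = F x + a * (y - x)) ->
  derive1 (conv F (rhoN N)) x = a.
Proof.
have N1' := N1.
move=> haff; rewrite derive_moll.
have ck' : continuous (fun s => drhoN N (x - s)).
  exact: (continuous_refl_comp continuous_drhoN).
have sk s : s < x - 2 \/ x + 2 < s -> drhoN N (x - s) = 0.
  by move=> h; apply: drhoN_supp; apply: supp1; lra.
have L1k := L1_cont_supp ck' sk.
have L1i : L1 lm (fun s => (s - x) * drhoN N (x - s)).
  apply: (@L1_cont_supp _ (x - 2) (x + 2)); last by move=> s h; rewrite sk ?mulr0.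
  by move=> s; apply: cvgM; [apply: cvgB; [exact: cvg_id|exact: cvg_cst]|exact: ck'].
have -> : conv F (drhoN N) x = Int lm (fun s => F x * drhoN N (x - s) + a * ((s - x) * drhoN N (x - s))).
  congr Int; apply/funext => s.
  have [h|h] := boolP ((x - N^-1 <= s) && (s <= x)).
    rewrite haff; first by rewrite mulrDl -mulrA.
    by rewrite ler_norml; have := invN_le1; lra.
  rewrite drhoN_supp ?mulr0 ?addr0//.
  by move: h; rewrite negb_and -!ltNge => /orP[]; lra.
rewrite IntD; [|exact: (L1Z _ L1k)|exact: (L1Z _ L1i)].
rewrite (IntZ _ L1k) (IntZ _ L1i) Int_drhoN Int_drhoN_id.
by rewrite mulr0 add0r mulr1.
Qed.

End fixN.

Lemma smooth_approx F : (forall x y, `|F x - F y| <= `|x - y|) ->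
  exists (Fn : nat -> R -> R) (M : R), [/\ forall n, smooth1 (Fn n),
    forall n x, `|Fn n x - F x| <= (8 * n.+1%:R)^-1,
    0 <= M, forall n x, `|derive1 (Fn n) x| <= M &
    forall x a r, 0 < r -> (forall y, `|y - x| < r -> F y = F x + a * (y - x)) ->
      \forall n \near \oo, derive1 (Fn n) x = a].
Proof.
move=> lipF.
have [K1 K10 hK1] := @dsigma_bounded R.
have cd : continuous (derive1 (@dsigma R)).
  by apply: smooth1_continuous; apply: smooth1_derive1; exact: smooth1_dsigma.
have sd : forall t, t < 0 \/ 1 < t -> derive1 (@dsigma R) t = 0.
  by apply: derive1_supp; exact: dsigma_supp.
have [K2 K20 hK2] := cont_supp_bounded cd sd.
pose K := K1 + K2.
have K0 : 0 <= K by rewrite addr_ge0.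
have hK t : `|@dsigma R t| <= K by apply: le_trans (hK1 t) _; rewrite lerDl.
have hKK t : `|derive1 (@dsigma R) t| <= K by apply: le_trans (hK2 t) _; rewrite lerDr.
(* Makes the error [K / N] at most [1 / (8 (n + 1))]; the summand 1 ensures [N >= 1] whatever [K]
   is. *)
pose N (n : nat) := (8 * K + 1) * n.+1%:R.
have n1 (n : nat) : 1 <= n.+1%:R :> R by rewrite ler1n.
have N1 n : 1 <= N n by rewrite /N; have := n1 n; nra.
exists (fun n => conv F (rhoN (N n))), K; split=> //.
- by move=> n; exact: smooth1_moll.
- move=> n x; apply: le_trans (moll_approx (N1 n) lipF hK x) _.
  have N0 : 0 < N n by have := N1 n; lra.
  have n0 : 0 < 8 * n.+1%:R :> R by have := n1 n; lra.
  rewrite -[leRHS]mul1r ler_pdivlMr// mulrAC ler_pdivrMr// mul1r /N.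
  by have := n1 n; nra.
- by move=> n x; exact: moll_derive_bound.
- move=> x a r r0 haff.
  exists (Num.bound r^-1) => // n /= hn.
  apply: moll_derive_affine => // y hy; apply: haff; apply: le_lt_trans hy _.
  rewrite invf_plt ?posrE//; last by have := N1 n; lra.
  have : r^-1 < n.+1%:R.
    apply: (@lt_le_trans _ _ (Num.bound r^-1)%:R).
      by apply: archi_boundP; rewrite invr_ge0 ltW.
    by rewrite ler_nat (leq_trans hn).
  by rewrite /N; have := n1 n; nra.
Qed.

End Mollify.

Section Indicator.
Context d (T : measurableType d) (R : realType).
Implicit Types f g : T -> R.

Lemma measurable_ltr f g : measurable_fun setT f -> measurable_fun setT g ->
  measurable_fun setT (fun z => (f z < g z)%R%:R : R).
Proof.
move=> mf mg.
rewrite (_ : (fun z => _) = fun z => if f z < g z then 1 else 0); last first.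
  by apply/funext => z; case: ifP.
by apply: measurable_fun_ifT => //; exact: measurable_fun_ltr.
Qed.

Lemma norm_bool (b : bool) : `|b%:R : R| <= 1.
Proof. by case: b; rewrite ?normr1 ?normr0. Qed.

End Indicator.

(** * Plateau functions, the fundamental lemma on the line, and integration by parts *)

Section OneDim.
Context (R : realType).
Local Notation T1 := (measurableTypeR R).
Local Notation lm := (@lebesgue_measure R).
Local Notation mu2 := (mu2 R).
Implicit Types f g : R -> R.

Lemma L1_tensor f g : L1 lm f -> L1 lm g -> L1 mu2 (fun z : R * R => f z.1 * g z.2).
Proof.
move=> hf hg.
apply: (@L1_tonelli _ _ (fun x => `|f x| * Int lm (fun y => `|g y|))).
- apply: measurable_funM.
    exact: (measurableT_comp (L1_meas hf) measurable_fst).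
  exact: (measurableT_comp (L1_meas hg) measurable_snd).
- by apply: aeW => x /=; exact: L1Z.
- set c := Int _ _; rewrite (_ : (fun x => `|f x| * c) = fun x => c * `|f x|).
    exact: (L1Z c (L1_norm hf)).
  by apply/funext => x; rewrite mulrC.
- apply: aeW => x /=; rewrite -(IntZ _ (L1_norm hg)).
  by under [X in Int _ X]eq_fun do rewrite normrM.
Qed.

(** Smooth, with support in [[p, q]], and tending to the indicator of []p, q[]. With rational [p]
    and [q] this is a countable family, so that statements tested on it hold off a single null
    set. *)
Definition plateau (p q : R) (n : nat) (x : R) : R :=
  sigma (n%:R * (x - p)) * sigma (n%:R * (q - x)).

Lemma smooth1_affine g (k c : R) : smooth1 g -> smooth1 (fun t => g (k * t + c)).
Proof.
move=> sg; apply: (@Sm_smooth1 _ (fun z => g (k * z.1 + c)) 0).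
apply: (@Sm_comp1 _ g (fun z => k * z.1 + c)) => //.
apply: (@Sm_add _ (fun z => k * z.1) (cst c)); last exact: Sm_cst.
by apply: (@Sm_mul _ (cst k)); [exact: Sm_cst|exact: Sm_fst].
Qed.

Lemma smooth1M f g : smooth1 f -> smooth1 g -> smooth1 (fun x => f x * g x).
Proof.
move=> sf sg; apply: (@Sm_smooth1 _ (fun z => f z.1 * g z.1) 0).
by apply: Sm_mul; [apply: (Sm_comp1 sf)|apply: (Sm_comp1 sg)]; exact: Sm_fst.
Qed.

Lemma smooth1_plateau p q n : smooth1 (plateau p q n).
Proof.
apply: smooth1M.
  have := @smooth1_affine _ n%:R (- (n%:R * p)) (@smooth1_sigma R).
  by under eq_fun do rewrite -mulrBr.
have := @smooth1_affine _ (- n%:R) (n%:R * q) (@smooth1_sigma R).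
by under eq_fun do rewrite mulNr addrC -mulrBr.
Qed.

Lemma plateau_ge0 p q n x : 0 <= plateau p q n x.
Proof. by rewrite mulr_ge0// sigma_ge0. Qed.

Lemma plateau_le1 p q n x : `|plateau p q n x| <= 1.
Proof.
by rewrite ger0_norm ?plateau_ge0// mulr_ile1 ?sigma_ge0 ?sigma_le1.
Qed.

Lemma plateau_supp p q n x : x <= p \/ q <= x -> plateau p q n x = 0.
Proof.
rewrite /plateau => -[h|h]; [rewrite sigma_le0 ?mul0r//|rewrite [X in _ * X]sigma_le0 ?mulr0//];
by rewrite mulr_ge0_le0//; lra.
Qed.

Lemma sigma_cvg (r : R) : 0 < r -> \forall n \near \oo, sigma (n%:R * r) = 1.
Proof.
move=> r0; exists (Num.bound r^-1) => // n /= hn.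
rewrite sigma_ge1// -ler_pdivrMr// div1r.
apply: (@le_trans _ _ (Num.bound r^-1)%:R); last by rewrite ler_nat.
by apply: ltW; apply: archi_boundP; rewrite invr_ge0 ltW.
Qed.

Lemma plateau_cvg p q x : plateau p q n x @[n --> \oo] --> ((p < x)%R%:R * (x < q)%R%:R : R).
Proof.
have [xp|px] := leP x p.
  by rewrite mul0r; apply: cvg_near_cst; near=> n; rewrite plateau_supp//; left.
have [qx|xq] := leP q x.
  by rewrite mulr0; apply: cvg_near_cst; near=> n; rewrite plateau_supp//; right.
rewrite mulr1; apply: cvg_near_cst; near=> n; rewrite /plateau.
rewrite (_ : sigma _ = 1) ?mul1r; last by near: n; apply: sigma_cvg; rewrite subr_gt0.
by near: n; apply: sigma_cvg; rewrite subr_gt0.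
Unshelve. all: by end_near. Qed.

Lemma measurable_plateau p q n : measurable_fun setT (plateau p q n : T1 -> R).
Proof. by apply: continuous_measurable_fun; apply: smooth1_continuous; exact: smooth1_plateau. Qed.

Lemma FL1_itv f p q : L1 lm f -> (forall n, Int lm (fun x => f x * plateau p q n x) = 0) ->
  Int lm (fun x => f x * ((p < x)%R%:R * (x < q)%R%:R)) = 0.
Proof.
move=> hf h; have mf := L1_meas hf.
have [] := @Int_dct _ _ _ lm (fun n x => f x * plateau p q n x)
   (fun x => f x * ((p < x)%R%:R * (x < q)%R%:R)) (fun x => `|f x|).
- by move=> n; apply: measurable_funM => //; exact: measurable_plateau.
- apply: measurable_funM => //; apply: measurable_funM; exact: measurable_ltr.
- by apply: aeW => x; apply: cvgMr; exact: plateau_cvg.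
- exact: L1_norm.
- by apply: aeW => x n; rewrite normrM ler_piMr// plateau_le1.
move=> _; under eq_fun do rewrite h.
by move/(cvg_unique (@Rhausdorff R)); apply; exact: cvg_cst.
Qed.

(** By Lebesgue differentiation the primitive of [f] has derivative [f] almost everywhere. The
    hypothesis makes the primitive constant on the rationals near a point of [J], hence its
    derivative there is 0. *)
Lemma FL1 f (J : set R) : open J -> L1 lm f ->
  (forall p q : rat, `[ratr p, ratr q]%classic `<=` J ->
    forall n, Int lm (fun x => f x * plateau (ratr p) (ratr q) n x) = 0) ->
  {ae lm, forall x, J x -> f x = 0}.
Proof.
move=> oJ hf h.
have iA A : measurable A -> lm.-integrable A (EFin \o f).
  by move=> mA; apply: integrableS hf.
have fl : locally_integrable [set: R] f.
  by apply: open_integrable_locally => //; exact: openT.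
have := FTC1Ny (fun y => iA _ (measurable_itv _)) fl.
set F := fun x => _; move=> hF.
apply: (aeS hF) => x [dF <-] Jx {hF}.
have /nbhs_ballP[r /= r0 rJ] : nbhs x J by apply: open_nbhs_nbhs.
(* Letting [n] tend to infinity, the integral of [f] over []p, q[] is 0. *)
have Fpq (p q : rat) : `|x - ratr p| < r -> `|x - ratr q| < r -> ratr p < ratr q :> R -> F (ratr p) = F (ratr q).
  move=> hp hq pq.
  have pqJ : `[ratr p, ratr q]%classic `<=` J.
    move=> y /=; rewrite in_itv/= => hy; apply: rJ; rewrite /ball/=.
    by move: hp hq; rewrite !ltr_norml; lra.
  have := FL1_itv hf (h _ _ pqJ).
  have -> : Int lm (fun x => f x * ((ratr p < x)%R%:R * (x < ratr q)%R%:R)) =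
      Rintegral lm `]ratr p, ratr q] f.
    rewrite -Rintegral_itv_bndo_bndc; last by apply: iA; exact: measurable_itv.
    rewrite [RHS]Rintegral_mkcond; congr Int; apply/funext => y; rewrite patchE.
    case: ifPn; rewrite ?inE ?notin_setE /= in_itv/=.
      by move=> /andP[-> ->]; rewrite !mulr1.
    by move=> /negP; rewrite negb_and => /orP[]/negbTE->; rewrite ?mul0r ?mulr0.
  rewrite -(@Rintegral_itvB _ f -oo%O (BRight (ratr q)) (ratr p)).
  - by move=> /eqP; rewrite subr_eq0 => /eqP.
  - by apply: iA; exact: measurable_itv.
  - by [].
  - by rewrite bnd_simp ltW.
have ratdense (a b : R) : a < b -> exists p : rat, a < ratr p < b.
  by move=> /rat_in_itvoo[p]; rewrite in_itv/= => ?; exists p.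
have Fc : exists c, forall p : rat, `|x - ratr p| < r -> F (ratr p) = c.
  have [p0 hp0] : exists p : rat, x - r < ratr p < x + r by apply: ratdense; lra.
  have hp0' : `|x - ratr p0| < r by rewrite ltr_norml; lra.
  exists (F (ratr p0)) => p hp.
  by have [pp|pp|/(fmorph_inj _) ->//] := ltgtP (ratr p : R) (ratr p0); [|apply/esym]; apply: Fpq.
have [c hc] := Fc.
have cF : {for x, continuous F} by apply: differentiable_continuous; apply/derivable1_diffP.
have Fx : F x = c.
  apply/eqP; rewrite -subr_eq0 -normr_le0; apply/ler_addgt0Pl => e e0; rewrite addr0.
  have /cvgrPdist_lt/(_ _ e0)/nbhs_ballP[s /= s0 hs] := cF.
  pose m := Num.min r s.
  have m0 : 0 < m by rewrite lt_min r0.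
  have [p hp] : exists p : rat, x - m < ratr p < x + m by apply: ratdense; lra.
  have hm : `|x - ratr p| < m by rewrite ltr_norml; lra.
  rewrite -(hc p); last by apply: lt_le_trans hm _; rewrite ge_min lexx.
  by apply/ltW/hs; rewrite /ball/=; apply: lt_le_trans hm _; rewrite ge_min lexx orbT.
set l := derive1 F x.
have /is_derive_cvgP : is_derive x (1:R) F l by rewrite /l derive1E; exact: derivableP.
move=> /cvgrPdist_lt hl.
apply/eqP; rewrite -normr_le0; apply/ler_addgt0Pl => e e0; rewrite addr0.
have /nbhs_ballP[s /= s0 hs] := hl _ e0.
pose m := Num.min r s.
have m0 : 0 < m by rewrite lt_min r0.
have [p hp] : exists p : rat, x < ratr p < x + m by apply: ratdense; lra.
have pn0 : ratr p - x != 0 by rewrite subr_eq0 gt_eqF//; lra.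
have hm : `|ratr p - x| < m by rewrite ltr_norml; lra.
have := hs (ratr p - x).
rewrite (_ : (ratr p - x) *: (1:R) = ratr p - x) ?subrK; last exact: mulr1.
rewrite Fx hc ?subrr ?mulr0 ?subr0.
- move=> /(_ _ pn0) h1; apply: ltW; apply: h1.
  by rewrite /ball/= sub0r normrN; apply: lt_le_trans hm _; rewrite ge_min lexx orbT.
- by rewrite distrC; apply: lt_le_trans hm _; rewrite ge_min lexx.
Qed.

Lemma ibp (g Chi chi : R -> R) (A B c : R) : L1 lm g ->
  (forall y, is_derive y (1:R) Chi (chi y)) -> continuous chi ->
  (forall y, y < A \/ B < y -> chi y = 0) ->
  Int lm (fun y => (c < y)%R%:R * chi y * Int lm (fun s => (y < s)%R%:R * g s)) =
  Int lm (fun s => (c < s)%R%:R * g s * (Chi s - Chi c)).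
Proof.
move=> hg dC cc c0; have mg := L1_meas hg.
have hc : L1 lm chi by exact: L1_cont_supp cc c0.
pose k (z : R * R) : R := ((c < z.1)%R%:R * (z.1 < z.2)%R%:R) * (chi z.1 * g z.2).
have kL1 : L1 mu2 k.
  apply: (L1M (M := 1)); first exact: L1_tensor.
    apply: measurable_funM; apply: measurable_ltr => //; exact: measurable_fst || exact: measurable_snd.
  by move=> z; rewrite normrM mulr_ile1// norm_bool.
have -> : Int lm (fun y => (c < y)%R%:R * chi y * Int lm (fun s => (y < s)%R%:R * g s)) = Int mu2 k.
  rewrite Int2//; congr Int; apply/funext => y.
  have hyg : L1 lm (fun s => (y < s)%R%:R * g s).
    by apply: (L1M (M := 1)) => //; [exact: measurable_ltr|move=> s; exact: norm_bool].
  rewrite -(IntZ _ hyg); congr Int; apply/funext => s; rewrite /k/=; ring.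
rewrite -(Int_swp kL1) (Int2 (L1_swp kL1)); congr Int; apply/funext => s; rewrite /k /swp/=.
have [cs|sc] := ltP c s; last first.
  rewrite !mul0r (_ : (fun y => _) = cst 0) ?Int0//.
  by apply/funext => y; have [cy|] := ltP c y; rewrite ?mul0r// (_ : (y < s) = false) ?mulr0 ?mul0r//; apply/negbTE; rewrite -leNgt; lra.
rewrite mul1r.
have hcs : L1 lm (fun y => ((c < y)%R%:R * (y < s)%R%:R) * chi y).
  apply: (L1M (M := 1)) => //; first by apply: measurable_funM; exact: measurable_ltr.
  by move=> z; rewrite normrM mulr_ile1// norm_bool.
have -> : (fun y => (c < y)%R%:R * (y < s)%R%:R * (chi y * g s)) = (fun y => g s * (((c < y)%R%:R * (y < s)%R%:R) * chi y)).
  by apply/funext => y; ring.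
rewrite IntZ//; congr (_ * _).
have -> : Int lm (fun y => (c < y)%R%:R * (y < s)%R%:R * chi y) = Rintegral lm `[c, s] chi.
  rewrite -Rintegral_itv_obnd_cbnd ?(@Rintegral_itv_bndo_bndc _ (BRight c)).
  - rewrite -Rintegral_itv_bndo_bndc; last by apply: integrableS hc => //.
    rewrite [RHS]Rintegral_mkcond; congr Int; apply/funext => y; rewrite patchE.
    case: ifPn; rewrite ?inE ?notin_setE /= in_itv/=.
      by move=> /andP[-> ->]; rewrite !mul1r.
    by move=> /negP; rewrite negb_and => /orP[]/negbTE->; rewrite ?mul0r ?mulr0 ?mul0r.
  - by apply: integrableS hc.
rewrite /Rintegral (@continuous_FTC2 _ chi Chi)//.
- exact: continuous_subspaceT.
- have cG x : {for x, continuous Chi}.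
    by apply: differentiable_continuous; apply/derivable1_diffP; case: (dC x).
  split.
  + by move=> x _; case: (dC x).
  + by apply: cvg_at_right_filter; exact: cG.
  + by apply: cvg_at_left_filter; exact: cG.
- by move=> x _; rewrite derive1E; case: (dC x).
Qed.

End OneDim.

(** * Weak derivatives and Hardy's inequality *)

Section Test.
Context (R : realType).
Local Notation T1 := (measurableTypeR R).
Local Notation lm := (@lebesgue_measure R).
Local Notation mu2 := (mu2 R).
Local Notation e1 := (e1 R).
Local Notation e2 := (e2 R).
Implicit Types (O A : set (R * R)) (phi : R * R -> R).

Lemma test_intro O A phi : Sm phi -> compact A -> A `<=` O ->
  (forall z, ~ A z -> phi z = 0) -> test_function O phi.
Proof.
move=> sphi cA AO phi0.
have clA : closed A by apply: compact_closed => //; exact: norm_hausdorff.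
have sA : closure [set z | phi z != 0] `<=` A.
  rewrite [X in _ `<=` X]((closure_id A).1 clA); apply: closure_subset => z /= h.
  by apply: contrapT => /phi0 h0; move: h; rewrite h0 eqxx.
split; first exact: Sm_Ck.
  by apply: (subclosed_compact _ cA) => //; exact: closed_closure.
by apply: subset_trans AO.
Qed.

Lemma test_smooth O phi : test_function O phi -> smooth2 phi.
Proof. by case. Qed.

Lemma testS O O' phi : O `<=` O' -> test_function O phi -> test_function O' phi.
Proof. by move=> OO' [h1 h2 h3]; split=> //; exact: subset_trans h3 OO'. Qed.

Lemma zero_derive phi (A : set (R * R)) v : closed A -> (forall z, ~ A z -> phi z = 0) ->
  forall z, ~ A z -> 'D_v phi z = 0.
Proof.
move=> cA h z Az.
have nA : nbhs z (~` A) by apply: open_nbhs_nbhs; split => //; exact: closed_openC.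
rewrite (@near_eq_derive _ _ _ phi (cst (0:R))); first exact: derive_cst.
by near=> w; apply: h; near: w.
Unshelve. all: by end_near. Qed.

Lemma compact_box A : compact A -> exists2 M, 0 <= M & forall z, A z -> `|z.1| <= M /\ `|z.2| <= M.
Proof.
move=> /compact_bounded[M [_ hM]].
have M1 : 0 <= Num.max 0 M by rewrite le_max lexx.
have MM : M < Num.max 0 M + 1.
  by apply: (@le_lt_trans _ _ (Num.max 0 M)); [rewrite le_max lexx orbT|rewrite ltrDl].
exists (Num.max 0 M + 1); first by rewrite addr_ge0.
move=> z Az; have := hM _ MM z Az.
by rewrite /Num.norm/= ge_max => /andP[].
Qed.

Lemma box_compact (M : R) : compact [set z : R * R | `|z.1| <= M /\ `|z.2| <= M].
Proof.
have -> : [set z : R * R | `|z.1| <= M /\ `|z.2| <= M] = `[-M, M] `*` `[-M, M].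
  by apply/seteqP; split => -[x y] /=; rewrite !in_itv/= !ler_norml.
by apply: compact_setX; exact: segment_compact.
Qed.

Lemma cont_compact_bounded (f : R * R -> R) A : continuous f -> compact A ->
  exists2 M, 0 <= M & forall z, A z -> `|f z| <= M.
Proof.
move=> cf cA.
have : compact (f @` A) by apply: continuous_compact => //; exact: continuous_subspaceT.
move=> /compact_bounded[M [_ hM]].
have M1 : 0 <= Num.max 0 M by rewrite le_max lexx.
have MM : M < Num.max 0 M + 1.
  by apply: (@le_lt_trans _ _ (Num.max 0 M)); [rewrite le_max lexx orbT|rewrite ltrDl].
exists (Num.max 0 M + 1); first by rewrite addr_ge0.
by move=> z Az; apply: (hM _ MM); exists z.
Qed.

Lemma test_supp O phi : test_function O phi -> exists A, [/\ compact A, A `<=` O,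
  forall z, ~ A z -> phi z = 0, forall z, ~ A z -> 'D_e1 phi z = 0 &
  forall z, ~ A z -> 'D_e2 phi z = 0].
Proof.
move=> [h1 h2 h3]; exists (closure [set z | phi z != 0]).
have c : closed (closure [set z | phi z != 0]) by exact: closed_closure.
have h z : ~ closure [set z | phi z != 0] z -> phi z = 0.
  move=> hz; apply/eqP; apply: contrapT => /negP hne; apply: hz.
  exact: subset_closure.
by split => //; apply: zero_derive.
Qed.

Lemma test_bounded O phi : test_function O phi -> exists2 K, 0 <= K & forall z,
  [/\ `|phi z| <= K, `|'D_e1 phi z| <= K & `|'D_e2 phi z| <= K].
Proof.
move=> t; have [A [cA AO h0 h1 h2]] := test_supp t.
have s := test_smooth t.
have [K0 K00 hK0] := cont_compact_bounded (smooth2_continuous s) cA.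
have [K1 K10 hK1] := cont_compact_bounded (smooth2_continuous (smooth2_D1 s)) cA.
have [K2 K20 hK2] := cont_compact_bounded (smooth2_continuous (smooth2_D2 s)) cA.
exists (K0 + K1 + K2); first by rewrite !addr_ge0.
move=> z; have [Az|nAz] := pselect (A z).
  split; [apply: le_trans (hK0 _ Az) _|apply: le_trans (hK1 _ Az) _|apply: le_trans (hK2 _ Az) _]; lra.
by rewrite (h0 _ nAz) (h1 _ nAz) (h2 _ nAz) normr0 !addr_ge0.
Qed.

Lemma measurable_test O phi : test_function O phi ->
  [/\ measurable_fun setT (phi : T1 * T1 -> R),
      measurable_fun setT ('D_e1 phi : T1 * T1 -> R) &
      measurable_fun setT ('D_e2 phi : T1 * T1 -> R)].
Proof.
move=> /test_smooth s; split; apply: cont2_measurable; apply: smooth2_continuous => //.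
  exact: smooth2_D1.
exact: smooth2_D2.
Qed.

(** The working form of a weak gradient: all three functions are integrable on the whole plane,
    typically zero outside [O], and only the test functions know about [O]. Sums, reflections and
    changes of [O] then need no integrals over subsets. *)
Definition WD O (u g1 g2 : R * R -> R) := [/\ L1 mu2 u, L1 mu2 g1, L1 mu2 g2,
  (forall phi, test_function O phi ->
     Int mu2 (fun z => u z * 'D_e1 phi z) = - Int mu2 (fun z => g1 z * phi z)) &
  (forall phi, test_function O phi ->
     Int mu2 (fun z => u z * 'D_e2 phi z) = - Int mu2 (fun z => g2 z * phi z))].

Lemma L1_mul u (w : R * R -> R) K : L1 mu2 u -> measurable_fun setT (w : T1 * T1 -> R) ->
  (forall z, `|w z| <= K) -> L1 mu2 (fun z => u z * w z).
Proof.
move=> hu mw hK; have := L1M hu mw hK; congr (L1 _ _).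
by apply/funext => z; rewrite mulrC.
Qed.

(** [Psi] is the integral from minus infinity, so it is zero left of the support but constant, in
    general nonzero, to the right; as a factor of a test function it has to be cut off there. *)
Lemma primitive (psi : R -> R) (p q : R) : smooth1 psi ->
  (forall y, y < p \/ q < y -> psi y = 0) ->
  exists Psi : R -> R, [/\ smooth1 Psi, forall y, is_derive y (1:R) Psi (psi y),
    forall y, y <= p -> Psi y = 0 & exists K, forall y, `|Psi y| <= K].
Proof.
move=> sp p0; have cp := smooth1_continuous sp.
have hp : L1 lm psi by exact: L1_cont_supp cp p0.
pose Psi y := Rintegral lm `]-oo, y] psi.
have dP y : is_derive y (1:R) Psi (psi y).
  have yy : y < y + 1 by rewrite ltrDl.
  have [] := @continuous_FTC1 _ psi -oo%O y (y + 1) yy.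
  - by apply: integrableS hp.
  - by rewrite ltNyr.
  - exact: cp.
  by move=> dd <-; rewrite derive1E; exact: derivableP.
exists Psi; split => //.
(* A class closed under differentiation stays so when a primitive of one of its members is
   adjoined. *)
- have [S Sp hS] := sp; exists (S `|` [set Psi]); first by right.
  move=> f [/hS[f' Sf' h]|->]; first by exists f' => //; left.
  by exists psi => //; left.
- move=> y yp; rewrite /Psi -Rintegral_itv_bndo_bndc; last by apply: integrableS hp.
  rewrite Rintegral_mkcond (_ : psi \_ `]-oo, y[ = cst 0); first exact: Int0.
  apply/funext => x; rewrite patchE; case: ifPn => //.
  by rewrite inE/= in_itv/= => xy; rewrite p0//; left; lra.
- exists (Int lm (fun s => `|psi s|)) => y; rewrite /Psi Rintegral_mkcond.
  have h1 : L1 lm (psi \_ `]-oo, y]).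
    apply: (L1_le _ hp) => [|x]; last by rewrite patchE; case: ifP; rewrite ?normr0.
    by apply/(measurable_restrictT _ _).1 => //; apply: measurable_funTS; exact: (L1_meas hp).
  apply: le_trans (le_norm_Int h1) _; apply: le_Int.
  + exact: L1_norm.
  + exact: L1_norm.
  + by move=> x; rewrite patchE; case: ifP; rewrite ?normr0.
Qed.

End Test.

(** * Absolute continuity on almost every vertical line *)

Section ACL.
Context (R : realType).
Local Notation T1 := (measurableTypeR R).
Local Notation lm := (@lebesgue_measure R).
Local Notation mu2 := (mu2 R).
Local Notation e1 := (e1 R).
Local Notation e2 := (e2 R).

Lemma ae_countable d (T : measurableType d) (mu : {measure set T -> \bar R})
    (K : countType) (P : K -> set T) :
  (forall k, {ae mu, forall x, P k x}) -> {ae mu, forall x, forall k, P k x}.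
Proof.
move=> h.
pose Q n x := if unpickle n is Some k then P k x else True.
have : {ae mu, forall x, forall n, Q n x}.
  apply: ae_foralln => n; rewrite /Q; case: (unpickle n) => [k|]; [exact: h|exact: aeW].
by move=> hQ; apply: (aeS hQ) => x hx k; have := hx (pickle k); rewrite /Q pickleK.
Qed.

Definition above (I : set R) (F : R -> R) : set (R * R) := [set z | I z.1 /\ F z.1 < z.2].

Context (I : set R) (F : R -> R) (u g1 g2 : R * R -> R) (Mt : R).
Hypotheses (oI : open I) (cF : continuous F) (wd : WD (above I F) u g1 g2).
Hypothesis (out : forall z, ~ above I F z -> u z = 0 /\ g2 z = 0).
Hypothesis (top : forall z, Mt <= z.2 -> u z = 0 /\ g2 z = 0).

(** The columns whose points at height [s0] or above all lie in the domain: over this open set,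
    products of a function of [x] and a function of [y] are admissible tests. *)
Let J (s0 : R) : set R := [set x | I x /\ F x < s0].

Lemma open_J s0 : open (J s0).
Proof.
apply: openI => //.
have := @open_comp _ _ F [set y | y < s0]; apply; first by move=> x _; exact: cF.
exact: open_lt.
Qed.

Definition is_prim (psi Psi : R -> R) (p : R) := [/\ smooth1 Psi,
  forall y, is_derive y (1:R) Psi (psi y),
    forall y, y <= p -> Psi y = 0 & exists K, forall y, `|Psi y| <= K].

(** The test function is a plateau in [x] times the primitive [Psi] of a plateau in [y]. The
    identity obtained holds for all plateaus in [x], and [FL1] turns it into an identity on almost
    every column. *)
Lemma ACL_step (s0 p q : R) n : s0 <= p -> p < q ->
  exists2 Psi, is_prim (plateau p q n) Psi p &
  {ae lm, forall x, J s0 x -> Int lm (fun y => u (x, y) * plateau p q n y + g2 (x, y) * Psi y) = 0}.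
Proof.
move=> sp pq.
have [hu hg1 hg2 _ w2] := wd.
have bs y : y < p \/ q < y -> plateau p q n y = 0.
  by move=> h; apply: plateau_supp; case: h => h; [left|right]; exact: ltW.
have [Psi hPsi] := primitive (smooth1_plateau p q n) bs.
exists Psi => //; have [sPsi dPsi Psi0 [K hK]] := hPsi.
have mPsi : measurable_fun setT (Psi : T1 -> R).
  by apply: continuous_measurable_fun; exact: smooth1_continuous.
have mb := @measurable_plateau R p q n.
pose k (z : R * R) := u z * plateau p q n z.2 + g2 z * Psi z.2.
have hk : L1 mu2 k.
  apply: L1D.
    apply: (L1_mul (K := 1)) => //; first exact: (measurableT_comp mb measurable_snd).
    by move=> z; exact: plateau_le1.
  apply: (L1_mul (K := K)) => //; exact: (measurableT_comp mPsi measurable_snd).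
suff h : {ae lm, forall x, J s0 x -> Int lm (fun y => k (x, y)) = 0} by exact: h.
apply: (FL1 (@open_J s0) (L1_marg hk)) => a b abJ m.
set al := ratr a; set be := ratr b.
(* Equal to 1 below [Mt] and to 0 above [Mt + 1]: it makes the support compact and changes nothing
   in the integrals, since [u] and [g2] vanish above [Mt]. *)
pose kap (y : R) := sigma (Mt + 1 - y).
have skap : smooth1 kap.
  have := @smooth1_affine _ _ (-1) (Mt + 1) (@smooth1_sigma R).
  by under eq_fun do rewrite mulN1r addrC.
pose phi (z : R * R) := plateau al be m z.1 * (Psi z.2 * kap z.2).
pose A : set (R * R) := `[al, be] `*` `[p, Mt + 1].
have tphi : test_function (above I F) phi.
  apply: (@test_intro _ _ A).
  - apply: Sm_mul; first by apply: (Sm_comp1 (smooth1_plateau _ _ _)); exact: Sm_fst.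
    by apply: Sm_mul; [apply: (Sm_comp1 sPsi)|apply: (Sm_comp1 skap)]; exact: Sm_snd.
  - by apply: compact_setX; exact: segment_compact.
  - move=> z [/= h1]; rewrite in_itv/= => /andP[pz _].
    by have [Iz Fz] := abJ _ h1; split => //; lra.
  - move=> z /= nA; rewrite /phi /kap.
    have [h1|h1] := boolP (z.1 \in `[al, be]); last first.
      rewrite plateau_supp ?mul0r//; move: h1; rewrite in_itv/= negb_and -!ltNge.
      by move=> /orP[] h; [left|right]; exact: ltW.
    have [h2|h2] := leP z.2 p; first by rewrite Psi0// mul0r mulr0.
    have [h3|h3] := leP (Mt + 1) z.2; first by rewrite [sigma _]sigma_le0 ?mulr0//; lra.
    by exfalso; apply: nA; split => //; rewrite /= in_itv/= (ltW h2) (ltW h3).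
have := w2 _ tphi.
have dphi z : 'D_e2 phi z = plateau al be m z.1 * (Psi z.2 * derive1 kap z.2 + kap z.2 * plateau p q n z.2).
  have h : is_derive z e2 phi (plateau al be m z.1 * (Psi z.2 * derive1 kap z.2 + kap z.2 * plateau p q n z.2)).
    apply/is_derive_e2; rewrite /phi/=.
    have h1 := is_deriveM (dPsi z.2) (smooth1_derivable z.2 skap).
    exact: (is_deriveZ _ h1).
  by case: h.
have kap1 y : y < Mt -> kap y = 1 by move=> h; rewrite /kap sigma_ge1//; lra.
have kap'0 y : y < Mt -> derive1 kap y = 0.
  move=> hy; have h : is_derive y (1:R) kap 0.
    apply: (@near_eq_is_derive _ R R (cst (1:R))).
    by near=> t; rewrite kap1//; near: t; exact: near_lt.
  by rewrite derive1E; case: h.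
have -> : (fun z => u z * 'D_e2 phi z) = (fun z => plateau al be m z.1 * (u z * plateau p q n z.2)).
  apply/funext => z; rewrite dphi; have [h|h] := leP Mt z.2.
    by have [-> _] := top h; rewrite !mul0r mulr0.
  by rewrite kap1// kap'0// mulr0 add0r mul1r mulrCA.
have -> : (fun z => g2 z * phi z) = (fun z => plateau al be m z.1 * (g2 z * Psi z.2)).
  apply/funext => z; rewrite /phi; have [h|h] := leP Mt z.2.
    by have [_ ->] := top h; rewrite !mul0r mulr0.
  by rewrite kap1// mulr1 mulrCA.
have L1a : L1 mu2 (fun z => plateau al be m z.1 * (u z * plateau p q n z.2)).
  apply: (L1M (M := 1)); last by move=> z; exact: plateau_le1.
    apply: (L1_mul (K := 1)) => //; first exact: (measurableT_comp mb measurable_snd).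
    by move=> z; exact: plateau_le1.
  exact: (measurableT_comp (measurable_plateau _ _ _) measurable_fst).
have L1b : L1 mu2 (fun z => plateau al be m z.1 * (g2 z * Psi z.2)).
  apply: (L1M (M := 1)); last by move=> z; exact: plateau_le1.
    apply: (L1_mul (K := K)) => //; exact: (measurableT_comp mPsi measurable_snd).
  exact: (measurableT_comp (measurable_plateau _ _ _) measurable_fst).
move=> /eqP; rewrite -addr_eq0 -IntD// => /eqP.
rewrite (_ : (fun z => _ + _) = fun z => plateau al be m z.1 * k z); last first.
  by apply/funext => z; rewrite -mulrDr.
have L1k : L1 mu2 (fun z : R * R => plateau al be m z.1 * k z).
  apply: (L1M (M := 1)) => //; last by move=> z; exact: plateau_le1.
  exact: (measurableT_comp (measurable_plateau _ _ _) measurable_fst).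
rewrite Int2// => <-.
apply: Int_ae.
- apply: measurable_funM; first exact: L1_meas (L1_marg hk).
  exact: measurable_plateau.
- exact: L1_meas (L1_marg L1k).
apply: (aeS (L1_fiber hk)) => x hx /=.
by rewrite mulrC -IntZ.
Unshelve. all: by end_near. Qed.

(** The constant of integration is zero because [u] vanishes above [Mt]. On a good column, [ibp]
    shows that [u] and minus the tail integral of [g2] have the same integral against every rational
    plateau above the graph, and [FL1] applies in [y]. *)
Lemma ACL : {ae lm, forall x, {ae lm, forall y, F x < y ->
  u (x, y) = - Int lm (fun s => (y < s)%R%:R * g2 (x, s))}}.
Proof.
have [hu hg1 hg2 _ w2] := wd.
(* The exceptional set of columns depends on [s0], [p], [q] and [n]; with rational parameters a
   single null set serves for all. *)
pose P (k : rat * rat * rat * nat) x := let: (s0, p, q, n) := k in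
  ratr s0 <= ratr p :> R -> ratr p < ratr q :> R -> J (ratr s0) x ->
  exists2 Psi, is_prim (plateau (ratr p) (ratr q) n) Psi (ratr p) &
    Int lm (fun y => u (x, y) * plateau (ratr p) (ratr q) n y + g2 (x, y) * Psi y) = 0.
have hP : {ae lm, forall x k, P k x}.
  apply: ae_countable => -[[[s0 p] q] n]; rewrite /P.
  have [h1|h1] := leP (ratr s0 : R) (ratr p); last by apply: aeW.
  have [h2|h2] := ltP (ratr p : R) (ratr q); last by apply: aeW => x _ h3 _; exfalso; lra.
  have [Psi hPsi hae] := ACL_step n h1 h2.
  by apply: (aeS hae) => x hx _ _ Jx; exists Psi => //; exact: hx.
apply: (aeS3 hP (L1_fiber hu) (L1_fiber hg2)) => x hx fu fg.
have [Ix|nIx] := pselect (I x); last first.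
  apply: aeW => y Fy; have [-> _] := out (z := (x, y)) (fun h => nIx h.1).
  rewrite (_ : (fun s => _) = cst 0) ?Int0 ?oppr0//.
  by apply/funext => s; have [_ ->] := out (z := (x, s)) (fun h => nIx h.1); rewrite mulr0.
set g := fun s => g2 (x, s) in fg *.
pose T y := Int lm (fun s => (y < s)%R%:R * g s).
have ibg y : L1 lm (fun s => (y < s)%R%:R * g s).
  by apply: (L1M (M := 1)) => //; [exact: measurable_ltr|move=> s; exact: norm_bool].
(* Makes the tail integral [T], which need not decay at minus infinity, integrable; above [Mt] it
   discards nothing, since [T] is zero there. *)
pose cut y := (F x < y)%R%:R * (y < Mt)%R%:R : R.
have mcut : measurable_fun setT (cut : T1 -> R).
  by apply: measurable_funM; exact: measurable_ltr.
have cut0 y : y < F x \/ Mt < y -> cut y = 0.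
  rewrite /cut => -[h|h]; first by rewrite (_ : (F x < y) = false) ?mul0r//; apply/negbTE; rewrite -leNgt ltW.
  by rewrite (_ : (y < Mt) = false) ?mulr0//; apply/negbTE; rewrite -leNgt ltW.
have cutL1 : L1 lm cut.
  apply: (L1_supp (M := 1) mcut _ cut0).
  by move=> y; rewrite normrM mulr_ile1// norm_bool.
have cTL1 : L1 lm (fun y => cut y * T y).
  have h : L1 mu2 (fun z : R * R => (z.1 < z.2)%R%:R * (cut z.1 * g z.2)).
    apply: (L1M (M := 1)); first exact: L1_tensor.
      by apply: measurable_ltr; [exact: measurable_fst|exact: measurable_snd].
    by move=> z; exact: norm_bool.
  have := L1_marg h; congr (L1 _ _); apply/funext => y /=.
  by rewrite -IntZ//; congr Int; apply/funext => s; rewrite mulrCA.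
pose f y := u (x, y) + cut y * T y.
have fL1 : L1 lm f by exact: L1D.
have oK : open [set y : R | F x < y] by exact: open_gt.
suff h : {ae lm, forall y, F x < y -> f y = 0}.
  apply: (aeS h) => y hy Fy; move: (hy Fy); rewrite /f /cut Fy mul1r.
  have [yM|My] := ltP y Mt; first by rewrite mul1r => /eqP; rewrite addr_eq0 => /eqP.
  have [-> _] := top (z := (x, y)) My.
  rewrite mul0r addr0 => _.
  rewrite (_ : (fun s => _) = cst 0) ?Int0 ?oppr0//.
  apply/funext => s; have [ys|] := ltP y s; last by rewrite mul0r.
  have Ms : Mt <= (x, s).2 by rewrite /=; lra.
  by have [_ ->] := top Ms; rewrite mulr0.
apply: (FL1 oK fL1) => p q pqK n.
have [pq|qp] := ltP (ratr p : R) (ratr q); last first.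
  rewrite (_ : (fun y => _) = cst 0) ?Int0//; apply/funext => y.
  rewrite plateau_supp ?mulr0//; have [?|?] := leP y (ratr p); [by left|right; lra].
have Fp : F x < ratr p.
  by apply: pqK; rewrite /= in_itv/= lexx ltW.
(* A rational level between the graph and [p] places the column in one of the countably many sets
   [J]. *)
have [s0] := rat_in_itvoo Fp; rewrite in_itv/= => hs0.
have s0p : ratr s0 <= ratr p :> R by lra.
have Js0 : J (ratr s0) x by split => //; lra.
have [Psi [sPsi dPsi Psi0 [K hK]]] := hx (s0, p, q, n) s0p pq Js0.
have mb := @measurable_plateau R (ratr p) (ratr q) n.
have ub : L1 lm (fun y => u (x, y) * plateau (ratr p) (ratr q) n y).
  have := L1M (M := 1) fu mb (plateau_le1 _ _ _); congr (L1 _ _).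
  by apply/funext => y; rewrite mulrC.
have mPsi : measurable_fun setT (Psi : T1 -> R).
  by apply: continuous_measurable_fun; exact: smooth1_continuous.
have gP : L1 lm (fun y => g y * Psi y).
  have := L1M fg mPsi hK; congr (L1 _ _).
  by apply/funext => y; rewrite mulrC.
rewrite IntD// => E.
have cTb : L1 lm (fun y => cut y * T y * plateau (ratr p) (ratr q) n y).
  have := L1M (M := 1) cTL1 mb (plateau_le1 _ _ _); congr (L1 _ _).
  by apply/funext => y; rewrite mulrC.
rewrite /f; under [X in Int _ X]eq_fun do rewrite mulrDl.
rewrite IntD//.
have bs (y : R) : y < ratr p \/ ratr q < y -> plateau (ratr p) (ratr q) n y = 0.
  by move=> h; apply: plateau_supp; case: h => h; [left|right]; exact: ltW.
have := @ibp _ g Psi _ (ratr p) (ratr q) (ratr p) fg dPsi (smooth1_continuous (smooth1_plateau _ _ n)) bs.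
have -> : (fun y => (ratr p < y)%R%:R * plateau (ratr p) (ratr q) n y * Int lm (fun s => (y < s)%R%:R * g s)) =
    (fun y => cut y * T y * plateau (ratr p) (ratr q) n y).
  apply/funext => y; rewrite -/(T y).
  have [yp|py] := leP y (ratr p); first by rewrite plateau_supp ?mulr0 ?mul0r//; left.
  rewrite mul1r /cut (_ : F x < y) ?mul1r; last by lra.
  have [yM|My] := ltP y Mt; first by rewrite mul1r mulrC.
  rewrite mul0r mul0r /T (_ : (fun s => _) = cst 0) ?Int0 ?mulr0//.
  apply/funext => s; have [ys|] := ltP y s; last by rewrite mul0r.
  have Ms : Mt <= (x, s).2 by rewrite /=; lra.
  by have [_ h] := top Ms; rewrite /g h mulr0.
move=> ->.
rewrite -[RHS]E; congr (_ + _); congr Int; apply/funext => s.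
rewrite (Psi0 (ratr p))// subr0.
by have [sp|ps] := leP s (ratr p); [rewrite (Psi0 s)// !mulr0|rewrite mul1r].
Qed.

End ACL.

Section AeInt.
Context d (T : measurableType d) (R : realType) (mu : {measure set T -> \bar R}).
Implicit Types f g : T -> R.

Lemma ae_le_Int f g : L1 mu f -> L1 mu g -> {ae mu, forall x, f x <= g x} ->
  Int mu f <= Int mu g.
Proof.
move=> hf hg fg; have mf := L1_meas hf; have mg := L1_meas hg.
have mm : measurable_fun setT (fun x => Num.min (f x) (g x)) by exact: measurable_minr.
have e : {ae mu, forall x, f x = Num.min (f x) (g x)}.
  by apply: (aeS fg) => x h; rewrite min_l.
rewrite (Int_ae mf mm e); apply: le_Int => //; first exact: (L1_ae hf mm e).
by move=> x; rewrite ge_min lexx orbT.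
Qed.

End AeInt.

Lemma measurable_invR (R : realType) :
  measurable_fun setT (@GRing.inv R : measurableTypeR R -> R).
Proof.
pose D : set R := [set x | x != 0].
have oD : open D by exact: open_neq.
have -> : @GRing.inv R = (@GRing.inv R) \_ D.
  apply/funext => x; rewrite patchE; case: ifPn => //.
  by rewrite notin_setE /D/= => /negP; rewrite negbK => /eqP->; rewrite invr0.
apply/(measurable_restrictT _ _).1; first exact: open_measurable.
apply: open_continuous_measurable_fun => // x; rewrite inE => /= x0.
by apply: (@cvgV R R) => //; exact: cvg_id.
Qed.

(** * Hardy's inequality and vertical integration by parts *)

Section Hardy.
Context (R : realType).
Local Notation T1 := (measurableTypeR R).
Local Notation lm := (@lebesgue_measure R).
Local Notation mu2 := (mu2 R).
Local Notation e1 := (e1 R).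
Local Notation e2 := (e2 R).

Context (I : set R) (F d : R -> R) (u g1 g2 : R * R -> R) (Mt : R).
Hypotheses (oI : open I) (cF : continuous F) (cd : continuous d) (d0 : forall x, 0 <= d x).
Hypothesis (wd : WD (above I F) u g1 g2).
Hypothesis (out : forall z, ~ above I F z -> u z = 0 /\ g2 z = 0).
Hypothesis (top : forall z, Mt <= z.2 -> u z = 0 /\ g2 z = 0).
Hypothesis (dout : forall z, d z.1 <= 0 -> u z = 0 /\ g2 z = 0).

(* The factor [3] makes room for the layers of height [dn n] over the graphs of
   [Fn n], for smooth approximations [Fn] and [dn] of [F] and [d]. *)
Definition wgt (z : R * R) : R :=
  (F z.1 < z.2)%R%:R * (z.2 < F z.1 + 3 * d z.1)%R%:R * (d z.1)^-1.

Lemma measurable_fst1 (f : R -> R) : continuous f -> measurable_fun setT ((fun z => f z.1) : T1 * T1 -> R).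
Proof.
move=> cf; have mf := continuous_measurable_fun cf.
exact: (measurableT_comp mf measurable_fst).
Qed.

Lemma measurable_inv1 (f : R -> R) : continuous f ->
  measurable_fun setT ((fun z => (f z.1)^-1) : T1 * T1 -> R).
Proof.
move=> cf; have mf := measurable_fst1 cf.
exact: (measurableT_comp (@measurable_invR R) mf).
Qed.

Lemma measurable_wgt : measurable_fun setT (wgt : T1 * T1 -> R).
Proof.
have mF := measurable_fst1 cF; have md := measurable_fst1 cd.
apply: measurable_funM; last exact: measurable_inv1.
apply: measurable_funM; apply: measurable_ltr => //.
by apply: measurable_funD => //; apply: measurable_funM.
Qed.

Lemma wgt_ge0 z : 0 <= wgt z.
Proof. by rewrite /wgt !mulr_ge0// invr_ge0. Qed.

Definition tot (g : R * R -> R) (x : R) := Int lm (fun y => `|g (x, y)|).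

Lemma ae_fiber_bound : {ae lm, forall x, {ae lm, forall y, `|u (x, y)| <= tot g2 x}}.
Proof.
have [hu _ hg2 _ _] := wd.
apply: (aeS2 (ACL oI cF wd out top) (L1_fiber hg2)) => x hx fg.
apply: (aeS hx) => y hy; have [Fy|yF] := ltP (F x) y; last first.
  have nab : ~ above I F (x, y) by move=> [_] /=; rewrite ltNge yF.
  by have [-> _] := out nab; rewrite normr0; exact: Int_ge0.
rewrite (hy Fy) normrN.
have h : L1 lm (fun s => (y < s)%R%:R * g2 (x, s)).
  by apply: (L1M (M := 1)) => //; [exact: measurable_ltr|move=> s; exact: norm_bool].
apply: le_trans (le_norm_Int h) _; apply: le_Int; [exact: L1_norm|exact: L1_norm|].
by move=> s; rewrite normrM ler_piMl// norm_bool.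
Qed.

(** The weight is [1 / d x] on an interval of length [3 d x], so its integral is 3 however small
    [d x] is. *)
Lemma hardy_fiber (x S : R) : 0 <= S -> measurable_fun setT (fun y : T1 => u (x, y)) ->
  {ae lm, forall y, `|u (x, y)| <= S} ->
  L1 lm (fun y => u (x, y) * wgt (x, y)) /\
  Int lm (fun y => `|u (x, y) * wgt (x, y)|) <= 3 * S.
Proof.
move=> S0 mu h.
have mw : measurable_fun setT (fun y : T1 => wgt (x, y)) by apply: fibx_measurable; exact: measurable_wgt.
have [dx|dx] := leP (d x) 0.
  have E : (fun y => u (x, y) * wgt (x, y)) = cst 0.
    by apply/funext => y; have [-> _] := dout (z := (x, y)) dx; rewrite mul0r.
  have E2 : (fun y => `|u (x, y) * wgt (x, y)|) = cst 0.
    by apply/funext => y; have [-> _] := dout (z := (x, y)) dx; rewrite mul0r normr0.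
  by rewrite E E2 Int0; split; [exact: L10|rewrite mulr_ge0].
have FF : F x <= F x + 3 * d x by lra.
have [iL iI] := Int_indic FF.
have bL : L1 lm (fun y => (S / d x) * \1_(`[F x, F x + 3 * d x]%classic) y) by exact: L1Z.
have ble : {ae lm, forall y, `|u (x, y) * wgt (x, y)| <= (S / d x) * \1_(`[F x, F x + 3 * d x]%classic) y}.
  apply: (aeS h) => y hy; rewrite normrM (ger0_norm (wgt_ge0 _)) /wgt/=.
  have [h1|h1] := boolP ((F x < y) && (y < F x + 3 * d x)); last first.
    rewrite (_ : (F x < y)%R%:R * (y < F x + 3 * d x)%R%:R = 0).
      by rewrite mul0r mulr0 !mulr_ge0// invr_ge0.
    by move: h1; rewrite negb_and => /orP[]/negbTE->; rewrite ?mul0r ?mulr0.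
  move: (h1) => /andP[-> ->]; rewrite !mul1r indicE mem_set ?mulr1.
    by rewrite ler_wpM2r// invr_ge0.
  by rewrite /= in_itv/=; move: h1; lra.
have mm : measurable_fun setT (fun y : T1 => u (x, y) * wgt (x, y)) by exact: measurable_funM.
have L : L1 lm (fun y => u (x, y) * wgt (x, y)).
  apply: (L1_ae_le mm bL); apply: (aeS ble) => y hy.
  by apply: le_trans hy (ler_norm _).
split => //; have <- : Int lm (fun y => (S / d x) * \1_(`[F x, F x + 3 * d x]%classic) y) = 3 * S.
  rewrite IntZ// iI; field; by rewrite gt_eqF.
by apply: ae_le_Int => //; exact: L1_norm.
Qed.

(** With the weight [1 / (y - F x)] the integral would diverge as soon as [u] does not vanish on the
    graph; here the weight is constant on each column of the layer, and the bound of [|u|] by the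
    total variation of the column suffices. *)
Lemma hardy : L1 mu2 (fun z => u z * wgt z) /\
  Int mu2 (fun z => `|u z * wgt z|) <= 3 * Int mu2 (fun z => `|g2 z|).
Proof.
have [hu _ hg2 _ _] := wd.
have mu' := L1_meas hu.
have mm : measurable_fun setT ((fun z => u z * wgt z) : T1 * T1 -> R).
  by apply: measurable_funM => //; exact: measurable_wgt.
have hS : L1 lm (fun x => 3 * tot g2 x) by apply: L1Z; exact: (L1_marg (L1_norm hg2)).
have hfib : {ae lm, forall x, L1 lm (fun y => u (x, y) * wgt (x, y)) /\
  Int lm (fun y => `|u (x, y) * wgt (x, y)|) <= 3 * tot g2 x}.
  apply: (aeS ae_fiber_bound) => x hx; apply: hardy_fiber hx.
    exact: Int_ge0.
  exact: fibx_measurable.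
have L : L1 mu2 (fun z => u z * wgt z).
  by apply: (L1_tonelli mm _ hS); apply: (aeS hfib) => x [].
split=> //.
have Ln := L1_norm L.
rewrite (Int2 Ln) (Int2 (L1_norm hg2)) -IntZ; last exact: (L1_marg (L1_norm hg2)).
apply: ae_le_Int => //; first exact: (L1_marg Ln).
by apply: (aeS hfib) => x [].
Qed.

(** The cutoff [H], read on the side of the graph where [u] lives: 1 on the graph and 0 from height
    [d] on. Composing it with [refl F] turns height into depth. *)
Definition hcut (z : R * R) : R := (0 < d z.1)%R%:R * (1 - sigma ((z.2 - F z.1) / d z.1)).
Definition hcutY (z : R * R) : R := - ((0 < d z.1)%R%:R * dsigma ((z.2 - F z.1) / d z.1) / d z.1).

Lemma measurable_td : measurable_fun setT ((fun z => (z.2 - F z.1) / d z.1) : T1 * T1 -> R).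
Proof.
apply: measurable_funM; last exact: measurable_inv1.
by apply: measurable_funB => //; exact: measurable_fst1.
Qed.

Lemma measurable_hcut : measurable_fun setT (hcut : T1 * T1 -> R).
Proof.
apply: measurable_funM; first by apply: measurable_ltr => //; exact: measurable_fst1.
apply: measurable_funB => //.
have ms := continuous_measurable_fun (smooth1_continuous (@smooth1_sigma R)).
exact: (measurableT_comp ms measurable_td).
Qed.

Lemma measurable_hcutY : measurable_fun setT (hcutY : T1 * T1 -> R).
Proof.
apply: measurableT_comp => //; apply: measurable_funM; last exact: measurable_inv1.
apply: measurable_funM; first by apply: measurable_ltr => //; exact: measurable_fst1.
have ms := continuous_measurable_fun (smooth1_continuous (@smooth1_dsigma R)).
exact: (measurableT_comp ms measurable_td).
Qed.

Lemma hcut_bound z : `|hcut z| <= 1.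
Proof.
rewrite normrM mulr_ile1// ?norm_bool// ger0_norm.
  by have := sigma_ge0 ((z.2 - F z.1) / d z.1); lra.
by have := sigma_le1 ((z.2 - F z.1) / d z.1); lra.
Qed.

(** Common to the two derivatives of [hcut]: they are of size [1 / d] and vanish above height [d],
    so that products with [u] are controlled by [hardy]. *)
Lemma layer_bound (w : R * R -> R) (K : R) : 0 <= K ->
  (forall z, 0 < d z.1 -> F z.1 < z.2 -> `|w z| <= K / d z.1) ->
  (forall z, 0 < d z.1 -> F z.1 + d z.1 < z.2 -> w z = 0) ->
  forall z, `|u z * w z| <= K * `|u z * wgt z|.
Proof.
move=> K0 h1 h2 z.
have rhs0 : 0 <= K * `|u z * wgt z| by rewrite mulr_ge0.
have [dz|dz] := leP (d z.1) 0; first by have [-> _] := dout dz; rewrite !mul0r normr0 mulr0.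
have [zF|Fz] := leP z.2 (F z.1).
  have nab : ~ above I F z by move=> [_] /=; rewrite ltNge zF.
  by have [-> _] := out nab; rewrite !mul0r normr0 mulr0.
have [zd|zd] := ltP (F z.1 + d z.1) z.2; first by rewrite h2// mulr0 normr0.
rewrite normrM [X in _ <= _ * X]normrM (ger0_norm (wgt_ge0 _)) mulrCA ler_wpM2l//.
rewrite /wgt Fz (_ : z.2 < F z.1 + 3 * d z.1) ?mul1r; last by lra.
exact: h1.
Qed.

Variable Ks : R.
Hypotheses (Ks0 : 0 <= Ks) (hKs : forall x, `|@dsigma R x| <= Ks).

Lemma hcutY_layer z : `|u z * hcutY z| <= Ks * `|u z * wgt z|.
Proof.
apply: layer_bound => // {}z dz Fz; rewrite /hcutY dz mul1r.
  by rewrite normrN normrM (gtr0_norm (_ : 0 < (d z.1)^-1)) ?invr_gt0// ler_wpM2r// invr_ge0 ltW.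
by rewrite dsigma_gt1 ?mul0r ?oppr0// ltr_pdivlMr//; lra.
Qed.

Lemma L1_uhY : L1 mu2 (fun z => u z * hcutY z).
Proof.
have [hu _ _ _ _] := wd; have [hw _] := hardy.
have hb : L1 mu2 (fun z => Ks * `|u z * wgt z|) by apply: L1Z; exact: L1_norm.
have mm : measurable_fun setT ((fun z => u z * hcutY z) : T1 * T1 -> R).
  by apply: measurable_funM; [exact: (L1_meas hu)|exact: measurable_hcutY].
by apply: (L1_le mm hb) => z; apply: le_trans (hcutY_layer z) (ler_norm _).
Qed.

Variables (phi : R * R -> R) (Kp : R) (Bx : R).
Hypotheses (sphi : smooth2 phi) (Kp0 : 0 <= Kp)
  (hKp : forall z, [/\ `|phi z| <= Kp, `|'D_e1 phi z| <= Kp & `|'D_e2 phi z| <= Kp])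
  (phi0 : forall z, Bx < `|z.2| -> phi z = 0).

(* [chiM] vanishes on the graph, so that it may serve as a test function for the
   vertical derivative although its support reaches the graph. *)
Definition chiM z := phi z - hcut z * phi (refl F z).
Definition chiMY z := 'D_e2 phi z - hcutY z * phi (refl F z) + hcut z * 'D_e2 phi (refl F z).

Lemma measurable_phir (f : R * R -> R) : continuous f ->
  measurable_fun setT ((fun z => f (refl F z)) : T1 * T1 -> R).
Proof.
move=> cf; apply: (measurableT_comp (cont2_measurable cf)).
by apply: measurable_refl; exact: continuous_measurable_fun.
Qed.

Lemma chi_fiber x : 0 < d x ->
  smooth1 (fun y => chiM (x, y)) /\
  forall y, is_derive y (1:R) (fun y => chiM (x, y)) (chiMY (x, y)).
Proof.
move=> dx; rewrite /chiM /chiMY /hcut /hcutY /refl/= dx.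
split.
  have -> : (fun y => phi (x, y) - 1%:R * (1 - sigma ((y - F x) / d x)) * phi (x, 2 * F x - y)) =
      (fun y => phi (x, y) + (-1) * ((1 + (-1) * sigma ((y + (- F x)) * (d x)^-1)) * phi (x, 2 * F x + (-1) * y))).
    by apply/funext => y; rewrite !mulN1r mul1r.
  apply: (@Sm_smooth1 _ (fun z => phi (x, z.1) + (-1) * ((1 + (-1) * sigma ((z.1 + (- F x)) * (d x)^-1)) * phi (x, 2 * F x + (-1) * z.1))) 0).
  apply: Sm_add.
    exact: (Sm_comp2 (p := cst x) (q := fst) sphi (Sm_cst _) (Sm_fst R)).
  apply: (@Sm_mul _ (cst (-1))); first exact: Sm_cst.
  apply: Sm_mul.
    apply: (@Sm_add _ (cst 1)); first exact: Sm_cst.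
    apply: (@Sm_mul _ (cst (-1))); first exact: Sm_cst.
    apply: (@Sm_comp1 _ (@sigma R) (fun z => (z.1 + - F x) * (d x)^-1)); first exact: smooth1_sigma.
    apply: (@Sm_mul _ _ (cst (d x)^-1)); last exact: Sm_cst.
    by apply: (@Sm_add _ _ (cst (- F x))); [exact: Sm_fst|exact: Sm_cst].
  apply: (@Sm_comp2 _ phi (cst x) (fun z => 2 * F x + -1 * z.1)) => //; first exact: Sm_cst.
  apply: (@Sm_add _ (cst (2 * F x))); first exact: Sm_cst.
  by apply: (@Sm_mul _ (cst (-1))); [exact: Sm_cst|exact: Sm_fst].
move=> y.
have h1 := (is_derive_e2 phi (x, y) _).1 (smooth2_derive2 (x, y) sphi).
have h2 := (is_derive_e2 phi (x, 2 * F x - y) _).1 (smooth2_derive2 (x, 2 * F x - y) sphi).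
have h3 := is_derive_refl (g := fun y => phi (x, y)) h2.
have h4 : is_derive y (1:R) (fun y => 1%:R * (1 - sigma ((y - F x) / d x))) (- (dsigma ((y - F x) / d x) / d x)).
  have l1 : is_derive y (1:R) (fun y => (y - F x) / d x) (d x)^-1.
    have := is_deriveD (is_derive_lin (d x)^-1 y) (is_derive_cst (- (F x / d x)) y (1:R)).
    rewrite addr0; congr is_derive; apply/funext => t; rewrite fctE/=; ring.
  have := @is_derive1_comp _ (@sigma R) (fun y => (y - F x) / d x) y _ _ (is_derive_sigma _) l1.
  move=> /is_deriveN l2.
  have := is_deriveD (is_derive_cst (1:R) y (1:R)) l2.
  by rewrite add0r; congr is_derive; apply/funext => t; rewrite fctE mul1r.
have := is_deriveB h1 (is_deriveM h4 h3) => /is_derive_eq; apply.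
rewrite /GRing.scale/= mul1r; ring.
Qed.

(** On the column, [u] is a tail integral and [ibp] applies with lower end [F x]; the boundary value
    [chiM (x, F x)] is zero because the reflection fixes the graph and [hcut] is 1 there. *)
Lemma vanishing_fiber x : L1 lm (fun y => g2 (x, y)) -> measurable_fun setT (fun y : T1 => u (x, y)) ->
  {ae lm, forall y, F x < y -> u (x, y) = - Int lm (fun s => (y < s)%R%:R * g2 (x, s))} ->
  Int lm (fun y => u (x, y) * chiMY (x, y)) = - Int lm (fun y => g2 (x, y) * chiM (x, y)).
Proof.
move=> hg mu h.
have [dx|dx] := leP (d x) 0.
  rewrite (_ : (fun y => _) = cst 0); last first.
    by apply/funext => y; have [-> _] := dout (z := (x, y)) dx; rewrite mul0r.
  rewrite (_ : (fun y => g2 _ * _) = cst 0) ?Int0 ?oppr0//.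
  by apply/funext => y; have [_ ->] := dout (z := (x, y)) dx; rewrite mul0r.
have [sC dC] := chi_fiber dx.
have chiE y : chiMY (x, y) = derive1 (fun y => chiM (x, y)) y.
  by rewrite derive1E; case: (dC y).
have cY : continuous (fun y => chiMY (x, y)).
  rewrite (_ : (fun y => _) = derive1 (fun y => chiM (x, y))); last exact/funext.
  exact: smooth1_continuous (smooth1_derive1 sC).
(* Beyond this height both [y] and its mirror image [2 F x - y] are outside the support of [phi]. *)
pose B := `|Bx| + 2 * `|F x|.
have B0 : [/\ 0 <= `|Bx|, 0 <= `|F x|, - `|F x| <= F x, F x <= `|F x| & Bx <= `|Bx|].
  by rewrite !normr_ge0 !ler_norm lerNnormlW.
have C0 y : y < - B \/ B < y -> chiM (x, y) = 0.
  move=> hy; rewrite /chiM phi0 ?phi0 ?mulr0 ?subr0//=; move: hy B0; rewrite /B.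
    by move=> hy [? ? ? ? ?]; rewrite ltr_normr; apply/orP; case: hy => hy; ((left; lra) || (right; lra)).
  by move=> hy [? ? ? ? ?]; rewrite ltr_normr; apply/orP; case: hy => hy; ((left; lra) || (right; lra)).
have CY0 y : y < - B \/ B < y -> chiMY (x, y) = 0.
  by move=> hy; rewrite chiE; exact: (derive1_supp C0).
have E := @ibp _ (fun s => g2 (x, s)) (fun y => chiM (x, y)) (fun y => chiMY (x, y)) _ _ (F x) hg dC cY CY0.
have CF : chiM (x, F x) = 0.
  rewrite /chiM /hcut /refl/= dx subrr mul0r sigma_le0// subr0 !mul1r.
  by rewrite mulr2n mulrDl mul1r addrK subrr.
have L1c : L1 lm (fun y => (F x < y)%R%:R * chiMY (x, y)).
  apply: (L1M (M := 1)); [exact: L1_cont_supp cY CY0|exact: measurable_ltr|move=> y; exact: norm_bool].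
have hT : L1 lm (fun y => (F x < y)%R%:R * chiMY (x, y) *
      Int lm (fun s => (y < s)%R%:R * g2 (x, s))).
  have hk : L1 mu2 (fun z : R * R => (z.1 < z.2)%R%:R * (((F x < z.1)%R%:R * chiMY (x, z.1)) * g2 (x, z.2))).
    apply: (L1M (M := 1)); first exact: (L1_tensor L1c hg).
      by apply: measurable_ltr; [exact: measurable_fst|exact: measurable_snd].
    by move=> z; exact: norm_bool.
  have := L1_marg hk; congr (L1 _ _); apply/funext => y /=.
  have ib : L1 lm (fun s => (y < s)%R%:R * g2 (x, s)).
    by apply: (L1M (M := 1)) => //; [exact: measurable_ltr|move=> s; exact: norm_bool].
  by rewrite -(IntZ _ ib); congr Int; apply/funext => s; rewrite mulrCA.
have -> : Int lm (fun y => u (x, y) * chiMY (x, y)) =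
    Int lm (fun y => - ((F x < y)%R%:R * chiMY (x, y) *
      Int lm (fun s => (y < s)%R%:R * g2 (x, s)))).
  apply: Int_ae.
  - by apply: measurable_funM => //; exact: continuous_measurable_fun.
  - exact: L1_meas (L1N hT).
  apply: (aeS h) => y hy; have [Fy|yF] := ltP (F x) y.
    by rewrite (hy Fy) mul1r mulNr mulrC.
  have nab : ~ above I F (x, y) by move=> [_] /=; rewrite ltNge yF.
  by have [-> _] := out nab; rewrite !mul0r oppr0.
rewrite IntN// E; congr (- _); congr Int; apply/funext => y.
rewrite CF subr0; have [Fy|yF] := ltP (F x) y; first by rewrite mul1r.
have nab : ~ above I F (x, y) by move=> [_] /=; rewrite ltNge yF.
by have [_ ->] := out nab; rewrite mulr0 !mul0r.
Qed.

Lemma L1_uchiY : L1 mu2 (fun z => u z * chiMY z).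
Proof.
have [hu _ hg2 _ _] := wd.
have mr := measurable_phir (smooth2_continuous sphi).
have mr2 := measurable_phir (smooth2_continuous (smooth2_D2 sphi)).
have -> : (fun z => u z * chiMY z) = (fun z => (u z * 'D_e2 phi z - phi (refl F z) * (u z * hcutY z)) +
    u z * (hcut z * 'D_e2 phi (refl F z))).
  by apply/funext => z; rewrite /chiMY; ring.
apply: L1D; first apply: L1B.
- apply: (L1_mul (K := Kp)) => //; last by move=> z; have [] := hKp z.
  by apply: cont2_measurable; apply: smooth2_continuous; exact: smooth2_D2.
- by apply: (L1M (M := Kp)); [exact: L1_uhY|exact: mr|move=> z; have [] := hKp (refl F z)].
- apply: (L1_mul (K := Kp)) => //; first by apply: measurable_funM => //; exact: measurable_hcut.
  move=> z; rewrite normrM -[leRHS]mul1r ler_pM// ?hcut_bound//.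
  by have [] := hKp (refl F z).
Qed.

Lemma L1_gchi (g : R * R -> R) : L1 mu2 g -> L1 mu2 (fun z => g z * chiM z).
Proof.
move=> hg; have mr := measurable_phir (smooth2_continuous sphi).
apply: (L1_mul (K := Kp + Kp)) => //.
  apply: measurable_funB; first exact: (cont2_measurable (smooth2_continuous sphi)).
  by apply: measurable_funM => //; exact: measurable_hcut.
move=> z; apply: le_trans (ler_normB _ _) _; apply: lerD; first by have [] := hKp z.
rewrite normrM -[leRHS]mul1r ler_pM// ?hcut_bound//.
by have [] := hKp (refl F z).
Qed.

(** An identity on almost every column may be multiplied by any bounded measurable function of [x].
    The slope of [F] will be used for [m]; it is not smooth and could not be a factor of a test
    function. *)
Lemma vanishing_ibp (m : R -> R) (Mm : R) : measurable_fun setT (m : T1 -> R) ->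
  (forall x, `|m x| <= Mm) ->
  Int mu2 (fun z => m z.1 * (u z * chiMY z)) = - Int mu2 (fun z => m z.1 * (g2 z * chiM z)).
Proof.
move=> mm hm; have [hu _ hg2 _ _] := wd.
have mm1 : measurable_fun setT ((fun z => m z.1) : T1 * T1 -> R).
  exact: (measurableT_comp mm measurable_fst).
have La : L1 mu2 (fun z : R * R => m z.1 * (u z * chiMY z)).
  by apply: (L1M (M := Mm)); [exact: L1_uchiY|exact: mm1|move=> z; exact: hm].
have Lb : L1 mu2 (fun z : R * R => m z.1 * (g2 z * chiM z)).
  by apply: (L1M (M := Mm)); [exact: L1_gchi|exact: mm1|move=> z; exact: hm].
rewrite (Int2 La) (Int2 Lb) -IntN; last exact: L1_marg Lb.
apply: Int_ae; [exact: L1_meas (L1_marg La)|exact: L1_meas (L1N (L1_marg Lb))|].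
have h := aeS2 (L1_fiber L1_uchiY) (L1_fiber (L1_gchi hg2)) (fun x h1 h2 => conj h1 h2).
apply: (aeS3 h (ACL oI cF wd out top) (L1_fiber hg2)) => x [h1 h2] h3 h4 /=.
rewrite !IntZ// vanishing_fiber ?mulrN//.
by apply: fibx_measurable; exact: (L1_meas hu).
Qed.

End Hardy.

(** * Extension across a Lipschitz graph *)

Section Derivation.
Context (R : realType).
Local Notation e1 := (e1 R).
Local Notation e2 := (e2 R).

(* The derivation [d/dx + a d/dy], tangent to the level sets of [y - F x] when
   [a] is the slope of [F]. *)
Definition der (a : R) (f : R * R -> R) (z : R * R) (l : R) :=
  exists f1 f2 : R, [/\ is_derive z e1 f f1, is_derive z e2 f f2 & l = f1 + a * f2].

Lemma der_eq a f z l l' : der a f z l -> l = l' -> der a f z l'.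
Proof. by move=> h <-. Qed.

Lemma derE a f z l : der a f z l -> 'D_e1 f z + a * 'D_e2 f z = l.
Proof. by move=> [f1 [f2 [[_ ->] [_ ->] ->]]]. Qed.

Lemma der_add a f g z l m : der a f z l -> der a g z m ->
  der a (fun z => f z + g z) z (l + m).
Proof.
move=> [f1 [f2 [h1 h2 ->]]] [g1 [g2 [k1 k2 ->]]]; exists (f1 + g1), (f2 + g2); split.
- exact: (is_deriveD h1 k1).
- exact: (is_deriveD h2 k2).
- ring.
Qed.

Lemma der_mul a f g z l m : der a f z l -> der a g z m ->
  der a (fun z => f z * g z) z (f z * m + g z * l).
Proof.
move=> [f1 [f2 [h1 h2 ->]]] [g1 [g2 [k1 k2 ->]]].
exists (f z * g1 + g z * f1), (f z * g2 + g z * f2); split.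
- exact: (is_deriveM h1 k1).
- exact: (is_deriveM h2 k2).
- ring.
Qed.

Lemma der_cst a c z : der a (cst c) z 0.
Proof. by exists 0, 0; split; [exact: is_derive_cst|exact: is_derive_cst|rewrite mulr0 addr0]. Qed.

Lemma der_fst1 a g z : smooth1 g -> der a (fun z => g z.1) z (derive1 g z.1).
Proof.
move=> sg; exists (derive1 g z.1), 0; split; last by rewrite mulr0 addr0.
- by apply/is_derive_e1; exact: smooth1_derivable.
- by apply/is_derive_e2; exact: (is_derive_cst (g z.1) z.2 (1:R)).
Qed.

Lemma der_snd a z : der a snd z a.
Proof.
exists 0, 1; split; last by rewrite mulr1 add0r.
- by apply/is_derive_e1; exact: (is_derive_cst z.2 z.1 (1:R)).
- by apply/is_derive_e2; exact: (is_derive_id z.2 (1:R)).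
Qed.

Lemma der_comp1 a g f z l : smooth1 g -> der a f z l ->
  der a (fun z => g (f z)) z (derive1 g (f z) * l).
Proof.
move=> sg [f1 [f2 [h1 h2 ->]]].
exists (derive1 g (f z) * f1), (derive1 g (f z) * f2); split; last by ring.
- apply/is_derive_e1; apply: (@is_derive1_comp _ g (fun x => f (x, z.2))).
    by rewrite -surjective_pairing; exact: smooth1_derivable.
  exact: ((is_derive_e1 _ _ _).1 h1).
- apply/is_derive_e2; apply: (@is_derive1_comp _ g (fun x => f (z.1, x))).
    by rewrite -surjective_pairing; exact: smooth1_derivable.
  exact: ((is_derive_e2 _ _ _).1 h2).
Qed.

Lemma der_comp2 a phi p q z l m : smooth2 phi -> der a p z l -> der a q z m ->
  der a (fun z => phi (p z, q z)) z
    ('D_e1 phi (p z, q z) * l + 'D_e2 phi (p z, q z) * m).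
Proof.
move=> sphi [f1 [f2 [h1 h2 ->]]] [g1 [g2 [k1 k2 ->]]].
have c1 := smooth2_continuous (smooth2_D1 sphi).
exists ('D_e1 phi (p z, q z) * f1 + 'D_e2 phi (p z, q z) * g1),
  ('D_e1 phi (p z, q z) * f2 + 'D_e2 phi (p z, q z) * g2); split; last by ring.
- exact: (is_derive_comp2 (fun w => smooth2_derive1 w sphi) c1 (fun w => smooth2_derive2 w sphi) h1 k1).
- exact: (is_derive_comp2 (fun w => smooth2_derive1 w sphi) c1 (fun w => smooth2_derive2 w sphi) h2 k2).
Qed.

Lemma der_smooth2 a phi z : smooth2 phi -> der a phi z ('D_e1 phi z + a * 'D_e2 phi z).
Proof.
by move=> s; exists ('D_e1 phi z), ('D_e2 phi z); split; [exact: smooth2_derive1|exact: smooth2_derive2|].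
Qed.

Lemma smooth1_inv (g : R -> R) : smooth1 g -> (forall x, g x != 0) -> smooth1 (fun x => (g x)^-1).
Proof.
move=> sg g0; apply: (@Sm_smooth1 _ (fun z => (g z.1)^-1) 0).
by apply: (@Sm_inv _ (fun z => g z.1)) => //; apply: (Sm_comp1 sg); exact: Sm_fst.
Qed.

Lemma derive1_inv (g : R -> R) x : smooth1 g -> g x != 0 ->
  derive1 (fun x => (g x)^-1) x = - derive1 g x / g x ^+ 2.
Proof.
move=> sg g0; have h := is_deriveV g0 (smooth1_derivable x sg).
rewrite derive1E; case: h => _ ->.
by rewrite /GRing.scale/= mulNr mulNr mulrC.
Qed.

Lemma approx_cvg (a : nat -> R) (l c : R) : 0 < c ->
  (forall n, `|a n - l| <= (c * n.+1%:R)^-1) -> a n @[n --> \oo] --> l.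
Proof.
move=> c0 h; apply/cvgrPdist_le => e e0.
exists (Num.bound (c * e)^-1) => // n /= hn.
rewrite distrC; apply: le_trans (h n) _.
rewrite invf_ple ?posrE ?mulr_gt0//.
have : (c * e)^-1 <= n.+1%:R.
  apply: (@le_trans _ _ (Num.bound (c * e)^-1)%:R).
    by apply/ltW/archi_boundP; rewrite invr_ge0 mulr_ge0// ltW.
  by rewrite ler_nat (leq_trans hn).
rewrite invfM mulrC -ler_pdivlMr ?invr_gt0// invrK => h2.
by apply: le_trans h2 _; rewrite mulrC.
Qed.

End Derivation.

(** * Reflection across the graph *)

Section GraphExtension.
Context (R : realType).
Local Notation T1 := (measurableTypeR R).
Local Notation lm := (@lebesgue_measure R).
Local Notation mu2 := (mu2 R).
Local Notation e1 := (e1 R).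
Local Notation e2 := (e2 R).

(** What dominated convergence requires: slopes bounded by [M] and converging almost everywhere. The
    constant [c] compares the uniform error with the height [1 / (n + 1)] of the cutoff [Xn]; it is
    8 for [F] and 2 for [d]. *)
Definition smooth_approximation (I : set R) (F Fp : R -> R) (Fn : nat -> R -> R) (M c : R) :=
  [/\ forall n, smooth1 (Fn n),
    forall n x, `|Fn n x - F x| <= (c * n.+1%:R)^-1,
    forall n x, `|derive1 (Fn n) x| <= M,
    {ae lm, forall x, I x -> derive1 (Fn n) x @[n --> \oo] --> Fp x} &
    measurable_fun setT (Fp : T1 -> R) /\ forall x, `|Fp x| <= M].

Context (I : set R) (F d Fp dp : R -> R) (Fn dn : nat -> R -> R) (M : R).
Context (u g1 g2 : R * R -> R) (Mt : R).
Hypotheses (oI : open I) (cF : continuous F) (cd : continuous d) (d0 : forall x, 0 <= d x).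
Hypothesis M0 : 0 <= M.
Hypotheses (aF : smooth_approximation I F Fp Fn M 8) (ad : smooth_approximation I d dp dn M 2).
Hypothesis (dn0 : forall n x, 0 < dn n x).
Hypothesis (wd : WD (above I F) u g1 g2).
Hypothesis (out : forall z, ~ above I F z -> [/\ u z = 0, g1 z = 0 & g2 z = 0]).
Hypothesis (top : forall z, Mt <= z.2 -> [/\ u z = 0, g1 z = 0 & g2 z = 0]).
Hypothesis (dout : forall z, d z.1 <= 0 -> [/\ u z = 0, g1 z = 0 & g2 z = 0]).

Let out2 z : ~ above I F z -> u z = 0 /\ g2 z = 0.
Proof. by move=> /out[? _ ?]. Qed.
Let top2 z : Mt <= z.2 -> u z = 0 /\ g2 z = 0.
Proof. by move=> /top[? _ ?]. Qed.
Let dout2 z : d z.1 <= 0 -> u z = 0 /\ g2 z = 0.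
Proof. by move=> /dout[? _ ?]. Qed.

Variable Ks : R.
Hypotheses (Ks0 : 0 <= Ks) (hKs : forall x, `|@dsigma R x| <= Ks).

Local Notation strip := [set z : R * R | I z.1].

Definition tn n (z : R * R) := z.2 - Fn n z.1.
Definition Xn n (z : R * R) : R := sigma (n.+1%:R * tn n z - 1).
Definition Hn n (z : R * R) : R := 1 - sigma (tn n z / dn n z.1).
(** The derivative of [Hn] along [(1, Fn')]: since [tn] is constant in this direction, only [dn] is
    differentiated. *)
Definition HSn n (z : R * R) : R :=
  dsigma (tn n z / dn n z.1) * (tn n z / dn n z.1) * (derive1 (dn n) z.1 / dn n z.1).
(* [Xn] cuts off near the graph; it depends on [tn] only, so that it is not
   differentiated in the derivative [Dn] of [Phin] along [(1, Fn')]. *)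
Definition Phin phi n z := Xn n z * (phi z + Hn n z * phi (refl (Fn n) z)).
Definition Dn phi n z := Xn n z * ('D_e1 phi z + derive1 (Fn n) z.1 * 'D_e2 phi z +
  (HSn n z * phi (refl (Fn n) z) +
  Hn n z * ('D_e1 phi (refl (Fn n) z) + derive1 (Fn n) z.1 * 'D_e2 phi (refl (Fn n) z)))).

Let sFn n : smooth1 (Fn n). Proof. by case: aF. Qed.
Let sdn n : smooth1 (dn n). Proof. by case: ad. Qed.

Lemma Sm_tn n : Sm (tn n).
Proof.
have -> : tn n = fun z => z.2 + (-1) * Fn n z.1 by apply/funext => z; rewrite mulN1r.
apply: Sm_add; first exact: Sm_snd.
apply: (@Sm_mul _ (cst (-1))); first exact: Sm_cst.
by apply: (Sm_comp1 (sFn n)); exact: Sm_fst.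
Qed.

Lemma Sm_refl phi n : smooth2 phi -> Sm (fun z => phi (refl (Fn n) z)).
Proof.
move=> sphi; apply: (@Sm_comp2 _ phi fst (fun z => 2 * Fn n z.1 - z.2)) => //; first exact: Sm_fst.
have -> : (fun z : R * R => 2 * Fn n z.1 - z.2) = (fun z => 2 * Fn n z.1 + (-1) * z.2).
  by apply/funext => z; rewrite mulN1r.
apply: Sm_add.
  apply: (@Sm_mul _ (cst 2)); first exact: Sm_cst.
  by apply: (Sm_comp1 (sFn n)); exact: Sm_fst.
by apply: (@Sm_mul _ (cst (-1))); [exact: Sm_cst|exact: Sm_snd].
Qed.

Lemma Sm_Phin phi n : smooth2 phi -> Sm (Phin phi n).
Proof.
move=> sphi; rewrite /Phin /Xn /Hn; apply: Sm_mul.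
  apply: (@Sm_comp1 _ (@sigma R) (fun z => n.+1%:R * tn n z - 1)); first exact: smooth1_sigma.
  apply: (@Sm_add _ _ (cst (-1))); last exact: Sm_cst.
  by apply: (@Sm_mul _ (cst n.+1%:R)); [exact: Sm_cst|exact: Sm_tn].
apply: Sm_add; first exact: Sm_smooth2.
apply: Sm_mul; last exact: Sm_refl.
have -> : (fun z => 1 - sigma (tn n z / dn n z.1)) = (fun z => 1 + (-1) * sigma (tn n z / dn n z.1)).
  by apply/funext => z; rewrite mulN1r.
apply: (@Sm_add _ (cst 1)); first exact: Sm_cst.
apply: (@Sm_mul _ (cst (-1))); first exact: Sm_cst.
apply: (@Sm_comp1 _ (@sigma R) (fun z => tn n z / dn n z.1)); first exact: smooth1_sigma.
apply: Sm_mul; first exact: Sm_tn.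
apply: (@Sm_inv _ (fun z => dn n z.1)); first by move=> z; rewrite gt_eqF.
by apply: (Sm_comp1 (sdn n)); exact: Sm_fst.
Qed.

(** The reflection in the graph of [Fn] preserves the direction [(1, Fn')], as [2 Fn' - Fn' = Fn'].
    Hence the reflected test function is again differentiated tangentially, with the same sign. *)
Lemma der_Phin phi n z : smooth2 phi ->
  der (derive1 (Fn n) z.1) (Phin phi n) z (Dn phi n z).
Proof.
move=> sphi; set a := derive1 (Fn n) z.1.
have dt : der a (tn n) z 0.
  have := der_add (der_snd a z) (der_mul (der_cst a (-1) z) (der_fst1 a z (sFn n))).
  rewrite mulr0 addr0 mulN1r subrr; congr der; apply/funext => w.
  by rewrite /tn /cst mulN1r.
have dX : der a (Xn n) z 0.
  have l : der a (fun z => n.+1%:R * tn n z - 1) z 0.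
    have := der_add (der_mul (der_cst a n.+1%:R z) dt) (der_cst a (-1) z).
    by rewrite !mulr0 !addr0.
  by have := der_comp1 (@smooth1_sigma R) l; rewrite mulr0.
have dninv := smooth1_inv (sdn n) (fun x => lt0r_neq0 (dn0 n x)).
have dH : der a (Hn n) z (HSn n z).
  have l : der a (fun z => tn n z / dn n z.1) z (tn n z * derive1 (fun x => (dn n x)^-1) z.1).
    by have := der_mul dt (der_fst1 a z dninv); rewrite mulr0 addr0.
  have := der_add (der_cst a 1 z) (der_mul (der_cst a (-1) z) (der_comp1 (@smooth1_sigma R) l)).
  rewrite mulr0 addr0 add0r derive1_inv//; last by rewrite gt_eqF.
  have -> : Hn n = (fun w => cst 1 w + cst (-1) w * sigma (tn n w / dn n w.1)).
    by apply/funext => w; rewrite /Hn /cst mulN1r.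
  move=> /der_eq; apply; rewrite /HSn /cst /dsigma.
  by field; rewrite gt_eqF.
have dq : der a (fun z => 2 * Fn n z.1 - z.2) z a.
  have := der_add (der_mul (der_cst a 2 z) (der_fst1 a z (sFn n))) (der_mul (der_cst a (-1) z) (der_snd a z)).
  rewrite !mulr0 !addr0 /cst -/a.
  have -> : (fun w : R * R => 2 * Fn n w.1 + -1 * w.2) = (fun w => 2 * Fn n w.1 - w.2).
    by apply/funext => w; rewrite mulN1r.
  by move=> /der_eq; apply; ring.
have df : der a fst z 1.
  exists 1, 0; split; last by rewrite mulr0 addr0.
  - by apply/is_derive_e1; exact: (is_derive_id z.1 (1:R)).
  - by apply/is_derive_e2; exact: (is_derive_cst z.1 z.2 (1:R)).
have db := der_comp2 sphi df dq.
have := der_mul dX (der_add (der_smooth2 a z sphi) (der_mul dH db)).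
move=> /der_eq; apply; rewrite /Dn -/a /refl; ring.
Qed.

Lemma Phin_support phi n : test_function strip phi -> exists A,
  [/\ compact A, A `<=` above I F & forall z, ~ A z -> Phin phi n z = 0].
Proof.
move=> tphi; have [A0 [cA0 A0I phi0 _ _]] := test_supp tphi.
have [B B0 hB] := compact_box cA0.
pose Kx := fst @` A0.
have cKx : compact Kx.
  by apply: continuous_compact => //; apply: continuous_subspaceT => z; exact: cvg_fst.
have cFn := smooth1_continuous (sFn n).
have [MF MF0 hMF] : exists2 MF, 0 <= MF & forall x, Kx x -> `|Fn n x| <= MF.
  have cz : continuous (fun z : R * R => Fn n z.1).
    by move=> z; apply: (@continuous_comp _ _ _ fst (Fn n)); [exact: cvg_fst|exact: cFn].
  have [MF MF0 h] := cont_compact_bounded cz cA0.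
  by exists MF => // x [w Aw <-]; exact: h.
(* If [|2 Fn x - y| <= B] and [|Fn x| <= MF] then [|y| <= B + 2 MF], so the box also contains the
   reflected support. *)
pose A := (Kx `*` `[- (B + 2 * MF), B + 2 * MF]) `&` [set z : R * R | n.+1%:R^-1 <= tn n z].
exists A; split.
- apply: (@subclosed_compact _ _ (Kx `*` `[- (B + 2 * MF), B + 2 * MF])).
  + apply: closedI.
      apply: compact_closed; first exact: norm_hausdorff.
      by apply: compact_setX => //; exact: segment_compact.
    have := @closed_comp _ _ (tn n) [set y | n.+1%:R^-1 <= y]; apply.
      by move=> z _; exact: (Sm_continuous (Sm_tn n)).
    exact: closed_ge.
  + by apply: compact_setX => //; exact: segment_compact.
  + by move=> z [].
- move=> z [[[w Aw wz] _] /= h]; split; first by rewrite -wz; exact: A0I.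
  (* A height [1 / (n + 1)] over [Fn] exceeds the error [1 / (8 (n + 1))], so the support lies
     strictly above the graph of [F]. *)
  have [_ /(_ n z.1) h8 _ _ _] := aF.
  have n0 : 0 < n.+1%:R^-1 :> R by rewrite invr_gt0.
  move: h8 h; rewrite invfM /tn ler_norml; set e := n.+1%:R^-1 in n0 *.
  by move=> /andP[? ?] ?; lra.
- move=> z nA; rewrite /Phin.
  have [ht|ht] := ltP (tn n z) n.+1%:R^-1.
    rewrite /Xn sigma_le0 ?mul0r// subr_le0 mulrC -ler_pdivlMr// mul1r; exact: ltW.
  have [hK|nK] := pselect (Kx z.1); last first.
    have h (w : R * R) : w.1 = z.1 -> phi w = 0.
      by move=> wz; apply: phi0 => Aw; apply: nK; exists w.
    by rewrite !h// mulr0 addr0 mulr0.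
  have hz : B + 2 * MF < `|z.2|.
    rewrite ltNge; apply/negP => hz; apply: nA; split => //; split => //=.
    by rewrite in_itv/= -ler_norml.
  have hF := hMF _ hK.
  rewrite phi0; last by move=> /hB[_]; lra.
  rewrite phi0 ?mulr0 ?addr0 ?mulr0//.
  move=> /hB[_ /=]; apply/negP; rewrite -ltNge.
  apply: (@lt_le_trans _ _ (`|z.2| - `|2 * Fn n z.1|)).
    by rewrite normrM ger0_norm//; lra.
  by rewrite distrC lerB_dist.
Qed.

(** The slope [Fn'] is smooth and depends on [x] only, hence commutes with the vertical derivative:
    the two weak identities are tested with [Phin] and with [Fn' Phin], and added. *)
Lemma weak_Phin phi n : test_function strip phi ->
  Int mu2 (fun z => u z * Dn phi n z) =
  - Int mu2 (fun z => (g1 z + derive1 (Fn n) z.1 * g2 z) * Phin phi n z).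
Proof.
move=> tphi; have sphi := test_smooth tphi.
have [hu hg1 hg2 w1 w2] := wd.
have [A [cA AO P0]] := Phin_support n tphi.
have t1 : test_function (above I F) (Phin phi n).
  exact: (test_intro (Sm_Phin n sphi) cA AO P0).
have sdF := smooth1_derive1 (sFn n).
have SdF : Sm (fun z => derive1 (Fn n) z.1) by apply: (Sm_comp1 sdF); exact: Sm_fst.
have t2 : test_function (above I F) (fun z => derive1 (Fn n) z.1 * Phin phi n z).
  apply: (test_intro _ cA AO); first by apply: Sm_mul => //; exact: Sm_Phin.
  by move=> z /P0->; rewrite mulr0.
have D2 z : 'D_e2 (fun z => derive1 (Fn n) z.1 * Phin phi n z) z = derive1 (Fn n) z.1 * 'D_e2 (Phin phi n) z.
  have h := smooth2_derive2 z (test_smooth t1).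
  have h' : is_derive z e2 (fun z => derive1 (Fn n) z.1 * Phin phi n z) (derive1 (Fn n) z.1 * 'D_e2 (Phin phi n) z).
    apply/is_derive_e2 => /=; exact: (is_deriveZ (derive1 (Fn n) z.1) ((is_derive_e2 _ _ _).1 h)).
  by case: h'.
have [K1 K10 hK1] := test_bounded t1; have [K2 K20 hK2] := test_bounded t2.
have [m1 m11 _] := measurable_test t1; have [m2 _ m22] := measurable_test t2.
have E1 := w1 _ t1; have E2 := w2 _ t2.
have La : L1 mu2 (fun z => u z * 'D_e1 (Phin phi n) z).
  by apply: (L1_mul (K := K1) hu m11) => z; have [_ h _] := hK1 z; exact: h.
have Lb : L1 mu2 (fun z => u z * 'D_e2 (fun z => derive1 (Fn n) z.1 * Phin phi n z) z).
  by apply: (L1_mul (K := K2)) => // z; have [] := hK2 z.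
have Lc : L1 mu2 (fun z => g1 z * Phin phi n z).
  by apply: (L1_mul (K := K1)) => // z; have [] := hK1 z.
have Ld : L1 mu2 (fun z => g2 z * (derive1 (Fn n) z.1 * Phin phi n z)).
  by apply: (L1_mul (K := K2)) => // z; have [] := hK2 z.
transitivity (Int mu2 (fun z => u z * 'D_e1 (Phin phi n) z + u z * 'D_e2 (fun z => derive1 (Fn n) z.1 * Phin phi n z) z)).
  congr Int; apply/funext => z; rewrite -(derE (der_Phin n z sphi)) D2; ring.
rewrite IntD// E1 E2 -opprD -IntD//; congr (- Int _ _); apply/funext => z; ring.
Qed.

(* The derivative of [hcut] along the tangent [(1, F')] to the graph. *)
Definition hcutS (z : R * R) : R :=
  (0 < d z.1)%R%:R * (dsigma ((z.2 - F z.1) / d z.1) * ((z.2 - F z.1) / d z.1) * (dp z.1 / d z.1)).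
Definition Dlim phi z := 'D_e1 phi z + Fp z.1 * 'D_e2 phi z +
  (hcutS z * phi (refl F z) + hcut F d z * ('D_e1 phi (refl F z) + Fp z.1 * 'D_e2 phi (refl F z))).
Definition chiP phi z := phi z + hcut F d z * phi (refl F z).

Lemma good_cvg phi z : smooth2 phi -> above I F z -> 0 < d z.1 ->
  derive1 (Fn n) z.1 @[n --> \oo] --> Fp z.1 ->
  derive1 (dn n) z.1 @[n --> \oo] --> dp z.1 ->
  Dn phi n z @[n --> \oo] --> Dlim phi z /\ Phin phi n z @[n --> \oo] --> chiP phi z.
Proof.
move=> sphi [Iz Fz] dz hF' hd'.
have hF : Fn n z.1 @[n --> \oo] --> F z.1.
  by case: aF => _ h _ _ _; apply: (approx_cvg (c := 8)) => // n; exact: h.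
have hd : dn n z.1 @[n --> \oo] --> d z.1.
  by case: ad => _ h _ _ _; apply: (approx_cvg (c := 2)) => // n; exact: h.
have ht : tn n z @[n --> \oo] --> z.2 - F z.1 by apply: cvgB => //; exact: cvg_cst.
have hi : (dn n z.1)^-1 @[n --> \oo] --> (d z.1)^-1 by apply: cvgV => //; rewrite gt_eqF.
have htd : tn n z / dn n z.1 @[n --> \oo] --> (z.2 - F z.1) / d z.1 by exact: cvgM.
have cs := smooth1_continuous (@smooth1_sigma R).
have cds := smooth1_continuous (@smooth1_dsigma R).
have hH : Hn n z @[n --> \oo] --> hcut F d z.
  rewrite /hcut dz mul1r; apply: cvgB; first exact: cvg_cst.
  exact: (@cvg_comp _ _ _ _ _ _ _ _ htd (cs _)).
have hS : HSn n z @[n --> \oo] --> hcutS z.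
  rewrite /hcutS dz mul1r; apply: cvgM; last exact: cvgM.
  by apply: cvgM => //; exact: (@cvg_comp _ _ _ _ _ _ _ _ htd (cds _)).
have hrefl : (z.1, 2 * Fn n z.1 - z.2) @[n --> \oo] --> (z.1, 2 * F z.1 - z.2).
  have h2 : 2 * Fn n z.1 - z.2 @[n --> \oo] --> 2 * F z.1 - z.2.
    by apply: cvgB; [apply: cvgMr|exact: cvg_cst].
  exact: (cvg_pair (cvg_cst _) h2).
have href (f : R * R -> R) : continuous f -> f (refl (Fn n) z) @[n --> \oo] --> f (refl F z).
  by move=> cf; exact: (@cvg_comp _ _ _ _ _ _ _ _ hrefl (cf _)).
have hX : Xn n z @[n --> \oo] --> (1 : R).
  apply: cvg_near_cst; near=> n.
  rewrite /Xn sigma_ge1//.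
  have t1 : (z.2 - F z.1) / 2 < tn n z.
    near: n; apply: (cvgr_gt _ ht); lra.
  (* Together with [tn > (y - F) / 2] this gives [(n + 1) tn >= 2], where the cutoff [Xn] equals
     1. *)
  have t2 : 4 / (z.2 - F z.1) <= n.+1%:R.
    near: n; exists (Num.bound (4 / (z.2 - F z.1))) => // n /= hn.
    apply: (@le_trans _ _ (Num.bound (4 / (z.2 - F z.1)))%:R); last by rewrite ler_nat (leq_trans hn).
    by apply/ltW/archi_boundP; rewrite divr_ge0//; lra.
  move: t2; rewrite ler_pdivrMr; last by lra.
  set N := n.+1%:R; have N0 : 0 < N by rewrite ltr0n.
  have : N * ((z.2 - F z.1) / 2) <= N * tn n z by rewrite ler_pM2l// ltW.
  by lra.
have c0 := smooth2_continuous sphi.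
have c1 := smooth2_continuous (smooth2_D1 sphi).
have c2 := smooth2_continuous (smooth2_D2 sphi).
split.
  rewrite -[Dlim phi z]mul1r /Dn /Dlim; apply: cvgM => //; apply: cvgD.
    by apply: cvgD; [exact: cvg_cst|apply: cvgMl].
  apply: cvgD; first by apply: cvgM => //; exact: (href _ c0).
  apply: cvgM => //; apply: cvgD; first exact: (href _ c1).
  by apply: cvgM => //; exact: (href _ c2).
rewrite -[chiP phi z]mul1r /Phin /chiP; apply: cvgM => //; apply: cvgD; first exact: cvg_cst.
by apply: cvgM => //; exact: (href _ c0).
Unshelve. all: by end_near. Qed.

Lemma sigma_norm (x : R) : `|sigma x| <= 1.
Proof. by rewrite ger0_norm ?sigma_ge0// sigma_le1. Qed.

Lemma Hn_norm n z : `|Hn n z| <= 1.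
Proof.
rewrite ger0_norm /Hn; first by have := sigma_ge0 (tn n z / dn n z.1); lra.
by have := sigma_le1 (tn n z / dn n z.1); lra.
Qed.

(** A majorant independent of [n]. With [e = 1 / (n + 1)], the product is nonzero only if
    [e < tn <= dn]. As [dn] is within [e / 2] of [d], it follows that [e < 2 d] and [d <= 2 dn],
    whence [1 / dn <= 2 / d]; and the height over [F] is at most [d + e / 2 + e / 8 < 3 d], so that
    [wgt] is [1 / d] at this point. *)
Lemma HSn_layer n z : `|u z * (Xn n z * HSn n z)| <= (2 * Ks * M) * `|u z * wgt F d z|.
Proof.
have C0 : 0 <= 2 * Ks * M by rewrite !mulr_ge0.
have rhs0 : 0 <= (2 * Ks * M) * `|u z * wgt F d z| by rewrite mulr_ge0.
set N := n.+1%:R : R; have N0 : 0 < N by rewrite ltr0n.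
have [ht|ht] := leP (N * tn n z) 1.
  by rewrite /Xn sigma_le0 ?mul0r ?mulr0 ?normr0// subr_le0.
have dnz := dn0 n z.1.
have t0 : 0 < tn n z by rewrite -(pmulr_rgt0 _ N0); lra.
have [htd|htd] := ltP (dn n z.1) (tn n z).
  by rewrite /HSn dsigma_gt1 ?mul0r ?mulr0 ?normr0// ltr_pdivlMr// mul1r.
have tN : N^-1 < tn n z by rewrite -[N^-1]mul1r ltr_pdivrMr// mulrC.
have [_ /(_ n z.1) h8 _ _ _] := aF; have [_ /(_ n z.1) h2 hM _ _] := ad.
rewrite !invfM -/N !ler_norml in h8 h2; move: h8 h2 => /andP[a1 a2] /andP[b1 b2].
have iN0 : 0 < N^-1 by rewrite invr_gt0.
have [e eE] : exists e, e = N^-1 by eexists.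
rewrite -eE in a1 a2 b1 b2 iN0 tN.
have dz : 0 < d z.1 by lra.
have wE : wgt F d z = (d z.1)^-1.
  have h1 : F z.1 < z.2 by move: tN; rewrite /tn; lra.
  have en : e < dn n z.1 by lra.
  have h2 : z.2 < F z.1 + 3 * d z.1 by move: htd; rewrite /tn; lra.
  by rewrite /wgt h1 h2 !mul1r.
have e1 : `|u z * (Xn n z * HSn n z)| = `|u z| * (`|Xn n z| * `|HSn n z|) by rewrite (normrM (u z)) (normrM (Xn n z)).
have e2 : `|u z * (d z.1)^-1| = `|u z| * `|(d z.1)^-1| by rewrite normrM.
rewrite wE e1 e2 [leRHS]mulrCA ler_wpM2l//.
apply: (@le_trans _ _ (1 * (Ks * 1 * (M * (dn n z.1)^-1)))).
  apply: ler_pM => //; first exact: sigma_norm.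
  have hq : `|tn n z / dn n z.1| <= 1.
    by rewrite ger0_norm ?ler_pdivrMr ?mul1r// divr_ge0// ltW.
  have hr : `|derive1 (dn n) z.1 / dn n z.1| <= M * (dn n z.1)^-1.
    by rewrite normrM ler_pM// ger0_norm// invr_ge0 ltW.
  rewrite /HSn; move: hq hr; set q := tn n z / dn n z.1; set r := derive1 (dn n) z.1 / dn n z.1 => hq hr.
  rewrite normrM normrM; apply: ler_pM => //.
  by apply: ler_pM.
rewrite (gtr0_norm (_ : 0 < (d z.1)^-1)) ?invr_gt0//.
have : (dn n z.1)^-1 <= 2 * (d z.1)^-1.
  rewrite -[leRHS]invrK lef_pV2 ?posrE ?invr_gt0 ?mulr_gt0 ?invr_gt0//.
  by rewrite invfM invrK; lra.
move=> h; have : Ks * M * (dn n z.1)^-1 <= Ks * M * (2 * (d z.1)^-1).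
  by rewrite ler_wpM2l// mulr_ge0.
by lra.
Qed.

Lemma Phin_bound phi Kp n z : (forall z, `|phi z| <= Kp) -> `|Phin phi n z| <= 2 * Kp.
Proof.
move=> hK; rewrite normrM -[leRHS]mul1r ler_pM ?sigma_norm//.
apply: le_trans (ler_normD _ _) _; have -> : 2 * Kp = Kp + Kp by ring.
apply: lerD => //.
by rewrite normrM -[leRHS]mul1r ler_pM// Hn_norm.
Qed.

Lemma Dn_bound phi Kp n z :
  (forall z, [/\ `|phi z| <= Kp, `|'D_e1 phi z| <= Kp & `|'D_e2 phi z| <= Kp]) -> 0 <= Kp ->
  `|u z * Dn phi n z| <= (2 * (1 + M) * Kp) * `|u z| + (2 * Ks * M * Kp) * `|u z * wgt F d z|.
Proof.
move=> hK Kp0.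
have [_ _ /(_ n z.1) haM _ _] := aF.
have hp w : `|'D_e1 phi w + derive1 (Fn n) z.1 * 'D_e2 phi w| <= (1 + M) * Kp.
  have [_ h1 h2] := hK w; apply: le_trans (ler_normD _ _) _.
  by rewrite mulrDl mul1r lerD// normrM ler_pM.
have -> : u z * Dn phi n z = (u z * (Xn n z * HSn n z)) * phi (refl (Fn n) z) +
   u z * (Xn n z * (('D_e1 phi z + derive1 (Fn n) z.1 * 'D_e2 phi z) +
     Hn n z * ('D_e1 phi (refl (Fn n) z) + derive1 (Fn n) z.1 * 'D_e2 phi (refl (Fn n) z)))).
  by rewrite /Dn; ring.
rewrite addrC; apply: le_trans (ler_normD _ _) _; apply: lerD.
  rewrite normrM mulrC ler_wpM2r// normrM -[leRHS]mul1r ler_pM ?sigma_norm//.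
  apply: le_trans (ler_normD _ _) _.
  rewrite (_ : 2 * (1 + M) * Kp = (1 + M) * Kp + (1 + M) * Kp); last by ring.
  apply: lerD => //; rewrite normrM -[leRHS]mul1r ler_pM ?Hn_norm//.
rewrite normrM; have [h0 _ _] := hK (refl (Fn n) z).
rewrite (_ : _ * Kp * _ = (2 * Ks * M) * `|u z * wgt F d z| * Kp); last by ring.
by apply: ler_pM => //; exact: HSn_layer.
Qed.

Lemma measurable_hcutS : measurable_fun setT (hcutS : T1 * T1 -> R).
Proof.
have [_ _ _ _ [mdp _]] := ad.
have mtd := measurable_td cF cd.
apply: measurable_funM; first by apply: measurable_ltr => //; exact: measurable_fst1.
apply: measurable_funM.
  apply: measurable_funM => //.
  have ms := continuous_measurable_fun (smooth1_continuous (@smooth1_dsigma R)).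
  exact: (measurableT_comp ms mtd).
apply: measurable_funM; last exact: measurable_inv1.
exact: (measurableT_comp mdp measurable_fst).
Qed.

Lemma measurable_Fp1 : measurable_fun setT ((fun z => Fp z.1) : T1 * T1 -> R).
Proof. by have [_ _ _ _ [mFp _]] := aF; exact: (measurableT_comp mFp measurable_fst). Qed.

Lemma measurable_Dlim phi : smooth2 phi -> measurable_fun setT (Dlim phi : T1 * T1 -> R).
Proof.
move=> sphi; have mFp := measurable_Fp1.
have c1 := smooth2_continuous (smooth2_D1 sphi).
have c2 := smooth2_continuous (smooth2_D2 sphi).
apply: measurable_funD.
  apply: measurable_funD; first exact: (cont2_measurable c1).
  exact: (measurable_funM mFp (cont2_measurable c2)).
apply: measurable_funD.
  apply: measurable_funM; first exact: measurable_hcutS.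
  exact: (measurable_phir cF (smooth2_continuous sphi)).
apply: measurable_funM; first exact: measurable_hcut.
apply: measurable_funD; first exact: (measurable_phir cF c1).
by apply: measurable_funM => //; exact: (measurable_phir cF c2).
Qed.

Lemma measurable_chiP phi : smooth2 phi -> measurable_fun setT (chiP phi : T1 * T1 -> R).
Proof.
move=> sphi; have c0 := smooth2_continuous sphi.
apply: measurable_funD; first exact: cont2_measurable.
by apply: measurable_funM; [exact: measurable_hcut|exact: (measurable_phir cF c0)].
Qed.

(* No trace of [u] on the graph appears: the cutoff [Xn] commutes with the
   tangential derivative. *)
Lemma tangential phi : test_function strip phi ->
  L1 mu2 (fun z => u z * Dlim phi z) /\
  Int mu2 (fun z => u z * Dlim phi z) = - Int mu2 (fun z => (g1 z + Fp z.1 * g2 z) * chiP phi z).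
Proof.
move=> tphi; have sphi := test_smooth tphi.
have [hu hg1 hg2 _ _] := wd.
have [Kp Kp0 hKp] := test_bounded tphi.
have [hw _] := hardy oI cF cd d0 wd out2 top2 dout2.
have [_ _ haM haF [mFp hFp]] := aF; have [_ _ _ had _] := ad.
have mFp1 := measurable_Fp1.
have ae_good : {ae mu2, forall z : R * R, (I z.1 -> derive1 (Fn n) z.1 @[n --> \oo] --> Fp z.1) /\
    (I z.1 -> derive1 (dn n) z.1 @[n --> \oo] --> dp z.1)}.
  apply: (ae_fstP (A := [set x | (I x -> derive1 (Fn n) x @[n --> \oo] --> Fp x) /\
    (I x -> derive1 (dn n) x @[n --> \oo] --> dp x)])).
  by apply: (aeS2 haF had) => x h1 h2.
have msDn n : measurable_fun setT (Dn phi n : T1 * T1 -> R).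
  have sP := Sm_Ck (Sm_Phin n sphi).
  have -> : Dn phi n = fun z => 'D_e1 (Phin phi n) z + derive1 (Fn n) z.1 * 'D_e2 (Phin phi n) z.
    by apply/funext => z; rewrite (derE (der_Phin n z sphi)).
  have m1 := cont2_measurable (smooth2_continuous (smooth2_D1 sP)).
  have m2 := cont2_measurable (smooth2_continuous (smooth2_D2 sP)).
  apply: measurable_funD; first exact: m1.
  apply: measurable_funM; last exact: m2.
  apply: measurable_fst1; exact: smooth1_continuous (smooth1_derive1 (sFn n)).
have msPn n : measurable_fun setT (Phin phi n : T1 * T1 -> R).
  exact: cont2_measurable (smooth2_continuous (Sm_Ck (Sm_Phin n sphi))).
(* The majorant of [Dn_bound] is integrable by [hardy]. Outside the domain and on the columns with
   [d = 0] the integrands are zero, so convergence is needed only where [good_cvg] gives it. *)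
have [LD cD] : L1 mu2 (fun z => u z * Dlim phi z) /\
    (fun n => Int mu2 (fun z => u z * Dn phi n z)) @ \oo --> Int mu2 (fun z => u z * Dlim phi z).
  apply: (@Int_dct _ _ _ mu2 (fun n z => u z * Dn phi n z) _
    (fun z => (2 * (1 + M) * Kp) * `|u z| + (2 * Ks * M * Kp) * `|u z * wgt F d z|)).
  - by move=> n; apply: measurable_funM => //; exact: (L1_meas hu).
  - by apply: measurable_funM; [exact: (L1_meas hu)|exact: measurable_Dlim].
  - apply: (aeS ae_good) => z [h1 h2].
    have [az|naz] := pselect (above I F z); last first.
      have [-> _ _] := out naz; rewrite mul0r; under eq_fun do rewrite mul0r; exact: cvg_cst.
    have [dz|dz] := leP (d z.1) 0.
      have [-> _ _] := dout dz; rewrite mul0r; under eq_fun do rewrite mul0r; exact: cvg_cst.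
    have [h _] := good_cvg sphi az dz (h1 az.1) (h2 az.1).
    by apply: cvgMr.
  - by apply: L1D; apply: L1Z; exact: L1_norm.
  - by apply: aeW => z n; exact: Dn_bound.
have [_ cP] : L1 mu2 (fun z => (g1 z + Fp z.1 * g2 z) * chiP phi z) /\
    (fun n => Int mu2 (fun z => (g1 z + derive1 (Fn n) z.1 * g2 z) * Phin phi n z)) @ \oo -->
     Int mu2 (fun z => (g1 z + Fp z.1 * g2 z) * chiP phi z).
  apply: (@Int_dct _ _ _ mu2 (fun n z => (g1 z + derive1 (Fn n) z.1 * g2 z) * Phin phi n z) _
    (fun z => (2 * Kp) * `|g1 z| + (M * (2 * Kp)) * `|g2 z|)).
  - move=> n; apply: measurable_funM => //; apply: measurable_funD; first exact: (L1_meas hg1).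
    apply: measurable_funM; last exact: (L1_meas hg2).
    apply: measurable_fst1; exact: smooth1_continuous (smooth1_derive1 (sFn n)).
  - apply: measurable_funM; last exact: measurable_chiP.
    apply: measurable_funD; first exact: (L1_meas hg1).
    by apply: measurable_funM => //; exact: (L1_meas hg2).
  - apply: (aeS ae_good) => z [h1 h2].
    have [az|naz] := pselect (above I F z); last first.
      have [_ -> ->] := out naz; rewrite mulr0 add0r mul0r.
      under eq_fun do rewrite mulr0 add0r mul0r; exact: cvg_cst.
    have [dz|dz] := leP (d z.1) 0.
      have [_ -> ->] := dout dz; rewrite mulr0 add0r mul0r.
      under eq_fun do rewrite mulr0 add0r mul0r; exact: cvg_cst.
    have [_ h] := good_cvg sphi az dz (h1 az.1) (h2 az.1).
    apply: cvgM => //; apply: cvgD; first exact: cvg_cst.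
    by apply: cvgMl; exact: h1 az.1.
  - by apply: L1D; apply: L1Z; exact: L1_norm.
  - apply: aeW => z n; rewrite normrM.
    have hP : `|Phin phi n z| <= 2 * Kp by apply: Phin_bound => w; have [] := hKp w.
    have -> : (2 * Kp) * `|g1 z| + (M * (2 * Kp)) * `|g2 z| = (`|g1 z| + M * `|g2 z|) * (2 * Kp) by ring.
    apply: ler_pM => //; apply: le_trans (ler_normD _ _) _.
    by rewrite lerD2l normrM ler_wpM2r.
split=> //.
have e : (fun n => Int mu2 (fun z => u z * Dn phi n z)) =
    (fun n => - Int mu2 (fun z => (g1 z + derive1 (Fn n) z.1 * g2 z) * Phin phi n z)).
  by apply/funext => n; exact: weak_Phin.
rewrite e in cD.
rewrite -(cvg_lim (@Rhausdorff R) cD).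
by apply: (cvg_lim (@Rhausdorff R)); exact: cvgN.
Qed.

Let mF : measurable_fun setT (F : T1 -> R).
Proof. exact: continuous_measurable_fun. Qed.

(** Chain rule for [(hcut u) o refl F]: its [x]-derivative is [(d_x + 2 F' d_y)(hcut u)] at the
    reflected point. Since [hcutS] is [d_x + F' d_y] of [hcut], the factor [hcut] contributes
    [hcutS + F' hcutY]. For [k2] the sign change of the reflection is left to [gh2]. *)
Definition k1 z := hcut F d z * g1 z + 2 * Fp z.1 * (hcut F d z * g2 z) +
  (u z * hcutS z + Fp z.1 * (u z * hcutY F d z)).
Definition k2 z := hcut F d z * g2 z + u z * hcutY F d z.

Lemma hcutS_layer z : `|u z * hcutS z| <= (Ks * M) * `|u z * wgt F d z|.
Proof.
have [_ _ _ _ [_ hdp]] := ad.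
apply: (layer_bound d0 out2 dout2) => [|{}z dz Fz|{}z dz Fz]; first exact: mulr_ge0.
  rewrite /hcutS dz mul1r; have [h|h] := leP (z.2 - F z.1) (d z.1); last first.
    have q1 : 1 < (z.2 - F z.1) / d z.1 by rewrite ltr_pdivlMr// mul1r.
    by rewrite dsigma_gt1// !mul0r normr0 divr_ge0 ?mulr_ge0// ltW.
  have iv : `|(d z.1)^-1| = (d z.1)^-1 by rewrite ger0_norm// invr_ge0 ltW.
  have hq : `|(z.2 - F z.1) / d z.1| <= 1.
    by rewrite ger0_norm ?ler_pdivrMr ?mul1r// divr_ge0//; lra.
  rewrite normrM (normrM (dsigma _)) (normrM (dp _)) iv mulrA ler_wpM2r ?invr_ge0 ?(ltW dz)//.
  have -> : Ks * M = Ks * 1 * M by ring.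
  by apply: ler_pM => //; apply: ler_pM.
have q1 : 1 < (z.2 - F z.1) / d z.1 by rewrite ltr_pdivlMr//; lra.
by rewrite /hcutS dsigma_gt1// !mul0r mulr0.
Qed.

Let hL1 : L1 mu2 u /\ L1 mu2 g1 /\ L1 mu2 g2.
Proof. by case: wd. Qed.

Lemma L1_uhS : L1 mu2 (fun z => u z * hcutS z).
Proof.
have [hu _] := hL1; have [hw _] := hardy oI cF cd d0 wd out2 top2 dout2.
have hb : L1 mu2 (fun z => (Ks * M) * `|u z * wgt F d z|) by apply: L1Z; exact: L1_norm.
have mm : measurable_fun setT ((fun z => u z * hcutS z) : T1 * T1 -> R).
  by apply: measurable_funM; [exact: (L1_meas hu)|exact: measurable_hcutS].
by apply: (L1_le mm hb) => z; apply: le_trans (hcutS_layer z) (ler_norm _).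
Qed.

Let Fpb x : `|Fp x| <= M. Proof. by case: aF => _ _ _ _ []. Qed.

Let mH := measurable_hcut cF cd.

Lemma L1_hcutM g : L1 mu2 g -> L1 mu2 (fun z => hcut F d z * g z).
Proof. by move=> hg; apply: (L1M (M := 1)) => //; exact: hcut_bound. Qed.

Let LuY : L1 mu2 (fun z => u z * hcutY F d z).
Proof. exact: (L1_uhY oI cF cd d0 wd out2 top2 dout2 Ks0 hKs). Qed.

Let LFp g : L1 mu2 g -> L1 mu2 (fun z : R * R => Fp z.1 * g z).
Proof. by move=> hg; apply: (L1M (M := M)) => //; exact: measurable_Fp1. Qed.

Lemma L1_k1 : L1 mu2 k1.
Proof.
have [_ [hg1 hg2]] := hL1.
apply: L1D; apply: L1D; first exact: L1_hcutM.
- have := L1Z 2 (LFp (L1_hcutM hg2)); congr (L1 _ _); apply/funext => z; ring.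
- exact: L1_uhS.
- exact: LFp.
Qed.

Lemma L1_k2 : L1 mu2 k2.
Proof. by have [_ [_ hg2]] := hL1; apply: L1D => //; exact: L1_hcutM. Qed.

(** A sum instead of a case distinction: [u] is zero below the graph, and the reflected term is zero
    above it. *)
Definition gv z := u z + (hcut F d (refl F z) * u (refl F z)).
Definition gh1 z := g1 z + k1 (refl F z).
Definition gh2 z := g2 z - k2 (refl F z).

Let Lr f : L1 mu2 f -> L1 mu2 (fun z => f (refl F z)).
Proof. exact: L1_refl. Qed.

Lemma reflK z : refl F (refl F z) = z.
Proof. by case: z => x y; rewrite /refl /= opprB addrC subrK. Qed.

Lemma Int_reflM (k psi : R * R -> R) K : L1 mu2 k -> continuous psi -> (forall z, `|psi z| <= K) ->
  Int mu2 (fun z => k (refl F z) * psi z) = Int mu2 (fun z => k z * psi (refl F z)) /\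
  L1 mu2 (fun z => k z * psi (refl F z)).
Proof.
move=> hk cpsi hK.
have L : L1 mu2 (fun z => k z * psi (refl F z)).
  by apply: (L1_mul (K := K)) => //; exact: (measurable_phir cF cpsi).
split => //; rewrite -(Int_refl mF L); congr Int; apply/funext => z.
by rewrite reflK.
Qed.

Lemma chiP_bound phi Kp z : (forall z, `|phi z| <= Kp) -> `|chiP phi z| <= Kp + Kp.
Proof.
move=> h; apply: le_trans (ler_normD _ _) _; apply: lerD => //.
by rewrite normrM -[leRHS]mul1r ler_pM// hcut_bound.
Qed.

Lemma Int_gvM psi K : continuous psi -> (forall z, `|psi z| <= K) ->
  Int mu2 (fun z => gv z * psi z) = Int mu2 (fun z => u z * (psi z + hcut F d z * psi (refl F z))).
Proof.
move=> cpsi hK; have [hu _] := hL1; have Lh := L1_hcutM hu.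
have [E L] := Int_reflM Lh cpsi hK.
have Lu := L1_mul hu (cont2_measurable cpsi) hK.
have Lr' := L1_mul (Lr Lh) (cont2_measurable cpsi) hK.
have -> : (fun z => gv z * psi z) =
    (fun z => u z * psi z + hcut F d (refl F z) * u (refl F z) * psi z).
  by apply/funext => z; rewrite /gv mulrDl.
rewrite (IntD Lu Lr') E -(IntD Lu L); congr Int; apply/funext => z; ring.
Qed.

Lemma Int_addM (g k psi : R * R -> R) K : L1 mu2 g -> L1 mu2 k -> continuous psi ->
  (forall z, `|psi z| <= K) ->
  Int mu2 (fun z => (g z + k (refl F z)) * psi z) =
  Int mu2 (fun z => g z * psi z + k z * psi (refl F z)).
Proof.
move=> hg hk cpsi hK.
have [E L] := Int_reflM hk cpsi hK.
have Lg := L1_mul hg (cont2_measurable cpsi) hK.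
have Lr' := L1_mul (Lr hk) (cont2_measurable cpsi) hK.
have -> : (fun z => (g z + k (refl F z)) * psi z) =
    (fun z => g z * psi z + k (refl F z) * psi z).
  by apply/funext => z; rewrite mulrDl.
by rewrite (IntD Lg Lr') E -(IntD Lg L).
Qed.

(** After the change of variables by [refl F], every integral is against [u] or its gradient above
    the graph. The vertical identity is [vanishing_ibp] with [m = 1]. For the horizontal one, [d_x]
    is the tangential derivative minus [F'] times the vertical one: [tangential] for the even
    combination [chiP], minus [vanishing_ibp] with [m = F'] for the odd combination [chiM]. *)
Lemma reflected_WD : WD strip gv gh1 gh2.
Proof.
have [hu [hg1 hg2]] := hL1.
have Lv : L1 mu2 gv by apply: L1D => //; apply: (Lr (L1_hcutM hu)).
have Lh1 : L1 mu2 gh1 by apply: L1D => //; apply: (Lr L1_k1).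
have Lh2 : L1 mu2 gh2 by apply: L1B => //; apply: (Lr L1_k2).
have [_ _ _ _ [mFp _]] := aF.
split => // phi tphi; have sphi := test_smooth tphi;
  have [Kp Kp0 hKp] := test_bounded tphi;
  have [A [cA AI phi0 _ _]] := test_supp tphi;
  have [Bx _ hB] := compact_box cA.
- have phi0' z : Bx < `|z.2| -> phi z = 0.
    by move=> h; apply: phi0 => /hB[_]; rewrite leNgt h.
  have c0 := smooth2_continuous sphi; have c1 := smooth2_continuous (smooth2_D1 sphi).
  have b0 z : `|phi z| <= Kp by case: (hKp z).
  have b1 z : `|'D_e1 phi z| <= Kp by case: (hKp z).
  rewrite (Int_gvM c1 b1) (Int_addM hg1 L1_k1 c0 b0).
  have V := @vanishing_ibp _ I F d u g1 g2 Mt oI cF cd d0 wd out2 top2 dout2 Ks Ks0 hKs phi Kp Bx sphi hKp phi0' Fp M mFp Fpb.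
  have [TL TE] := tangential tphi.
  have LV := LFp (L1_uchiY oI cF cd d0 wd out2 top2 dout2 Ks0 hKs sphi hKp).
  have LV' := LFp (L1_gchi cF cd sphi hKp hg2).
  have [_ LS] := Int_reflM (L1D L1_uhS (LFp LuY)) c0 b0.
  have LP := L1_mul (L1D hg1 (LFp hg2)) (measurable_chiP sphi) (fun z => chiP_bound z b0).
  transitivity (Int mu2 (fun z => u z * Dlim phi z - Fp z.1 * (u z * chiMY F d phi z) -
      (u z * hcutS z + Fp z.1 * (u z * hcutY F d z)) * phi (refl F z))).
    congr Int; apply/funext => z; rewrite /Dlim /chiMY; ring.
  rewrite (IntB (L1B TL LV) LS) (IntB TL LV) TE V opprK -(IntN LP) -(IntD (L1N LP) LV').
  rewrite -(IntB (L1D (L1N LP) LV') LS).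
  have [_ L0] := Int_reflM L1_k1 c0 b0.
  have Lg1 := L1_mul hg1 (cont2_measurable c0) b0.
  rewrite -(IntN (L1D Lg1 L0)).
  congr Int; apply/funext => z; rewrite /k1 /chiP /chiM; ring.
- have phi0' z : Bx < `|z.2| -> phi z = 0.
    by move=> h; apply: phi0 => /hB[_]; rewrite leNgt h.
  have c0 := smooth2_continuous sphi; have c1 := smooth2_continuous (smooth2_D2 sphi).
  have b0 z : `|phi z| <= Kp by case: (hKp z).
  have b1 z : `|'D_e2 phi z| <= Kp by case: (hKp z).
  have -> : gh2 = (fun z => g2 z + (fun z => - k2 z) (refl F z)) by [].
  rewrite (Int_gvM c1 b1) (Int_addM hg2 (L1N L1_k2) c0 b0).
  have n1 (x : R) : `|cst 1 x| <= (1 : R) by rewrite normr1.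
  have V := @vanishing_ibp _ I F d u g1 g2 Mt oI cF cd d0 wd out2 top2 dout2 Ks Ks0 hKs phi Kp Bx sphi hKp phi0' (cst 1) 1 (measurable_cst _) n1.
  have LV := L1_uchiY oI cF cd d0 wd out2 top2 dout2 Ks0 hKs sphi hKp.
  have LV' := L1_gchi cF cd sphi hKp hg2.
  have [_ LS] := Int_reflM LuY c0 b0.
  have V' : Int mu2 (fun z => u z * chiMY F d phi z) = - Int mu2 (fun z => g2 z * chiM F d phi z).
    transitivity (Int mu2 (fun z => cst 1 z.1 * (u z * chiMY F d phi z))).
      by congr Int; apply/funext => z; rewrite mul1r.
    by rewrite V; congr (- Int _ _); apply/funext => z; rewrite mul1r.
  transitivity (Int mu2 (fun z => u z * chiMY F d phi z + u z * hcutY F d z * phi (refl F z))).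
    congr Int; apply/funext => z; rewrite /chiMY; ring.
  rewrite (IntD LV LS) V' -(IntN LV') -(IntD (L1N LV') LS).
  have [_ L0] := Int_reflM (L1N L1_k2) c0 b0.
  have Lg1 := L1_mul hg2 (cont2_measurable c0) b0.
  rewrite -(IntN (L1D Lg1 L0)).
  congr Int; apply/funext => z; rewrite /k2 /chiM; ring.
Qed.

Lemma reflected_eq z : above I F z -> [/\ gv z = u z, gh1 z = g1 z & gh2 z = g2 z].
Proof.
move=> [_ Fz]; have nab : ~ above I F (refl F z).
  by move=> [_] /=; apply/negP; rewrite -leNgt; lra.
have [h1 h2 h3] := out nab.
by rewrite /gv /gh1 /gh2 /k1 /k2 h1 h2 h3 !(mulr0, mul0r, addr0, subr0).
Qed.

Lemma reflected_below z : z.2 < F z.1 - d z.1 -> [/\ gv z = 0, gh1 z = 0 & gh2 z = 0].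
Proof.
move=> hz; have := d0 z.1 => dz0.
have nab : ~ above I F z by move=> [_]; apply/negP; rewrite -leNgt; lra.
rewrite /gv /gh1 /gh2 /k1 /k2; have [-> -> ->] := out nab.
have [dz|dz] := leP (d z.1) 0.
  by have [-> -> ->] := dout (z := refl F z) dz; rewrite !(mulr0, mul0r, addr0, subr0).
have q1 : 1 < ((refl F z).2 - F (refl F z).1) / d (refl F z).1.
  by rewrite ltr_pdivlMr//=; lra.
rewrite /hcut /hcutY /hcutS dsigma_gt1// sigma_ge1 1?ltW//.
by rewrite subrr !(mulr0, mul0r, oppr0, addr0, subr0).
Qed.

Definition N1 (f : R * R -> R) := Int mu2 (fun z => `|f z|).

Lemma N1D f g : L1 mu2 f -> L1 mu2 g -> N1 (fun z => f z + g z) <= N1 f + N1 g.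
Proof.
move=> hf hg; rewrite -IntD; [|exact: L1_norm|exact: L1_norm].
apply: le_Int; [by apply: L1_norm; exact: L1D|by apply: L1D; exact: L1_norm|].
by move=> z; exact: ler_normD.
Qed.

Lemma N1_le f g K : L1 mu2 f -> L1 mu2 g -> (forall z, `|f z| <= K * `|g z|) -> N1 f <= K * N1 g.
Proof.
move=> hf hg h; rewrite /N1 -IntZ; last exact: L1_norm.
by apply: le_Int => //; [exact: L1_norm|apply: L1Z; exact: L1_norm].
Qed.

Lemma N1_refl f : L1 mu2 f -> N1 (fun z => f (refl F z)) = N1 f.
Proof. by move=> hf; exact: (Int_refl mF (L1_norm hf)). Qed.

Lemma N1_ge0 f : 0 <= N1 f.
Proof. exact: Int_ge0. Qed.

(** The reflection preserves integrals and [hcut] is at most 1. By [hardy], a term with [hcutY]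
    costs [3 Ks] and one with [hcutS] costs [3 Ks M] times the norm of [g2]; the factors [F'] in
    [k1] cost [M] each. *)
Lemma reflected_bound : N1 gv + N1 gh1 + N1 gh2 <=
  (4 + 2 * M + 6 * Ks * M + 3 * Ks) * (N1 u + N1 g1 + N1 g2).
Proof.
have [hu [hg1 hg2]] := hL1.
have [hw hwb] := hardy oI cF cd d0 wd out2 top2 dout2.
have hH g : L1 mu2 g -> N1 (fun z => hcut F d z * g z) <= N1 g.
  move=> hg; rewrite -[leRHS]mul1r; apply: N1_le => //; first exact: L1_hcutM.
  by move=> z; rewrite normrM ler_wpM2r// hcut_bound.
have hF' g : L1 mu2 g -> N1 (fun z => Fp z.1 * g z) <= M * N1 g.
  by move=> hg; apply: N1_le => //; [exact: LFp|move=> z; rewrite normrM ler_wpM2r].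
have n0 := (N1_ge0 u, N1_ge0 g1, N1_ge0 g2).
have W : N1 (fun z => u z * wgt F d z) <= 3 * N1 g2 by [].
have bY : N1 (fun z => u z * hcutY F d z) <= 3 * Ks * N1 g2.
  apply: le_trans (N1_le (K := Ks) LuY hw (hcutY_layer d0 out2 dout2 Ks0 hKs)) _.
  have -> : 3 * Ks * N1 g2 = Ks * (3 * N1 g2) by ring.
  exact: ler_wpM2l.
have bS : N1 (fun z => u z * hcutS z) <= 3 * Ks * M * N1 g2.
  apply: le_trans (N1_le L1_uhS hw hcutS_layer) _.
  have : Ks * M * N1 (fun z => u z * wgt F d z) <= Ks * M * (3 * N1 g2) by rewrite ler_wpM2l// mulr_ge0.
  lra.
have bk2 : N1 k2 <= N1 g2 + 3 * Ks * N1 g2.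
  by apply: le_trans (N1D (L1_hcutM hg2) LuY) _; rewrite lerD// hH.
have bk1 : N1 k1 <= N1 g1 + 2 * (M * N1 g2) + (3 * Ks * M * N1 g2 + M * (3 * Ks * N1 g2)).
  have L2 : L1 mu2 (fun z => 2 * Fp z.1 * (hcut F d z * g2 z)).
    have := L1Z 2 (LFp (L1_hcutM hg2)); congr (L1 _ _); apply/funext => z; ring.
  apply: le_trans (N1D (L1D (L1_hcutM hg1) L2) (L1D L1_uhS (LFp LuY))) _.
  apply: lerD.
    apply: le_trans (N1D (L1_hcutM hg1) L2) _; rewrite lerD ?hH//.
    apply: le_trans (N1_le (K := 2) L2 (LFp (L1_hcutM hg2)) _) _.
      by move=> z; rewrite -mulrA normrM ger0_norm.
    rewrite ler_wpM2l//; apply: le_trans (hF' _ (L1_hcutM hg2)) _.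
    by rewrite ler_wpM2l// hH.
  apply: le_trans (N1D L1_uhS (LFp LuY)) _; rewrite lerD//.
  by apply: le_trans (hF' _ LuY) _; rewrite ler_wpM2l.
have Hb : N1 gv <= N1 u + N1 u.
  apply: le_trans (N1D hu (Lr (L1_hcutM hu))) _.
  by rewrite lerD2l (N1_refl (L1_hcutM hu)) hH.
have H1 : N1 gh1 <= N1 g1 + N1 k1.
  by rewrite -(N1_refl L1_k1); exact: (N1D hg1 (Lr L1_k1)).
have H2 : N1 gh2 <= N1 g2 + N1 k2.
  apply: le_trans (N1D hg2 (L1N (Lr L1_k2))) _.
  rewrite lerD2l -(N1_refl L1_k2) /N1.
  by rewrite (_ : (fun z => `|- k2 (refl F z)|) = (fun z => `|k2 (refl F z)|))//; apply/funext => z; rewrite normrN.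
case: n0 => [[nu n1] n2].
have p : [/\ 0 <= M * N1 u, 0 <= M * N1 g1, 0 <= Ks * N1 u, 0 <= Ks * N1 g1 & 0 <= Ks * M * N1 u /\ 0 <= Ks * M * N1 g1].
  by split; last split; rewrite !mulr_ge0.
case: p => [p1 p2 p3 p4 [p5 p6]].
set A := N1 u in nu p1 p3 p5 Hb *; set B := N1 g1 in n1 p2 p4 p6 H1 bk1 *; set D := N1 g2 in n2 bY bS bk2 bk1 H2 *.
apply: (@le_trans _ _ (A + A + (B + (B + 2 * (M * D) + (3 * Ks * M * D + M * (3 * Ks * D)))) + (D + (D + 3 * Ks * D)))).
  by apply: lerD; [apply: lerD => //; apply: le_trans H1 _; rewrite lerD2l|apply: le_trans H2 _; rewrite lerD2l].
have -> : (4 + 2 * M + 6 * Ks * M + 3 * Ks) * (A + B + D) = 4 * A + 4 * B + 4 * D + 2 * (M * A) + 2 * (M * B) + 2 * (M * D) + 6 * (Ks * M * A) + 6 * (Ks * M * B) + 6 * (Ks * M * D) + 3 * (Ks * A) + 3 * (Ks * B) + 3 * (Ks * D) by ring.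
have -> : M * (3 * Ks * D) = 3 * (Ks * M * D) by ring.
have -> : 3 * Ks * M * D = 3 * (Ks * M * D) by ring.
have -> : 3 * Ks * D = 3 * (Ks * D) by ring.
lra.
Qed.

End GraphExtension.

(** * Sums, null modifications and cutoffs of weakly differentiable functions *)

Section WeakCalculus.
Context (R : realType).
Local Notation T1 := (measurableTypeR R).
Local Notation mu2 := (mu2 R).
Local Notation e1 := (e1 R).
Local Notation e2 := (e2 R).
Implicit Types (O : set (R * R)) (u v : R * R -> R).

Definition vanish (P : set (R * R)) u (g1 g2 : R * R -> R) :=
  forall z, P z -> [/\ u z = 0, g1 z = 0 & g2 z = 0].

Definition agree (P : set (R * R)) u (g1 g2 : R * R -> R) v (h1 h2 : R * R -> R) :=
  forall z, P z -> [/\ v z = u z, h1 z = g1 z & h2 z = g2 z].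

Definition nrm u (g1 g2 : R * R -> R) := N1 u + N1 g1 + N1 g2.

Lemma WD_L1 O u (g1 g2 : R * R -> R) : WD O u g1 g2 -> [/\ L1 mu2 u, L1 mu2 g1 & L1 mu2 g2].
Proof. by case. Qed.

Lemma WDS O O' u (g1 g2 : R * R -> R) : O `<=` O' -> WD O' u g1 g2 -> WD O u g1 g2.
Proof.
by move=> OO' [? ? ? w1 w2]; split => // phi /(testS OO') t; [exact: w1|exact: w2].
Qed.

Lemma L1_test O phi f : test_function O phi -> L1 mu2 f ->
  [/\ L1 mu2 (fun z => f z * phi z), L1 mu2 (fun z => f z * 'D_e1 phi z) &
      L1 mu2 (fun z => f z * 'D_e2 phi z)].
Proof.
move=> t hf; have [K _ hK] := test_bounded t; have [m0 m1 m2] := measurable_test t.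
split; [apply: (L1_mul (K := K) hf m0)|apply: (L1_mul (K := K) hf m1)|apply: (L1_mul (K := K) hf m2)];
  move=> z; have [h0 h1 h2] := hK z; [exact: h0|exact: h1|exact: h2].
Qed.

Lemma WDD O u (g1 g2 : R * R -> R) v (h1 h2 : R * R -> R) : WD O u g1 g2 -> WD O v h1 h2 ->
  WD O (fun z => u z + v z) (fun z => g1 z + h1 z) (fun z => g2 z + h2 z).
Proof.
move=> [a0 a1 a2 w1 w2] [b0 b1 b2 x1 x2].
split; [exact: L1D|exact: L1D|exact: L1D| |] => phi t.
  have [A1 _ _] := L1_test t a1; have [B1 _ _] := L1_test t b1.
  have [_ A0 _] := L1_test t a0; have [_ B0 _] := L1_test t b0.
  transitivity (Int mu2 (fun z => u z * 'D_e1 phi z + v z * 'D_e1 phi z)).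
    by congr Int; apply/funext => z; rewrite mulrDl.
  rewrite (IntD A0 B0) (w1 _ t) (x1 _ t) -opprD -(IntD A1 B1); congr (- Int _ _).
  by apply/funext => z; rewrite mulrDl.
have [A1 _ _] := L1_test t a2; have [B1 _ _] := L1_test t b2.
have [_ _ A0] := L1_test t a0; have [_ _ B0] := L1_test t b0.
transitivity (Int mu2 (fun z => u z * 'D_e2 phi z + v z * 'D_e2 phi z)).
  by congr Int; apply/funext => z; rewrite mulrDl.
rewrite (IntD A0 B0) (w2 _ t) (x2 _ t) -opprD -(IntD A1 B1); congr (- Int _ _).
by apply/funext => z; rewrite mulrDl.
Qed.

Lemma N1_ae (f g : R * R -> R) : measurable_fun setT (f : T1 * T1 -> R) -> measurable_fun setT (g : T1 * T1 -> R) ->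
  {ae mu2, forall z, f z = g z} -> N1 f = N1 g.
Proof.
move=> mf mg h; apply: Int_ae; [exact: measurableT_comp|exact: measurableT_comp|].
by apply: (aeS h) => z ->.
Qed.

Lemma WD_ae O u (g1 g2 : R * R -> R) v (h1 h2 : R * R -> R) : WD O u g1 g2 ->
  measurable_fun setT (v : T1 * T1 -> R) -> measurable_fun setT (h1 : T1 * T1 -> R) ->
  measurable_fun setT (h2 : T1 * T1 -> R) ->
  {ae mu2, forall z, [/\ u z = v z, g1 z = h1 z & g2 z = h2 z]} ->
  WD O v h1 h2 /\ nrm v h1 h2 = nrm u g1 g2.
Proof.
move=> [a0 a1 a2 w1 w2] mv mh1 mh2 e.
have e0 : {ae mu2, forall z, u z = v z} by apply: (aeS e) => z [].
have e1' : {ae mu2, forall z, g1 z = h1 z} by apply: (aeS e) => z [].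
have e2' : {ae mu2, forall z, g2 z = h2 z} by apply: (aeS e) => z [].
have l0 := L1_ae a0 mv e0; have l1 := L1_ae a1 mh1 e1'; have l2 := L1_ae a2 mh2 e2'.
have ee (a b w : R * R -> R) : {ae mu2, forall z, a z = b z} -> {ae mu2, forall z, a z * w z = b z * w z}.
  by move=> h; apply: (aeS h) => z ->.
split; last by rewrite /nrm (N1_ae (L1_meas a0) mv e0) (N1_ae (L1_meas a1) mh1 e1') (N1_ae (L1_meas a2) mh2 e2').
split => // phi t.
  have [_ A0 _] := L1_test t a0; have [_ B0 _] := L1_test t l0.
  have [A1 _ _] := L1_test t a1; have [B1 _ _] := L1_test t l1.
  by rewrite -(Int_ae (L1_meas A0) (L1_meas B0) (ee _ _ _ e0)) -(Int_ae (L1_meas A1) (L1_meas B1) (ee _ _ _ e1')) w1.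
have [_ _ A0] := L1_test t a0; have [_ _ B0] := L1_test t l0.
have [A1 _ _] := L1_test t a2; have [B1 _ _] := L1_test t l2.
by rewrite -(Int_ae (L1_meas A0) (L1_meas B0) (ee _ _ _ e0)) -(Int_ae (L1_meas A1) (L1_meas B1) (ee _ _ _ e2')) w2.
Qed.

Lemma WDN O u (g1 g2 : R * R -> R) : WD O u g1 g2 -> WD O (fun z => - u z) (fun z => - g1 z) (fun z => - g2 z).
Proof.
move=> [a0 a1 a2 w1 w2].
split; [exact: L1N|exact: L1N|exact: L1N| |] => phi t.
  have [A1 _ _] := L1_test t a1; have [_ A0 _] := L1_test t a0.
  have E (a b : R * R -> R) : L1 mu2 (fun z => a z * b z) ->
      Int mu2 (fun z => - a z * b z) = - Int mu2 (fun z => a z * b z).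
    by move=> h; rewrite -(IntN h); congr Int; apply/funext => z; rewrite mulNr.
  by rewrite (E _ _ A0) (E _ _ A1) (w1 _ t).
have [A1 _ _] := L1_test t a2; have [_ _ A0] := L1_test t a0.
have E (a b : R * R -> R) : L1 mu2 (fun z => a z * b z) ->
    Int mu2 (fun z => - a z * b z) = - Int mu2 (fun z => a z * b z).
  by move=> h; rewrite -(IntN h); congr Int; apply/funext => z; rewrite mulNr.
by rewrite (E _ _ A0) (E _ _ A1) (w2 _ t).
Qed.

Lemma nrmD u (g1 g2 : R * R -> R) v (h1 h2 : R * R -> R) : [/\ L1 mu2 u, L1 mu2 g1 & L1 mu2 g2] ->
  [/\ L1 mu2 v, L1 mu2 h1 & L1 mu2 h2] ->
  nrm (fun z => u z + v z) (fun z => g1 z + h1 z) (fun z => g2 z + h2 z) <=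
  nrm u g1 g2 + nrm v h1 h2.
Proof.
move=> [a0 a1 a2] [b0 b1 b2].
have := (N1D a0 b0, N1D a1 b1, N1D a2 b2); rewrite /nrm => -[[? ?] ?]; lra.
Qed.

Lemma nrmN u (g1 g2 : R * R -> R) : nrm (fun z => - u z) (fun z => - g1 z) (fun z => - g2 z) = nrm u g1 g2.
Proof.
have E f : N1 (fun z : R * R => - f z) = N1 f.
  by rewrite /N1; congr Int; apply/funext => z; rewrite normrN.
by rewrite /nrm !E.
Qed.

(** Changes the domain as well: where [zeta] vanishes nothing needs to be known about [u], because
    [zeta phi] is a test function on [O] whenever [phi] is one on [O']. *)
Lemma WD_cut O O' Z u (g1 g2 : R * R -> R) (zeta zeta' : R -> R) Kd : WD O u g1 g2 -> smooth1 zeta ->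
  (forall y, is_derive y (1:R) zeta (zeta' y)) ->
  (forall y, `|zeta y| <= 1) -> (forall y, `|zeta' y| <= Kd) ->
  closed Z -> (forall y, ~ Z y -> zeta y = 0) -> (forall z, O' z -> Z z.2 -> O z) ->
  WD O' (fun z => zeta z.2 * u z) (fun z => zeta z.2 * g1 z)
     (fun z => zeta z.2 * g2 z + zeta' z.2 * u z) /\
  nrm (fun z => zeta z.2 * u z) (fun z => zeta z.2 * g1 z)
     (fun z => zeta z.2 * g2 z + zeta' z.2 * u z) <= (1 + Kd) * nrm u g1 g2.
Proof.
move=> [hu hg1 hg2 w1 w2] sz dz z1 zd cZ Z0 ZO.
have Kd0 : 0 <= Kd by apply: le_trans (zd 0).
have cz := smooth1_continuous sz.
have cz' : continuous zeta'.
  have -> : zeta' = derive1 zeta by apply/funext => y; rewrite derive1E; case: (dz y).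
  exact: smooth1_continuous (smooth1_derive1 sz).
have mz : measurable_fun setT ((fun z => zeta z.2) : T1 * T1 -> R).
  exact: (measurableT_comp (continuous_measurable_fun cz) measurable_snd).
have mz' : measurable_fun setT ((fun z => zeta' z.2) : T1 * T1 -> R).
  exact: (measurableT_comp (continuous_measurable_fun cz') measurable_snd).
have l0 (f : R * R -> R) : L1 mu2 f -> L1 mu2 (fun z => zeta z.2 * f z).
  by move=> hf; apply: (L1M (M := 1) hf mz) => z; exact: z1.
have l1 (f : R * R -> R) : L1 mu2 f -> L1 mu2 (fun z => zeta' z.2 * f z).
  by move=> hf; apply: (L1M (M := Kd) hf mz') => z; exact: zd.
have tz phi : test_function O' phi -> test_function O (fun z => zeta z.2 * phi z).
  move=> t; have [A [cA AO A0 _ _]] := test_supp t.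
  have cl : closed [set z : R * R | Z z.2].
    apply: (@closed_comp _ _ (snd : R * R -> R) Z) => // z _; exact: cvg_snd.
  apply: (@test_intro _ _ (A `&` [set z | Z z.2])).
  - apply: Sm_mul; last exact: Sm_smooth2 (test_smooth t).
    by apply: (Sm_comp1 sz); exact: Sm_snd.
  - by apply: (subclosed_compact _ cA) => //; apply: closedI => //; apply: compact_closed => //; exact: norm_hausdorff.
  - by move=> z [/AO Oz Zz]; exact: ZO.
  - move=> z nAZ; have [Az|nAz] := pselect (A z); last by rewrite A0// mulr0.
    by rewrite Z0 ?mul0r// => Zz; exact: nAZ.
have d1 phi : test_function O' phi -> forall z,
    'D_e1 (fun z => zeta z.2 * phi z) z = zeta z.2 * 'D_e1 phi z.
  move=> /test_smooth s z.
  have h := (is_derive_e1 _ _ _).1 (smooth2_derive1 z s).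
  have : is_derive z e1 (fun z => zeta z.2 * phi z) (zeta z.2 * 'D_e1 phi z).
    by apply/is_derive_e1; exact: (is_deriveZ (zeta z.2) h).
  by case.
have d2 phi : test_function O' phi -> forall z,
    'D_e2 (fun z => zeta z.2 * phi z) z = zeta z.2 * 'D_e2 phi z + phi z * zeta' z.2.
  move=> /test_smooth s z.
  have h := (is_derive_e2 _ _ _).1 (smooth2_derive2 z s).
  have : is_derive z e2 (fun z => zeta z.2 * phi z) (zeta z.2 * 'D_e2 phi z + phi z * zeta' z.2).
    apply/is_derive_e2; have := is_deriveM (dz z.2) h => /is_derive_eq; apply.
    by rewrite -surjective_pairing.
  by case.
split; last first.
  have a0 : N1 (fun z => zeta z.2 * u z) <= 1 * N1 u.
    by apply: (N1_le (l0 _ hu) hu) => z; rewrite normrM; apply: ler_wpM2r.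
  have a1 : N1 (fun z => zeta z.2 * g1 z) <= 1 * N1 g1.
    by apply: (N1_le (l0 _ hg1) hg1) => z; rewrite normrM; apply: ler_wpM2r.
  have a2 : N1 (fun z => zeta z.2 * g2 z) <= 1 * N1 g2.
    by apply: (N1_le (l0 _ hg2) hg2) => z; rewrite normrM; apply: ler_wpM2r.
  have a3 : N1 (fun z => zeta' z.2 * u z) <= Kd * N1 u.
    by apply: (N1_le (l1 _ hu) hu) => z; rewrite normrM; apply: ler_wpM2r.
  have a4 := N1D (l0 _ hg2) (l1 _ hu).
  have p1 : 0 <= Kd * N1 g1 by rewrite mulr_ge0 ?N1_ge0.
  have p2 : 0 <= Kd * N1 g2 by rewrite mulr_ge0 ?N1_ge0.
  rewrite /nrm mulrDl mul1r !mulrDr; lra.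
split; [exact: l0|exact: l0|apply: L1D; [exact: l0|exact: l1]| |] => phi t.
  transitivity (Int mu2 (fun z => u z * 'D_e1 (fun z => zeta z.2 * phi z) z)).
    by congr Int; apply/funext => z; rewrite (d1 _ t); ring.
  rewrite (w1 _ (tz _ t)); congr (- Int _ _); apply/funext => z; ring.
have [A0 _ A2] := L1_test t (l0 _ hu); have [B0 _ _] := L1_test t (l1 _ hu).
have [C0 _ _] := L1_test t (l0 _ hg2).
transitivity (Int mu2 (fun z => u z * 'D_e2 (fun z => zeta z.2 * phi z) z - zeta' z.2 * u z * phi z)).
  by congr Int; apply/funext => z; rewrite (d2 _ t); ring.
have La : L1 mu2 (fun z => u z * 'D_e2 (fun z => zeta z.2 * phi z) z).
  have := L1D A2 B0; congr (L1 _ _); apply/funext => z; rewrite (d2 _ t); ring.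
have Lb : L1 mu2 (fun z => g2 z * (zeta z.2 * phi z)).
  by have := C0; congr (L1 _ _); apply/funext => z; ring.
have [D0 _ _] := L1_test t (L1D (l0 _ hg2) (l1 _ hu)).
rewrite (IntB La B0) (w2 _ (tz _ t)) -(IntN Lb) -(IntB (L1N Lb) B0) -(IntN D0).
by congr Int; apply/funext => z; ring.
Qed.

End WeakCalculus.

(** * Symmetries: the flip of the second coordinate and the swap of the two *)

Section Involution.
Context (R : realType).
Local Notation T1 := (measurableTypeR R).
Local Notation mu2 := (mu2 R).
Local Notation e1 := (e1 R).
Local Notation e2 := (e2 R).
Variable T : R * R -> R * R.
Hypotheses (TK : involutive T) (cT : continuous T).
Hypotheses (L1T : forall f, L1 mu2 f -> L1 mu2 (fun z => f (T z)))
  (IntT : forall f, L1 mu2 f -> Int mu2 (fun z => f (T z)) = Int mu2 f)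
  (SmT : forall phi, smooth2 phi -> Sm (fun z => phi (T z))).

Lemma test_involution O phi : test_function (T @^-1` O) phi -> test_function O (fun z => phi (T z)).
Proof.
move=> t; have [A [cA AO A0 _ _]] := test_supp t.
apply: (@test_intro _ _ (T @` A)); first exact: SmT (test_smooth t).
- by apply: continuous_compact => //; exact: continuous_subspaceT.
- by move=> _ [z /AO Oz <-].
- by move=> z nA; apply: A0 => h; apply: nA; exists (T z) => //; exact: TK.
Qed.

Lemma Int_involutionM (k psi : R * R -> R) : L1 mu2 (fun z => k z * psi (T z)) ->
  Int mu2 (fun z => k (T z) * psi z) = Int mu2 (fun z => k z * psi (T z)).
Proof. by move=> L; rewrite -(IntT L); congr Int; apply/funext => z; rewrite TK. Qed.

Lemma N1_involution f : L1 mu2 f -> N1 (fun z => f (T z)) = N1 f.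
Proof. by move=> hf; exact: (IntT (L1_norm hf)). Qed.

End Involution.

Section Flip.
Context (R : realType).
Local Notation T1 := (measurableTypeR R).
Local Notation mu2 := (mu2 R).
Local Notation e1 := (e1 R).
Local Notation e2 := (e2 R).
Implicit Types (O : set (R * R)) (u v f phi : R * R -> R).

Definition flp : R * R -> R * R := refl (cst 0).

Lemma flpE z : flp z = (z.1, - z.2).
Proof. by rewrite /flp /refl /cst mulr0 sub0r. Qed.

Lemma flpK : involutive flp.
Proof. by move=> z; rewrite !flpE/= opprK -surjective_pairing. Qed.

Lemma continuous_flp : continuous flp.
Proof.
have -> : flp = fun z => (z.1, - z.2) by apply/funext => z; rewrite flpE.
by move=> z; exact: (cvg_pair (@cvg_fst _ _ _ _ _) (cvgN (@cvg_snd _ _ _ _ _))).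
Qed.

Lemma L1_flp f : L1 mu2 f -> L1 mu2 (fun z => f (flp z)).
Proof. by move=> hf; exact: (@L1_refl R (cst 0) f (measurable_cst _) hf). Qed.

Lemma Int_flp f : L1 mu2 f -> Int mu2 (fun z => f (flp z)) = Int mu2 f.
Proof. by move=> hf; exact: (@Int_refl R (cst 0) f (measurable_cst _) hf). Qed.

Lemma Sm_flp phi : smooth2 phi -> Sm (fun z => phi (flp z)).
Proof.
move=> s; have -> : (fun z => phi (flp z)) = fun z => phi (z.1, -1 * z.2).
  by apply/funext => z; rewrite flpE mulN1r.
apply: (@Sm_comp2 _ phi fst (fun z => -1 * z.2)) => //; first exact: Sm_fst.
by apply: (@Sm_mul _ (cst (-1))); [exact: Sm_cst|exact: Sm_snd].
Qed.

Lemma Sm_swp phi : smooth2 phi -> Sm (fun z => phi (swp z)).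
Proof. by move=> s; exact: (@Sm_comp2 _ phi snd fst s (Sm_snd R) (Sm_fst R)). Qed.

Lemma swpK : involutive (@swp R).
Proof. by case. Qed.

Lemma continuous_swp : continuous (@swp R).
Proof. by move=> z; exact: (cvg_pair (@cvg_snd _ _ _ _ _) (@cvg_fst _ _ _ _ _)). Qed.

Lemma derive_flp phi z : smooth2 phi ->
  'D_e1 (fun z => phi (flp z)) z = 'D_e1 phi (flp z) /\
  'D_e2 (fun z => phi (flp z)) z = - 'D_e2 phi (flp z).
Proof.
move=> s; split.
  have h := (is_derive_e1 _ _ _).1 (smooth2_derive1 (flp z) s).
  have : is_derive z e1 (fun z => phi (flp z)) ('D_e1 phi (flp z)).
    by apply/is_derive_e1; move: h; rewrite /flp /refl.
  by case.
have h := (is_derive_e2 _ _ _).1 (smooth2_derive2 (flp z) s).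
have : is_derive z e2 (fun z => phi (flp z)) (- 'D_e2 phi (flp z)).
  by apply/is_derive_e2; exact: (is_derive_refl (g := fun y => phi (z.1, y)) h).
by case.
Qed.

Lemma derive_swp phi z : smooth2 phi ->
  'D_e1 (fun z => phi (swp z)) z = 'D_e2 phi (swp z) /\
  'D_e2 (fun z => phi (swp z)) z = 'D_e1 phi (swp z).
Proof.
move=> s; split.
  have h := (is_derive_e2 _ _ _).1 (smooth2_derive2 (swp z) s).
  have : is_derive z e1 (fun z => phi (swp z)) ('D_e2 phi (swp z)).
    by apply/is_derive_e1.
  by case.
have h := (is_derive_e1 _ _ _).1 (smooth2_derive1 (swp z) s).
have : is_derive z e2 (fun z => phi (swp z)) ('D_e1 phi (swp z)).
  by apply/is_derive_e2.
by case.
Qed.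

Lemma WD_flp O u (g1 g2 : R * R -> R) : WD O u g1 g2 ->
  WD (flp @^-1` O) (fun z => u (flp z)) (fun z => g1 (flp z)) (fun z => - g2 (flp z)).
Proof.
move=> [a0 a1 a2 w1 w2].
split; [exact: L1_flp|exact: L1_flp|by apply: L1N; exact: L1_flp| |] => phi t;
  have s := test_smooth t; have t' := test_involution flpK continuous_flp Sm_flp t.
- have [A0 _ _] := L1_test t' a1; have [_ A1 _] := L1_test t' a0.
  have E : (fun z => u z * 'D_e1 (fun z => phi (flp z)) z) = (fun z => u z * 'D_e1 phi (flp z)).
    by apply/funext => z; rewrite (derive_flp z s).1.
  have W := w1 _ t'; rewrite E in W A1.
  by rewrite (Int_involutionM flpK Int_flp A1) W (Int_involutionM flpK Int_flp A0).
- have [A0 _ _] := L1_test t' (L1N a2); have [_ _ A1] := L1_test t' (L1N a0).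
  have W := w2 _ t'.
  have E : (fun z => - u z * 'D_e2 (fun z => phi (flp z)) z) = (fun z => u z * 'D_e2 phi (flp z)).
    by apply/funext => z; rewrite (derive_flp z s).2 mulNr mulrN opprK.
  rewrite E in A1.
  have [C0 _ _] := L1_test t' a2; have [_ _ C1] := L1_test t' a0.
  rewrite (Int_involutionM flpK Int_flp A1) -E.
  rewrite (Int_involutionM (k := fun z => - g2 z) flpK Int_flp A0).
  transitivity (- Int mu2 (fun z => u z * 'D_e2 (fun z => phi (flp z)) z)).
    by rewrite -(IntN C1); congr Int; apply/funext => z; rewrite mulNr.
  rewrite W opprK.
  transitivity (- (- Int mu2 (fun z => g2 z * phi (flp z)))); first by rewrite opprK.
  by rewrite -(IntN C0); congr (- Int _ _); apply/funext => z; rewrite mulNr.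
Qed.

Lemma WD_swp O u (g1 g2 : R * R -> R) : WD O u g1 g2 ->
  WD (@swp R @^-1` O) (fun z => u (swp z)) (fun z => g2 (swp z)) (fun z => g1 (swp z)).
Proof.
move=> [a0 a1 a2 w1 w2].
have I := @Int_swp R; have K := swpK.
split; [exact: L1_swp|exact: L1_swp|exact: L1_swp| |] => phi t;
  have s := test_smooth t; have t' := test_involution swpK continuous_swp Sm_swp t.
- have [A0 _ _] := L1_test t' a2; have [_ _ A1] := L1_test t' a0.
  have E : (fun z => u z * 'D_e2 (fun z => phi (swp z)) z) = (fun z => u z * 'D_e1 phi (swp z)).
    by apply/funext => z; rewrite (derive_swp z s).2.
  have W := w2 _ t'; rewrite E in W A1.
  by rewrite (Int_involutionM K I A1) W (Int_involutionM K I A0).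
- have [A0 _ _] := L1_test t' a1; have [_ A1 _] := L1_test t' a0.
  have E : (fun z => u z * 'D_e1 (fun z => phi (swp z)) z) = (fun z => u z * 'D_e2 phi (swp z)).
    by apply/funext => z; rewrite (derive_swp z s).1.
  have W := w1 _ t'; rewrite E in W A1.
  by rewrite (Int_involutionM K I A1) W (Int_involutionM K I A0).
Qed.

Lemma nrm_flp u (g1 g2 : R * R -> R) : [/\ L1 mu2 u, L1 mu2 g1 & L1 mu2 g2] ->
  nrm (fun z => u (flp z)) (fun z => g1 (flp z)) (fun z => - g2 (flp z)) = nrm u g1 g2.
Proof.
move=> [a0 a1 a2]; rewrite /nrm (N1_involution Int_flp a0) (N1_involution Int_flp a1).
rewrite -(N1_involution Int_flp a2); congr (_ + _); rewrite /N1; congr Int.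
by apply/funext => z; rewrite normrN.
Qed.

Lemma nrm_swp u (g1 g2 : R * R -> R) : [/\ L1 mu2 u, L1 mu2 g1 & L1 mu2 g2] ->
  nrm (fun z => u (swp z)) (fun z => g2 (swp z)) (fun z => g1 (swp z)) = nrm u g1 g2.
Proof.
have I := @Int_swp R.
move=> [a0 a1 a2]; rewrite /nrm (N1_involution I a0) (N1_involution I a1) (N1_involution I a2).
by rewrite addrAC.
Qed.

End Flip.

(** * The reflection theorem, packaged *)

Section GraphLike.
Context (R : realType).
Local Notation T1 := (measurableTypeR R).
Local Notation lm := (@lebesgue_measure R).
Local Notation mu2 := (mu2 R).
Implicit Types (I : set R) (F d : R -> R).

Definition graph_like I F d (M : R) := [/\ open I, continuous F, continuous d,
  (forall x, 0 <= d x) /\ 0 <= M & exists Fp Fn dp dn, [/\ smooth_approximation I F Fp Fn M 8,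
  smooth_approximation I d dp dn M 2 & forall (n : nat) x, 0 < dn n x]].

Lemma graph_like_cst I (a : R) : open I -> graph_like I (cst a) (cst 1) 0.
Proof.
move=> oI; split => //; [exact: cst_continuous|exact: cst_continuous|].
have h (b c : R) : 0 < c -> smooth_approximation I (cst b) (cst 0) (fun _ => cst b) 0 c.
  move=> c0.
  have D x : derive1 (cst b) x = 0 by rewrite derive1E; case: (is_derive_cst b x (1:R)).
  split.
  - by move=> n; apply: (@Sm_smooth1 _ (cst b) 0); exact: Sm_cst.
  - by move=> n x; rewrite subrr normr0 invr_ge0 mulr_ge0 ?ltW.
  - by move=> n x; rewrite D normr0.
  - by apply: aeW => x _; rewrite D; exact: cvg_cst.
  - by split => [|x]; [exact: measurable_cst|rewrite normr0].
by exists (cst 0), (fun _ => cst a), (cst 0), (fun _ => cst 1); split => //; exact: h.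
Qed.

(** The constant depends on the graph only. The construction uses on each column only the values of
    the same column, so a column on which everything vanishes stays zero. *)
Lemma graph_extension I F d M : graph_like I F d M -> exists2 K, 0 <= K &
  forall u (g1 g2 : R * R -> R) Mt, WD (above I F) u g1 g2 -> vanish (~` above I F) u g1 g2 ->
  vanish [set z | Mt <= z.2] u g1 g2 -> vanish [set z | d z.1 <= 0] u g1 g2 ->
  exists v h1 h2, [/\ WD [set z | I z.1] v h1 h2, agree (above I F) u g1 g2 v h1 h2,
    vanish [set z | z.2 < F z.1 - d z.1] v h1 h2,
    forall x, vanish [set z | z.1 = x] u g1 g2 -> vanish [set z | z.1 = x] v h1 h2 &
    nrm v h1 h2 <= K * nrm u g1 g2].
Proof.
move=> [oI cF cd [d0 M0] [Fp [Fn [dp [dn [aF ad dn0]]]]]].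
have [Ks Ks0 hKs] := dsigma_bounded R.
exists (4 + 2 * M + 6 * Ks * M + 3 * Ks); first by rewrite !addr_ge0// !mulr_ge0.
move=> u g1 g2 Mt wd out top dout.
exists (gv F d u), (gh1 F d Fp dp u g1 g2), (gh2 F d u g2); split.
- exact: (reflected_WD oI cF cd d0 M0 aF ad dn0 wd out top dout Ks0 hKs).
- by move=> z hz; exact: (reflected_eq _ _ _ out hz).
- by move=> z hz; exact: (reflected_below _ _ d0 out dout hz).
- move=> x h z /= zx; rewrite /gv /gh1 /gh2 /k1 /k2.
  have [-> -> ->] := h z zx; have [-> -> ->] := h (refl F z) zx.
  by rewrite !(mulr0, mul0r, addr0, subr0).
- exact: (reflected_bound oI cF cd d0 M0 aF ad wd out top dout Ks0 hKs).
Qed.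

End GraphLike.

(** * Extension from layers, strips and rectangles *)

Section LayerExtension.
Context (R : realType).
Local Notation T1 := (measurableTypeR R).
Local Notation mu2 := (mu2 R).
Implicit Types (O : set (R * R)) (u v : R * R -> R) (I : set R) (F d : R -> R).

Lemma smooth_ramp (p c : R) : 0 < c -> exists xi xi' : R -> R, exists2 K, 0 <= K &
  [/\ smooth1 xi, forall y, is_derive y (1:R) xi (xi' y), forall y, 0 <= xi y <= 1,
     forall y, `|xi' y| <= K &
     (forall y, y < p -> xi y = 0 /\ xi' y = 0) /\ (forall y, p + c < y -> xi y = 1 /\ xi' y = 0)].
Proof.
move=> c0; have [Ks Ks0 hKs] := dsigma_bounded R.
exists (fun y => sigma ((y - p) / c)), (fun y => dsigma ((y - p) / c) / c).
exists (Ks / c); first by rewrite divr_ge0// ltW.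
split.
- apply: (@Sm_smooth1 _ (fun z => sigma ((z.1 + - p) * c^-1)) 0).
  apply: (@Sm_comp1 _ (@sigma R) (fun z => (z.1 + - p) * c^-1)); first exact: smooth1_sigma.
  apply: (@Sm_mul _ _ (cst c^-1)); last exact: Sm_cst.
  by apply: (@Sm_add _ _ (cst (- p))); [exact: Sm_fst|exact: Sm_cst].
- move=> y; have l1 : is_derive y (1:R) (fun y => (y - p) / c) c^-1.
    have := is_deriveD (is_derive_lin c^-1 y) (is_derive_cst (- (p / c)) y (1:R)).
    rewrite addr0; congr is_derive; apply/funext => t; rewrite fctE/=; ring.
  exact: (@is_derive1_comp _ (@sigma R) (fun y => (y - p) / c) y _ _ (is_derive_sigma _) l1).
- by move=> y; rewrite sigma_ge0 sigma_le1.
- by move=> y; rewrite normrM (gtr0_norm (_ : 0 < c^-1)) ?invr_gt0// ler_wpM2r// invr_ge0 ltW.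
- split=> y hy.
    have q : (y - p) / c < 0 by rewrite pmulr_llt0 ?invr_gt0// subr_lt0.
    by rewrite sigma_le0 1?ltW// dsigma_lt0// mul0r.
  have q : 1 < (y - p) / c by rewrite ltr_pdivlMr//; lra.
  by rewrite sigma_ge1 1?ltW// dsigma_gt1// mul0r.
Qed.

Definition layer I F (B : R) : set (R * R) := [set z | [/\ I z.1, F z.1 < z.2 & z.2 < B]].

(** A partition of unity in [y]. The lower part vanishes near [y = B], hence is weakly
    differentiable on all of [above I F] and is reflected in the graph; the upper part vanishes near
    the graph and, once flipped, is reflected in the horizontal line at height [- B]. *)
Lemma layer_extension I F d M B B' : graph_like I F d M -> B' < B ->
  (forall x, I x -> F x <= B') -> exists2 K, 0 <= K &
  forall u (g1 g2 : R * R -> R), WD (layer I F B) u g1 g2 -> vanish (~` layer I F B) u g1 g2 ->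
  vanish [set z | d z.1 <= 0] u g1 g2 ->
  exists v h1 h2, [/\ WD [set z | I z.1] v h1 h2, agree (layer I F B) u g1 g2 v h1 h2,
    vanish [set z | z.2 < F z.1 - d z.1] v h1 h2,
    forall x, vanish [set z | z.1 = x] u g1 g2 -> vanish [set z | z.1 = x] v h1 h2 &
    nrm v h1 h2 <= K * nrm u g1 g2].
Proof.
move=> G BB FB; have [oI _ _ [d0 _] _] := G.
have [K1 K10 ext1] := graph_extension G.
have [K2 K20 ext2] := graph_extension (graph_like_cst (- B) oI).
(* The ramp occupies the middle third of [[B', B]], so each part vanishes near the boundary of the
   other. *)
pose c := (B - B') / 3; pose p := B' + c.
have c0 : 0 < c by rewrite divr_gt0// subr_gt0.
have pB : p + c < B by rewrite /p /c; lra.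
have Bp : B' < p by rewrite ltrDl.
have [xi [xi' [Kd Kd0 [sx dx bx bx' [x0 x1]]]]] := smooth_ramp p c0.
pose zt y := 1 - xi y; pose zt' y := - xi' y.
have sz : smooth1 zt.
  have -> : zt = fun y => 1 + (-1) * xi y by apply/funext => y; rewrite mulN1r.
  apply: (@Sm_smooth1 _ (fun z => 1 + (-1) * xi z.1) 0).
  apply: (@Sm_add _ (cst 1)); first exact: Sm_cst.
  apply: (@Sm_mul _ (cst (-1))); first exact: Sm_cst.
  by apply: (@Sm_comp1 _ xi fst) => //; exact: Sm_fst.
have dz y : is_derive y (1:R) zt (zt' y).
  by have := is_deriveB (is_derive_cst (1:R) y (1:R)) (dx y); rewrite sub0r.
have bz y : `|zt y| <= 1 by rewrite /zt ler_norml; have := bx y; move=> /andP[? ?]; lra.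
have bz' y : `|zt' y| <= Kd by rewrite normrN.
have bx1 y : `|xi y| <= 1 by rewrite ler_norml; have := bx y; move=> /andP[? ?]; lra.
exists (K1 * (1 + Kd) + K2 * (1 + Kd)); first by rewrite addr_ge0// mulr_ge0// addr_ge0.
move=> u g1 g2 wd out dout.
set L := layer I F B in wd out *.
have [wd1 n1] : WD (above I F) (fun z => zt z.2 * u z) (fun z => zt z.2 * g1 z)
     (fun z => zt z.2 * g2 z + zt' z.2 * u z) /\
  nrm (fun z => zt z.2 * u z) (fun z => zt z.2 * g1 z)
     (fun z => zt z.2 * g2 z + zt' z.2 * u z) <= (1 + Kd) * nrm u g1 g2.
  apply: (@WD_cut _ L (above I F) [set y | y <= p + c] _ _ _ zt zt' Kd wd sz dz bz bz').
  - exact: closed_le.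
  - by move=> y /negP; rewrite -ltNge => /x1[xy _]; rewrite /zt xy subrr.
  - by move=> z [Iz Fz] zp; split => //; exact: le_lt_trans zp pB.
have [wd2 n2] : WD [set z | I z.1 /\ z.2 < B] (fun z => xi z.2 * u z) (fun z => xi z.2 * g1 z)
     (fun z => xi z.2 * g2 z + xi' z.2 * u z) /\
  nrm (fun z => xi z.2 * u z) (fun z => xi z.2 * g1 z)
     (fun z => xi z.2 * g2 z + xi' z.2 * u z) <= (1 + Kd) * nrm u g1 g2.
  apply: (@WD_cut _ L _ [set y | p <= y] _ _ _ xi xi' Kd wd sx dx bx1 bx').
  - exact: closed_ge.
  - by move=> y /negP; rewrite -ltNge => /x0[].
  - by move=> z [Iz zB] pz; split => //; apply: le_lt_trans (FB _ Iz) _; exact: lt_le_trans pz.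
set u1 := (fun z => zt z.2 * u z) in wd1 n1; set g11 := (fun z => zt z.2 * g1 z) in wd1 n1.
set g12 := (fun z => zt z.2 * g2 z + zt' z.2 * u z) in wd1 n1.
set u2 := (fun z => xi z.2 * u z) in wd2 n2; set g21 := (fun z => xi z.2 * g1 z) in wd2 n2.
set g22 := (fun z => xi z.2 * g2 z + xi' z.2 * u z) in wd2 n2.
have van1 z : [/\ u z = 0, g1 z = 0 & g2 z = 0] -> [/\ u1 z = 0, g11 z = 0 & g12 z = 0].
  by rewrite /u1 /g11 /g12 => -[-> -> ->]; rewrite !mulr0 addr0.
have van2 z : [/\ u z = 0, g1 z = 0 & g2 z = 0] -> [/\ u2 z = 0, g21 z = 0 & g22 z = 0].
  by rewrite /u2 /g21 /g22 => -[-> -> ->]; rewrite !mulr0 addr0.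
have van2' z : z.2 < p -> [/\ u2 z = 0, g21 z = 0 & g22 z = 0].
  by move=> /x0[e0 e1]; rewrite /u2 /g21 /g22 e0 e1 !mul0r addr0.
have [v1 [h11 [h12 [W1 A1 V1 F1 b1]]]] : exists v h1 h2, [/\ WD [set z | I z.1] v h1 h2,
    agree (above I F) u1 g11 g12 v h1 h2, vanish [set z | z.2 < F z.1 - d z.1] v h1 h2,
    forall x, vanish [set z | z.1 = x] u1 g11 g12 -> vanish [set z | z.1 = x] v h1 h2 &
    nrm v h1 h2 <= K1 * nrm u1 g11 g12].
  apply: (ext1 _ _ _ B wd1).
  - by move=> z nz; apply/van1/out => -[Iz Fz _]; exact: nz.
  - by move=> z /= Bz; apply/van1/out => -[_ _]; rewrite ltNge Bz.
  - by move=> z hz; apply/van1/dout.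
have [v2 [h21 [h22 [W2 A2 _ F2 b2]]]] : exists v h1 h2, [/\ WD [set z | I z.1] v h1 h2,
    agree (above I (cst (- B))) (fun z => u2 (flp z)) (fun z => g21 (flp z)) (fun z => - g22 (flp z)) v h1 h2,
    vanish [set z | z.2 < cst (- B) z.1 - cst 1 z.1] v h1 h2,
    forall x, vanish [set z | z.1 = x] (fun z => u2 (flp z)) (fun z => g21 (flp z)) (fun z => - g22 (flp z)) -> vanish [set z | z.1 = x] v h1 h2 &
    nrm v h1 h2 <= K2 * nrm (fun z => u2 (flp z)) (fun z => g21 (flp z)) (fun z => - g22 (flp z))].
  apply: (ext2 _ _ _ (- B')).
  - apply: (WDS _ (WD_flp wd2)) => z [Iz /= Bz]; suff: [set z | I z.1 /\ z.2 < B] (flp z) by []; rewrite flpE; split => //=.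
    by rewrite ltrNl.
  - move=> z nz; have [-> -> ->] : [/\ u2 (flp z) = 0, g21 (flp z) = 0 & g22 (flp z) = 0]; last by rewrite oppr0.
    apply/van2/out; rewrite flpE => -[/= Iz _ Bz]; apply: nz; split => //=.
    by rewrite ltrNl.
  - move=> z /= Bz; have [-> -> ->] := van2' (flp z) ltac:(rewrite flpE/=; lra).
    by rewrite oppr0.
  - by move=> z /=; rewrite /cst ler10.
exists (fun z => v1 z + v2 (flp z)), (fun z => h11 z + h21 (flp z)), (fun z => h12 z + - h22 (flp z)).
have flpI : @flp R @^-1` [set z | I z.1] = [set z : R * R | I z.1].
  by apply/seteqP; split => z; rewrite /preimage /mkset flpE.
have W2' : WD [set z | I z.1] (fun z => v2 (flp z)) (fun z => h21 (flp z)) (fun z => - h22 (flp z)).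
  by have := WD_flp W2; rewrite flpI.
have E2 z : I z.1 -> z.2 < B -> [/\ v2 (flp z) = u2 z, h21 (flp z) = g21 z & - h22 (flp z) = g22 z].
  move=> Iz zB; have [-> -> ->] := A2 (flp z) ltac:(rewrite flpE; split; rewrite //= ltrN2//).
  by rewrite flpK opprK.
have fib z : (forall y, [/\ u (z.1, y) = 0, g1 (z.1, y) = 0 & g2 (z.1, y) = 0]) ->
    [/\ v2 (flp z) = 0, h21 (flp z) = 0 & - h22 (flp z) = 0].
  move=> h; have Hv : vanish [set z' | z'.1 = z.1] (fun z => u2 (flp z)) (fun z => g21 (flp z)) (fun z => - g22 (flp z)).
    move=> w /= wz; have [-> -> ->] : [/\ u2 (flp w) = 0, g21 (flp w) = 0 & g22 (flp w) = 0]; last by rewrite oppr0.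
    by apply: van2; rewrite flpE wz; exact: h.
  have [-> -> ->] := F2 z.1 Hv (flp z) ltac:(by rewrite /mkset flpE).
  by rewrite oppr0.
split.
- exact: (WDD W1 W2').
- move=> z Lz; have [Iz Fz zB] := Lz; have [-> -> ->] := A1 z (conj Iz Fz).
  have [-> -> ->] := E2 z Iz zB.
  by rewrite /u1 /u2 /g11 /g12 /g21 /g22 /zt /zt'; split; ring.
- move=> z /= hz; have [-> -> ->] := V1 z hz.
  have [Iz|nIz] := pselect (I z.1).
    have zp : z.2 < p by have := FB _ Iz; have := d0 z.1; lra.
    have [-> -> ->] := E2 z Iz ltac:(move: pB c0; lra).
    by have [-> -> ->] := van2' z zp; rewrite !addr0.
  by have [|-> -> ->] := fib z; [move=> y; apply: out => -[]|rewrite !addr0].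
- move=> x h z /= zx; have Hv : vanish [set z | z.1 = x] u1 g11 g12 by move=> w wx; apply/van1/h.
  have [-> -> ->] := F1 x Hv z zx.
  by have [|-> -> ->] := fib z; [move=> y; apply: h|rewrite !addr0].
- apply: le_trans (nrmD (WD_L1 W1) (WD_L1 W2')) _.
  rewrite (nrm_flp (WD_L1 W2)) mulrDl; apply: lerD.
    by apply: le_trans b1 _; rewrite -mulrA ler_wpM2l.
  by apply: le_trans b2 _; rewrite (nrm_flp (WD_L1 wd2)) -mulrA ler_wpM2l.
Qed.

Lemma strip_extension I (a b : R) : open I -> a < b -> exists2 K, 0 <= K &
  forall u (g1 g2 : R * R -> R), WD [set z | I z.1 /\ a < z.2 < b] u g1 g2 ->
  vanish (~` [set z | I z.1 /\ a < z.2 < b]) u g1 g2 ->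
  exists v h1 h2, [/\ WD [set z | I z.1] v h1 h2,
    agree [set z | I z.1 /\ a < z.2 < b] u g1 g2 v h1 h2, vanish [set z | ~ I z.1] v h1 h2 &
    nrm v h1 h2 <= K * nrm u g1 g2].
Proof.
move=> oI ab.
have [K K0 h] := @layer_extension I (cst a) (cst 1) 0 b a (graph_like_cst a oI) ab (fun _ _ => lexx a).
have E : [set z | I z.1 /\ a < z.2 < b] = layer I (cst a) b.
  by apply/seteqP; split => z /= [? h1]; [move: h1 => /andP[]|move=> h2; split => //; apply/andP].
exists K => // u g1 g2; rewrite E => wd out.
have [|v [h1 [h2 [W A _ Fb bd]]]] := h u g1 g2 wd out; first by move=> z /=; rewrite /cst ler10.
exists v, h1, h2; split => // z nI.
by apply: (Fb z.1) => // w /= wz; apply: out => -[]; rewrite wz.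
Qed.

(** A rectangle is extended one direction at a time: first to a vertical strip, then, after swapping
    the coordinates, to the plane. *)
Definition rect (a b c e : R) : set (R * R) := [set z | a < z.1 < b /\ c < z.2 < e].

Lemma rect_extension (a b c e : R) : a < b -> c < e -> exists2 K, 0 <= K &
  forall u (g1 g2 : R * R -> R), WD (rect a b c e) u g1 g2 -> vanish (~` rect a b c e) u g1 g2 ->
  exists v h1 h2, [/\ WD setT v h1 h2, agree (rect a b c e) u g1 g2 v h1 h2 &
    nrm v h1 h2 <= K * nrm u g1 g2].
Proof.
move=> ab ce.
pose I := [set x : R | a < x < b].
have oI : open I.
  rewrite (_ : I = `]a, b[%classic); first exact: interval_open.
  by apply/seteqP; split => x /=; rewrite in_itv.
have [K1 K10 ext1] := strip_extension oI ce.
have [K2 K20 ext2] := strip_extension (@openT R) ab.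
exists (K2 * K1); first exact: mulr_ge0.
move=> u g1 g2 wd out.
have [v [h1 [h2 [W A V bd]]]] := ext1 u g1 g2 wd out.
have [|| w [k1 [k2 [W' A' _ bd']]]] := ext2 (fun z => v (swp z)) (fun z => h2 (swp z)) (fun z => h1 (swp z)).
- by apply: (WDS _ (WD_swp W)) => z [].
- move=> z nz; have [] := V (swp z); first by move=> h; apply: nz.
  by move=> -> -> ->.
exists (fun z => w (swp z)), (fun z => k2 (swp z)), (fun z => k1 (swp z)); split.
- by apply: (WDS _ (WD_swp W')).
- move=> z rz; have [-> -> ->] := A' (swp z) ltac:(by split => //; case: rz).
  by rewrite swpK; exact: A.
- rewrite (nrm_swp (WD_L1 W')); apply: le_trans bd' _.
  by rewrite (nrm_swp (WD_L1 W)) -mulrA ler_wpM2l.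
Qed.

End LayerExtension.

(** * The distance to a closed null set *)

Section LipschitzAffine.
Context (R : realType).
Local Notation T1 := (measurableTypeR R).
Local Notation lm := (@lebesgue_measure R).

Definition affine_near (F : R -> R) x a :=
  exists2 r, 0 < r & forall y, `|y - x| < r -> F y = F x + a * (y - x).

Lemma open_affine_near F a : open [set x | affine_near F x a].
Proof.
rewrite openE => x [r r0 h]; apply/nbhs_ballP; exists (r / 2); first by rewrite /= divr_gt0.
move=> y; rewrite /ball/= => xy; exists (r / 2); first by rewrite divr_gt0.
move=> z zy; have yx : `|y - x| < r by rewrite distrC; lra.
have zx : `|z - x| < r.
  have -> : z - x = (z - y) + (y - x) by ring.
  by apply: le_lt_trans (ler_normD _ _) _; rewrite (distrC y x); lra.
by rewrite (h _ zx) (h _ yx); ring.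
Qed.

(** A difference of indicators of two open sets: everywhere defined and measurable for free, and
    equal to the derivative wherever [F] is locally affine with slope 1, -1 or 0. *)
Definition slope (F : R -> R) : R -> R := fun x =>
  \1_[set x | affine_near F x 1] x - \1_[set x | affine_near F x (-1)] x.

Lemma measurable_slope F : measurable_fun setT (slope F : T1 -> R).
Proof.
by apply: measurable_funB; apply: measurable_indic; apply: open_measurable; exact: open_affine_near.
Qed.

Lemma affine_near_unique F x a b : affine_near F x a -> affine_near F x b -> a = b.
Proof.
move=> [r r0 h] [s s0 k]; pose e := Num.min r s / 2.
have m0 : 0 < Num.min r s by rewrite lt_min r0.
have e0 : 0 < e by rewrite divr_gt0.
have er : e < r by apply: (@lt_le_trans _ _ (Num.min r s)); [rewrite /e; lra|rewrite ge_min lexx].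
have es : e < s by apply: (@lt_le_trans _ _ (Num.min r s)); [rewrite /e; lra|rewrite ge_min lexx orbT].
have E : x + e - x = e by ring.
have := h (x + e); have := k (x + e); rewrite !E gtr0_norm// => /(_ es) -> /(_ er).
by move=> /addrI /(mulIf (lt0r_neq0 e0)).
Qed.

Lemma slopeE F x a : a \in [:: 1; -1; 0] -> affine_near F x a -> slope F x = a.
Proof.
have n1 : (1 == -1 :> R) = false by apply/eqP; lra.
have n2 : (1 == 0 :> R) = false by apply/eqP; lra.
have n3 : (-1 == 0 :> R) = false by apply/eqP; lra.
have i (c : R) : affine_near F x a -> \1_[set x | affine_near F x c] x = (a == c)%:R :> R.
  move=> h; rewrite indicE; congr (_%:R); congr nat_of_bool; apply/idP/eqP; rewrite inE/=.
    by move=> k; exact: affine_near_unique h k.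
  by move=> <-.
move=> ain h; rewrite /slope !i//.
move: ain; rewrite !inE => /or3P[]/eqP->; rewrite ?eqxx ?n1 ?(eq_sym (-1)) ?n1 ?(eq_sym 0) ?n2 ?n3 ?subr0 ?sub0r//.
Qed.

Lemma slope_bound F x : `|slope F x| <= 1.
Proof.
rewrite /slope !indicE; case: (_ \in _); case: (_ \in _); rewrite ?subrr ?subr0 ?sub0r ?normr0 ?normr1 ?normrN1//.
Qed.

(** Stands in for Rademacher's theorem: at such points the slopes of the mollifications are
    eventually exact. *)
Definition ae_affine F := (forall x y : R, `|F x - F y| <= `|x - y|) /\
  {ae lm, forall x, exists2 a, a \in [:: 1; -1; 0] & affine_near F x a}.

Lemma smooth_approximationW (I : set R) F Fp Fn M M' c c' : 0 < c' -> M <= M' -> c' <= c ->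
  smooth_approximation I F Fp Fn M c -> smooth_approximation I F Fp Fn M' c'.
Proof.
move=> c0 MM cc [h1 h2 h3 h4 [h5 h6]]; split => //.
- move=> n x; apply: le_trans (h2 n x) _.
  rewrite lef_pV2 ?posrE ?mulr_gt0//; last exact: lt_le_trans cc.
  by rewrite ler_wpM2r.
- by move=> n x; apply: le_trans (h3 n x) _.
- by split => // x; apply: le_trans (h6 x) _.
Qed.

Lemma ae_affine_approximation (I : set R) F : ae_affine F -> exists Fp Fn, exists2 M, 0 <= M &
  smooth_approximation I F Fp Fn M 8.
Proof.
move=> [lF aF]; have [Fn [M [h1 h2 M0 h3 h4]]] := smooth_approx lF.
exists (slope F), Fn, (M + 1); first by rewrite addr_ge0.
split => //.
- by move=> n x; apply: le_trans (h3 n x) _; rewrite lerDl.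
- apply: (aeS aF) => x [a ain ax] _; rewrite (slopeE ain ax).
  have [r r0 hr] := ax.
  by apply: cvg_near_cst; exact: h4 r0 hr.
- split; first exact: measurable_slope.
  by move=> x; apply: le_trans (slope_bound F x) _; rewrite lerDr.
Qed.

Lemma ae_affine_graph_like (I : set R) F d : open I -> ae_affine F -> ae_affine d -> (forall x, 0 <= d x) ->
  exists M, graph_like I F d M.
Proof.
move=> oI aF ad d0.
have [Fp [Fn [M M0 hF]]] := ae_affine_approximation I aF.
have [dp [dn [N N0 hd]]] := ae_affine_approximation I ad.
exists (M + N); split => //.
- exact: (lip_continuous (lexx 1) aF.1).
- exact: (lip_continuous (lexx 1) ad.1).
- by split => //; exact: addr_ge0.
(* The mollified [dn] may be as low as [- 1 / (8 (n + 1))]. Raising it by [1 / (4 (n + 1))] makes it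
   positive, and the total error [3 / (8 (n + 1))] is still below the allowed [1 / (2 (n + 1))]. *)
pose dn' n x := dn n x + (4 * n.+1%:R)^-1.
have [s1 s2 s3 s4 [s5 s6]] := hd.
have dnE n x : derive1 (dn' n) x = derive1 (dn n) x.
  have := is_deriveD (smooth1_derivable x (s1 n)) (is_derive_cst ((4 * n.+1%:R)^-1 : R) x (1:R)).
  by rewrite addr0 [X in _ -> X = _]derive1E => -[_ h]; exact: h.
exists Fp, Fn, dp, dn'; split.
- by apply: smooth_approximationW hF => //; rewrite lerDl.
- split.
  + move=> n; apply: (@Sm_smooth1 _ (fun z => dn n z.1 + (4 * n.+1%:R)^-1) 0).
    by apply: (@Sm_add _ _ (cst _)); [apply: (Sm_comp1 (s1 n)); exact: Sm_fst|exact: Sm_cst].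
  + move=> n x; have := s2 n x; rewrite /dn' !invfM; have : 0 < n.+1%:R^-1 :> R by rewrite invr_gt0.
    by set e := n.+1%:R^-1 => e0; rewrite !ler_norml => /andP[? ?]; apply/andP; split; lra.
  + by move=> n x; rewrite dnE; apply: le_trans (s3 n x) _; rewrite lerDr.
  + by apply: (aeS s4) => x h Ix; under eq_fun do rewrite dnE; exact: h.
  + by split => // x; apply: le_trans (s6 x) _; rewrite lerDr.
- move=> n x; have := s2 n x; rewrite /dn' !invfM; have : 0 < n.+1%:R^-1 :> R by rewrite invr_gt0.
  by set e := n.+1%:R^-1 => e0; rewrite !ler_norml => /andP[? ?]; have := d0 x; lra.
Qed.

End LipschitzAffine.

(** * The distance to a closed set on the line is almost everywhere locally affine *)

Section Distance.
Context (R : realType).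
Local Notation lm := (@lebesgue_measure R).
Variable A : set R.
Hypotheses (A0 : A !=set0) (cA : closed A).

Lemma dist_to_le x a : A a -> dist_to x A <= `|x - a|.
Proof.
move=> Aa; apply: ge_inf; last by exists a.
by exists 0; apply/lbP => _ [b _ <-]; rewrite /dist1 normr_ge0.
Qed.

Lemma dist_to_ge x m : (forall a, A a -> m <= `|x - a|) -> m <= dist_to x A.
Proof.
move=> h; apply: lb_le_inf; first by have [a Aa] := A0; exists (dist1 x a), a.
by move=> _ [a Aa <-]; exact: h.
Qed.

Lemma dist_to_ge0 x : 0 <= dist_to x A.
Proof. by apply: dist_to_ge. Qed.

Lemma dist_to_lip x y : `|dist_to x A - dist_to y A| <= `|x - y|.
Proof.
have h u v : dist_to u A <= dist_to v A + `|u - v|.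
  rewrite -lerBlDr; apply: dist_to_ge => a Aa; rewrite lerBlDr.
  apply: le_trans (dist_to_le u Aa) _.
  by have := ler_normD (u - v) (v - a); rewrite addrA subrK [X in _ <= X]addrC.
have := h x y; have := h y x; rewrite (distrC y x) => h1 h2.
by rewrite ler_norml; apply/andP; split; lra.
Qed.

Lemma notin_gap (x : R) : ~ A x -> exists2 r, 0 < r & forall a, A a -> r <= `|x - a|.
Proof.
move=> nA; have /nbhs_ballP[r r0 h] : nbhs x (~` A) by apply: open_nbhs_nbhs; split => //; exact: closed_openC.
by exists r => // a Aa; rewrite leNgt; apply/negP => xa; exact: h Aa.
Qed.

Lemma dist_to_gt0 x : ~ A x -> 0 < dist_to x A.
Proof. by move=> /notin_gap[r r0 h]; apply: (lt_le_trans r0); exact: dist_to_ge. Qed.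

Lemma dist_to0 x : A x -> dist_to x A = 0.
Proof.
move=> Ax; apply/le_anti/andP; split; last exact: dist_to_ge0.
by apply: le_trans (dist_to_le x Ax) _; rewrite subrr normr0.
Qed.

(** Were neither point in the closed set [A], both would have neighbourhoods free of [A], and the
    distance would exceed [r]. *)
Lemma nearest x : A (x - dist_to x A) \/ A (x + dist_to x A).
Proof.
set r := dist_to x A; have r0 : 0 <= r by exact: dist_to_ge0.
apply: contrapT => /not_orP[/notin_gap[s s0 hs] /notin_gap[t t0 ht]].
have : Num.min (r + s) (r + t) <= r.
  apply: dist_to_ge => a Aa; have xa := dist_to_le x Aa.
  rewrite ge_min; apply/orP; have := hs _ Aa; have := ht _ Aa; move: xa; rewrite -/r.
  have [ax|xa] := leP a x.
    rewrite (ger0_norm (_ : 0 <= x - a)) ?subr_ge0// => h1 _ h2; left.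
    by move: h2; rewrite ger0_norm; lra.
  rewrite (ltr0_norm (_ : x - a < 0)) ?subr_lt0// => h1 h2 _; right.
  by move: h2; rewrite ler0_norm; lra.
by rewrite ge_min => /orP[]; lra.
Qed.

(** If the nearest point lies on one side only, the mirror point has a neighbourhood of some radius
    [s] free of [A], and the nearest point stays the same for [|y - x| < s / 2]: such a move
    lengthens one distance and shortens the other by less than [s / 2]. *)
Lemma dist_to_affine x : ~ A x -> ~ (A (x - dist_to x A) /\ A (x + dist_to x A)) ->
  exists2 a : R, a \in [:: 1; -1; 0] & affine_near (fun y : R => dist_to y A) x a.
Proof.
set r := dist_to x A => nA nb; have r0 : 0 < r by exact: dist_to_gt0.
have xa a : A a -> r <= `|x - a| by exact: dist_to_le.
have [Al|nAl] := pselect (A (x - r)).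
  have [s s0 hs] := @notin_gap (x + r) (fun h => nb (conj Al h)).
  exists 1; first by rewrite inE eqxx.
  exists (Num.min r (s / 2)); first by rewrite lt_min r0 divr_gt0.
  move=> y; rewrite lt_min !ltr_norml -/r => /andP[/andP[y1 y2] /andP[y3 y4]].
  rewrite mul1r; apply/le_anti/andP; split.
    by apply: le_trans (dist_to_le y Al) _; rewrite ger0_norm; lra.
  apply: dist_to_ge => a Aa; have := xa _ Aa; have := hs _ Aa.
  have [ax|ax] := leP a x.
    by rewrite (ger0_norm (_ : 0 <= x - a)) ?subr_ge0// => _ h; rewrite ger0_norm; lra.
  rewrite (ltr0_norm (_ : x - a < 0)) ?subr_lt0// => h1 h2.
  by move: h1; rewrite ler0_norm; [move=> h1|lra]; rewrite ler0_norm; lra.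
have Ar : A (x + r) by have [] := nearest x.
have [s s0 hs] := notin_gap nAl.
exists (-1); first by rewrite !inE eqxx orbT.
exists (Num.min r (s / 2)); first by rewrite lt_min r0 divr_gt0.
move=> y; rewrite lt_min !ltr_norml -/r => /andP[/andP[y1 y2] /andP[y3 y4]].
rewrite mulN1r; apply/le_anti/andP; split.
  by apply: le_trans (dist_to_le y Ar) _; rewrite ler0_norm; lra.
apply: dist_to_ge => a Aa; have := xa _ Aa; have := hs _ Aa.
have [ax|ax] := leP a x; last first.
  by rewrite (ltr0_norm (_ : x - a < 0)) ?subr_lt0// => _ h; rewrite ler0_norm; lra.
rewrite (ger0_norm (_ : 0 <= x - a)) ?subr_ge0// => h1 h2.
by move: h1; rewrite ger0_norm; [move=> h1|lra]; rewrite ger0_norm; lra.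
Qed.

Lemma ae_neq (x0 : R) : {ae lm, forall x, x <> x0}.
Proof.
exists [set x0]; split; [exact: measurable_set1|exact: lebesgue_measure_set1|].
by move=> x /= h; apply: contrapT => k; exact: h.
Qed.

Definition ridge x := [/\ ~ A x, A (x - dist_to x A) & A (x + dist_to x A)].

Lemma ridge_unique x y s : ridge x -> ridge y ->
  `|s - x| < dist_to x A -> `|s - y| < dist_to y A -> x = y.
Proof.
move=> [_ x1 x2] [_ y1 y2]; set r := dist_to x A in x1 x2 *; set t := dist_to y A in y1 y2 *.
have hx a : A a -> r <= `|x - a| by exact: dist_to_le.
have hy a : A a -> t <= `|y - a| by exact: dist_to_le.
have := (hx _ y1, hx _ y2, hy _ x1, hy _ x2) => -[[[]]].
rewrite !ler_normr !ltr_norml => /orP[] ? /orP[] ? /orP[] ? /orP[] ? /andP[? ?] /andP[? ?]; lra.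
Qed.

(** Ridge points are midpoints of bounded components of the complement of [A]. Each component
    contains a rational, and a rational belongs to one component, so they are countably many. *)
Lemma ae_ridge : {ae lm, forall x, ~ ridge x}.
Proof.
have h : {ae lm, forall x, forall s : rat, ~ (ridge x /\ `|ratr s - x| < dist_to x A)}.
  apply: ae_countable => s.
  have [[x0 [h0 h1]]|no] := pselect (exists x, ridge x /\ `|ratr s - x| < dist_to x A).
    apply: (aeS (ae_neq x0)) => x xx0 [k0 k1]; apply: xx0; exact: (ridge_unique k0 h0 k1 h1).
  by apply: aeW => x hx; apply: no; exists x.
apply: (aeS h) => x hx rx; have [nA _ _] := rx; have r0 := dist_to_gt0 nA.
have [s] := @rat_in_itvoo R (x - dist_to x A) (x + dist_to x A) ltac:(lra).
rewrite in_itv/= => /andP[s1 s2]; apply: (hx s); split => //.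
by rewrite ltr_norml; apply/andP; split; lra.
Qed.

Hypothesis nullA : {ae lm, forall x, ~ A x}.

Definition gap x := dist_to (Num.max 0 x) A.

Lemma ae_affine_gap : ae_affine gap.
Proof.
split.
  move=> x y; apply: le_trans (dist_to_lip _ _) _.
  have [x0|x0] := leP 0 x; have [y0|y0] := leP 0 y; rewrite ?subrr ?normr0//.
    by rewrite subr0 (ger0_norm x0) ger0_norm; lra.
  by rewrite sub0r normrN (ger0_norm y0) ler0_norm; lra.
apply: (aeS3 (ae_neq 0) ae_ridge nullA) => x x0 rx nA.
have [xneg|xge] := ltP x 0.
  exists 0; first by rewrite !inE eqxx !orbT.
  exists (- x); first by rewrite oppr_gt0.
  move=> y; rewrite ltr_norml => /andP[_ yx]; rewrite mul0r addr0 /gap.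
  by rewrite !max_l//; lra.
have xpos : 0 < x by rewrite lt_neqAle xge andbT eq_sym; apply/eqP.
have [a ain [r r0 hr]] := dist_to_affine nA (fun h => rx (And3 nA h.1 h.2)).
exists a => //; exists (Num.min r x); first by rewrite lt_min r0.
move=> y; rewrite lt_min => /andP[yr]; rewrite ltr_norml => /andP[yx _].
by rewrite /gap !max_r//; [exact: hr|lra].
Qed.

End Distance.

Section HausdorffNull.
Context (R : realType).
Local Notation lm := (@lebesgue_measure R).
Local Open Scope ereal_scope.

Lemma diam_ge0 (T : Type) (d : T -> T -> R) U : 0 <= diam d U.
Proof. by apply: ereal_sup_ubound; left. Qed.

Lemma diam_le (T : Type) (d : T -> T -> R) U x y : U x -> U y -> (d x y)%:E <= diam d U.
Proof. by move=> Ux Uy; apply: ereal_sup_ubound; right; exists (x, y). Qed.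

Lemma hausdorff_term1 (T : Type) (d : T -> T -> R) U x : U x -> hausdorff_term d 1 U = diam d U.
Proof.
move=> Ux; rewrite /hausdorff_term asboolF; last by move=> U0; rewrite U0 in Ux.
by rewrite poweRe1// diam_ge0.
Qed.

(** A set of finite diameter [D] lies in an interval of length [2 D] around any of its points, so
    Lebesgue outer measure is at most twice [H^1]. *)
Lemma hausdorff_null (C : set R) : measurable (C : set (measurableTypeR R)) ->
  hausdorff_measure (@dist1 R) 1 C = 0 -> {ae lm, forall x, ~ C x}.
Proof.
move=> mC H; exists C; split => //; last by move=> x /= /contrapT.
apply/le_anti/andP; split; last exact: measure_ge0.
apply/lee_addgt0Pr => e e0; rewrite add0e.
have h1 : hausdorff_premeasure (@dist1 R) 1 1 C <= 0.
  by rewrite -H; apply: ereal_sup_ubound; exists 1%R => //=.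
have h2 : hausdorff_premeasure (@dist1 R) 1 1 C < (e / 2)%:E.
  by apply: le_lt_trans h1 _; rewrite lte_fin divr_gt0.
have [_ [U [CU dU] <-] hU] := ereal_inf_lt h2.
have hJ i : exists J : set (measurableTypeR R), [/\ measurable J, U i `<=` J &
    lm J <= 2%:E * hausdorff_term (@dist1 R) 1 (U i)].
  have [[x Ux]|nU] := pselect (U i !=set0); last first.
    exists set0; split => //; first by move=> x Ux; apply: nU; exists x.
    rewrite measure0 mule_ge0// /hausdorff_term.
    by case: ifP => // _; exact: poweR_ge0.
  have t0 := diam_ge0 (@dist1 R) (U i); have tf : diam (@dist1 R) (U i) \is a fin_num.
    by rewrite ge0_fin_numE//; apply: le_lt_trans (dU i) _; exact: ltry.
  rewrite (hausdorff_term1 _ Ux); move: t0; rewrite -(fineK tf).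
  set D := fine _; rewrite lee_fin => D0.
  exists `[(x - D)%R, (x + D)%R]%classic; split => //.
    move=> y Uy /=; rewrite in_itv/= -ler_distl distrC.
    by have := diam_le (@dist1 R) Ux Uy; rewrite -(fineK tf) lee_fin.
  rewrite lebesgue_measure_itv/=; case: ifP => _; last by rewrite -EFinM lee_fin mulr_ge0.
  by rewrite -EFinB -EFinM lee_fin; lra.
have [J hJ'] := choice hJ.
have mJ i : measurable (J i) by have [] := hJ' i.
apply: (@le_trans _ _ (\sum_(i <oo) lm (J i))).
  apply: measure_sigma_subadditive => //.
  by move=> x /CU[i _ Ux]; exists i => //; have [_ h _] := hJ' i; exact: h.
apply: (@le_trans _ _ (\sum_(i <oo) 2%:E * hausdorff_term (@dist1 R) 1 (U i))).
  by apply: lee_nneseries => [i _ _|i _]; [exact: measure_ge0|have [] := hJ' i].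
rewrite nneseriesZl//; last first.
  by move=> i _; rewrite /hausdorff_term; case: ifP => // _; exact: poweR_ge0.
apply: (@le_trans _ _ (2%:E * (e / 2)%:E)); last by rewrite -EFinM lee_fin mulrC divfK.
by rewrite lee_wpmul2l// ltW.
Qed.

End HausdorffNull.

(** * The extension operator *)

Section Patch.
Context (R : realType).
Local Notation T1 := (measurableTypeR R).
Local Notation mu2 := (mu2 R).
Local Notation e1 := (e1 R).
Local Notation e2 := (e2 R).
Implicit Types (O P : set (R * R)) (u v f : R * R -> R).

Lemma L1_patch P f : measurable (P : set (T1 * T1)) -> L1 mu2 f -> L1 mu2 (f \_ P).
Proof.
move=> mP hf; apply: (L1_le _ hf) => [|x]; last by rewrite patchE; case: ifP; rewrite ?normr0.
by apply/(measurable_restrictT _ _).1 => //; apply: measurable_funTS; exact: (L1_meas hf).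
Qed.

Lemma N1_patch P f : measurable (P : set (T1 * T1)) -> L1 mu2 f -> N1 (f \_ P) <= N1 f.
Proof.
move=> mP hf; apply: le_Int; [by apply: L1_norm; exact: L1_patch|exact: L1_norm|].
by move=> x; rewrite patchE; case: ifP; rewrite ?normr0.
Qed.

Lemma patch_out P f z : ~ P z -> (f \_ P) z = 0.
Proof. by move=> nP; rewrite patchE memNset. Qed.

Lemma patch_in P f z : P z -> (f \_ P) z = f z.
Proof. by move=> Pz; rewrite patchE mem_set. Qed.

Lemma WD_patch O O' P u (g1 g2 : R * R -> R) : measurable (P : set (T1 * T1)) ->
  O' `<=` O -> O' `<=` P -> WD O u g1 g2 -> WD O' (u \_ P) (g1 \_ P) (g2 \_ P).
Proof.
move=> mP OO OP wd; have [a0 a1 a2 w1 w2] := wd.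
split; [exact: L1_patch|exact: L1_patch|exact: L1_patch| |] => phi t;
  have [A [cA AO p0 p1 p2]] := test_supp t; have t' := testS OO t.
  have E (f psi : R * R -> R) : (forall z, ~ A z -> psi z = 0) ->
      (fun z => (f \_ P) z * psi z) = (fun z => f z * psi z).
    move=> h; apply/funext => z; have [Pz|nP] := pselect (P z); first by rewrite patch_in.
    by rewrite h ?mulr0// => /AO/OP.
  by rewrite (E _ _ p1) (E _ _ p0) (w1 _ t').
have E (f psi : R * R -> R) : (forall z, ~ A z -> psi z = 0) ->
    (fun z => (f \_ P) z * psi z) = (fun z => f z * psi z).
  move=> h; apply/funext => z; have [Pz|nP] := pselect (P z); first by rewrite patch_in.
  by rewrite h ?mulr0// => /AO/OP.
by rewrite (E _ _ p2) (E _ _ p0) (w2 _ t').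
Qed.

Lemma vanish_patch P u (g1 g2 : R * R -> R) : vanish (~` P) (u \_ P) (g1 \_ P) (g2 \_ P).
Proof. by move=> z nP; rewrite !patch_out. Qed.

Lemma nrm_patch P u (g1 g2 : R * R -> R) : measurable (P : set (T1 * T1)) ->
  [/\ L1 mu2 u, L1 mu2 g1 & L1 mu2 g2] -> nrm (u \_ P) (g1 \_ P) (g2 \_ P) <= nrm u g1 g2.
Proof. by move=> mP [a0 a1 a2]; rewrite /nrm; apply: lerD; [apply: lerD|]; exact: N1_patch. Qed.

Lemma open_rect (a b c e : R) : open (rect a b c e).
Proof.
rewrite (_ : rect a b c e = `]a, b[%classic `*` `]c, e[%classic); last first.
  by apply/seteqP; split => z /=; rewrite !in_itv.
rewrite openE => -[x y] [/= hx hy]; exists (`]a, b[%classic, `]c, e[%classic) => //.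
by split; apply: open_nbhs_nbhs; split => //; exact: interval_open.
Qed.

Lemma open_layer (I : set R) (F : R -> R) B : open I -> continuous F -> open (layer I F B).
Proof.
move=> oI cF.
rewrite (_ : layer I F B = (fst @^-1` I) `&` ([set z | 0 < z.2 - F z.1] `&` (snd @^-1` [set y | y < B]))).
  apply: openI; first by apply: open_comp => // z _; exact: cvg_fst.
  apply: openI; last by apply: open_comp; [move=> z _; exact: cvg_snd|exact: open_lt].
  apply: (@open_comp _ _ (fun z : R * R => z.2 - F z.1) [set y | 0 < y]); last exact: open_gt.
  move=> z _; apply: cvgB; first exact: cvg_snd.
  by apply: (@continuous_comp _ _ _ fst F); [exact: cvg_fst|exact: cF].
by apply/seteqP; split => z /=; rewrite ?subr_gt0; [move=> []|move=> [? []]].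
Qed.

End Patch.

(** * Gluing the extensions over the slit domain *)

Section Assembly.
Context (R : realType).
Local Notation T1 := (measurableTypeR R).
Local Notation lm := (@lebesgue_measure R).
Local Notation mu2 := (mu2 R).
Implicit Types (O P : set (R * R)) (u v f : R * R -> R).
Variables (C : set R) (c : R).
Hypotheses (cC : closed C) (Cc : C c) (c0 : 0 < c) (c1 : c < 1).
Hypothesis nullC : {ae lm, forall x, ~ C x}.

Let C0 : C !=set0. Proof. by exists c. Qed.
(** The added point makes [dgap] vanish for all [x < 0], so the columns of the left half are treated
    together with those over [C]. As [dgap <= Fgap], the reflected part ends above the axis. *)
Let C' := C `|` [set 0].
Let C'0 : C' !=set0. Proof. by exists c; left. Qed.
Let cC' : closed C'. Proof. by apply: closedU => //; exact: closed1. Qed.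
Let nullC' : {ae lm, forall x, ~ C' x}.
Proof. by apply: (aeS2 nullC (ae_neq 0)) => x h1 h2 []. Qed.

Definition Fgap := gap C.
Definition dgap := gap C'.
Let I := [set x : R | -1 < x < 1].
Let oI : open I.
Proof.
rewrite (_ : I = `]-1, 1[%classic); first exact: interval_open.
by apply/seteqP; split => x /=; rewrite in_itv.
Qed.

Lemma Fgap_ge0 x : 0 <= Fgap x. Proof. exact: dist_to_ge0. Qed.
Lemma dgap_ge0 x : 0 <= dgap x. Proof. exact: dist_to_ge0. Qed.
Lemma dgap_le x : dgap x <= Fgap x.
Proof. by apply: dist_to_ge => // a Ca; apply: dist_to_le; left. Qed.

Lemma dgap_le0 x : dgap x <= 0 -> x < 0 \/ C' x.
Proof.
move=> h; have h0 : C' (Num.max 0 x).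
  apply: contrapT => n; have := dist_to_gt0 C'0 cC' n; rewrite -/(gap C' x) -/(dgap x).
  by rewrite ltNge h.
move: h0; have [x0|x0] := leP 0 x; first by right.
by left.
Qed.

Lemma dgap_neg x : x < 0 -> dgap x <= 0.
Proof. by move=> x0; rewrite /dgap /gap (max_l (ltW x0)) dist_to0//; right. Qed.

(** One point of [C] inside []0, 1[] keeps the graph at a positive distance from the upper side of
    the square, which leaves room for the partition of unity. *)
Let B' := Num.max c (1 - c).
Let B'1 : B' < 1. Proof. by have := c0; rewrite gt_max c1/=; lra. Qed.
Let FB x : I x -> Fgap x <= B'.
Proof.
move=> /andP[x1 x2]; apply: le_trans (dist_to_le _ Cc) _.
have c0' := c0; have c1' := c1; rewrite /B' le_max !ler_norml; have [x0|x0] := leP 0 x; last first.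
  by apply/orP; left; apply/andP; split; lra.
by have [xc|cx] := leP x c; apply/orP; [left|right]; apply/andP; split; lra.
Qed.

Let Op := layer I Fgap 1.
Let L := rect (-1) 0 (-1) (1 : R).

Lemma Op_left z : Op z -> z.1 < 0 -> L z.
Proof.
move=> [/andP[h1 h2] h3 h4] h5; have := Fgap_ge0 z.1 => h6.
by split; [rewrite h1|apply/andP; split; lra].
Qed.

(** The reflection requires a function that is zero on every column with [dgap = 0]. Redefining [w]
    as zero there alters it only over the null set [C'], because for [x < 0] it vanishes already. *)
Lemma half_extension : exists2 K, 0 <= K & forall w (g1 g2 : R * R -> R),
  WD Op w g1 g2 -> vanish L w g1 g2 ->
  exists v h1 h2, [/\ WD [set z | I z.1] v h1 h2, {ae mu2, forall z, Op z -> v z = w z},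
    forall z, z.2 < 0 -> v z = 0, forall z, z.1 < 0 -> v z = 0 &
    nrm v h1 h2 <= K * nrm w g1 g2].
Proof.
have [M G] := ae_affine_graph_like oI (ae_affine_gap C0 cC nullC) (ae_affine_gap C'0 cC' nullC') dgap_ge0.
have [_ cF cd _ _] := G.
have [K K0 ext] := layer_extension G B'1 FB.
exists K => // w g1 g2 wd van.
have oO : open Op by exact: open_layer.
have mO := open2_measurable oO.
pose P := Op `&` [set z | 0 < dgap z.1].
have oP : open P.
  apply: openI => //; apply: (@open_comp _ _ (fun z : R * R => dgap z.1) [set y | 0 < y]); last exact: open_gt.
  by move=> z _; apply: (@continuous_comp _ _ _ fst dgap); [exact: cvg_fst|exact: cd].
have mP := open2_measurable oP.
have wO := WD_patch mO (@subset_refl _ Op) (@subset_refl _ Op) wd.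
have [a0 a1 a2] := WD_L1 wd.
have aeP (f : R * R -> R) : (forall z, L z -> f z = 0) -> {ae mu2, forall z, (f \_ Op) z = (f \_ P) z}.
  move=> f0; apply: (aeS (ae_fstP nullC')) => z nC.
  have [Oz|nO] := pselect (Op z); last by rewrite !patch_out// => -[].
  have [dz|dz] := ltP 0 (dgap z.1); first by rewrite !patch_in.
  rewrite patch_in// patch_out; last by move=> [_ /=]; rewrite ltNge dz.
  by apply: f0; apply: Op_left => //; case: (dgap_le0 dz).
have [wP nP] : WD Op (w \_ P) (g1 \_ P) (g2 \_ P) /\ nrm (w \_ P) (g1 \_ P) (g2 \_ P) = nrm (w \_ Op) (g1 \_ Op) (g2 \_ Op).
  apply: (WD_ae wO); [exact: L1_meas (L1_patch mP a0)|exact: L1_meas (L1_patch mP a1)|exact: L1_meas (L1_patch mP a2)|].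
  apply: (aeS3 (aeP w (fun z h => let: And3 e _ _ := van z h in e))
    (aeP g1 (fun z h => let: And3 _ e _ := van z h in e))
    (aeP g2 (fun z h => let: And3 _ _ e := van z h in e))) => z e0 e1' e2'.
  by split.
have [||v [h1 [h2 [W A V Fb bd]]]] := ext _ _ _ wP.
- by move=> z nO; rewrite !patch_out// => -[].
- by move=> z /= dz; rewrite !patch_out// => -[_ /=]; rewrite ltNge dz.
exists v, h1, h2; split => //.
- apply: (aeS (aeP w (fun z h => let: And3 e _ _ := van z h in e))) => z e Oz.
  by have [-> _ _] := A z Oz; rewrite -e patch_in.
- by move=> z z2; have [] := V z _ => //=; have := dgap_le z.1; lra.
- move=> z z1; have [] := Fb z.1 _ z => // y /= yz; rewrite !patch_out// => -[_ /=];
    by rewrite yz ltNge dgap_neg.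
- apply: le_trans bd _; rewrite nP ler_wpM2l//; exact: nrm_patch.
Qed.

(** The lower side is the upper side of the flipped problem. Both extensions exist over the strip
    []-1, 1[] in [x]; their sum is restricted to the square and extended from there, and the
    extension of the left half is added back at the end. *)
Lemma Omega2_extension : exists2 K, 0 <= K & forall u (g1 g2 : R * R -> R),
  WD (Omega2 C) u g1 g2 ->
  exists v h1 h2, [/\ WD setT v h1 h2, {ae mu2, forall z, Omega2 C z -> v z = u z} &
    nrm v h1 h2 <= K * nrm u g1 g2].
Proof.
have n10 : -1 < 0 :> R by lra. have n11 : -1 < 1 :> R by lra.
have [K1 K10 extL] := rect_extension n10 n11.
have [K2 K20 extQ] := rect_extension n11 n11.
have [K3 K30 half] := half_extension.
exists (K1 + K2 * (K3 * (1 + K1) + K3 * (1 + K1))).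
  by rewrite !(addr_ge0, mulr_ge0).
move=> u g1 g2 wd; have l := WD_L1 wd.
have LO : L `<=` Omega2 C.
  move=> z [/andP[a1 a2] /andP[a3 a4]]; split; first by split; rewrite /= in_itv/= ?a3 ?a4// a1/=; lra.
  by move=> /= [_ /andP[]]; lra.
have OpO : Op `<=` Omega2 C.
  move=> z [/andP[a1 a2] a3 a4]; have F0 := Fgap_ge0 z.1; split.
    by split; rewrite /= in_itv/= ?a1 ?a4 ?andbT//; lra.
  move=> /= [h /andP[x0 _]]; move: h a3; rewrite /Fgap /gap max_r// ler_norml => /andP[_ ?]; lra.
have OmF : Op `<=` @flp R @^-1` (Omega2 C).
  move=> z [/andP[a1 a2] a3 a4]; have F0 := Fgap_ge0 z.1.
  suff : Omega2 C (flp z) by [].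
  rewrite flpE; split.
    by split; rewrite /= in_itv/= ?a1//; apply/andP; split; lra.
  move=> /= [h /andP[x0 _]]; move: h a3; rewrite /Fgap /gap max_r// normrN ler_norml => /andP[_ ?]; lra.
have mL := open2_measurable (@open_rect R (-1) 0 (-1) 1).
have mQ := open2_measurable (@open_rect R (-1) 1 (-1) 1).
have [vL [hL1 [hL2 [WL AL bL]]]] := extL _ _ _ (WD_patch mL LO (@subset_refl _ L) wd) (@vanish_patch _ L u g1 g2).
have bL' : nrm vL hL1 hL2 <= K1 * nrm u g1 g2.
  by apply: le_trans bL _; rewrite ler_wpM2l//; exact: nrm_patch.
(* The remainder vanishes on [L]; this is the hypothesis of [half_extension] for [w] and for its
   flip. *)
pose w z := u z + - vL z; pose k1 z := g1 z + - hL1 z; pose k2 z := g2 z + - hL2 z.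
have Ww : WD (Omega2 C) w k1 k2 by apply: WDD => //; apply: WDN; exact: (WDS (@subsetT _ _) WL).
have lw := WD_L1 Ww.
have bw : nrm w k1 k2 <= (1 + K1) * nrm u g1 g2.
  apply: le_trans (nrmD l (WD_L1 (WDN WL))) _.
  by rewrite mulrDl mul1r lerD2l nrmN.
have wL : vanish L w k1 k2.
  move=> z Lz; rewrite /w /k1 /k2; have [-> -> ->] := AL z Lz.
  by rewrite !patch_in// !subrr.
have wfL : vanish L (fun z => w (flp z)) (fun z => k1 (flp z)) (fun z => - k2 (flp z)).
  move=> z [/andP[a1 a2] /andP[a3 a4]]; have [|-> -> ->] := wL (flp z); last by rewrite oppr0.
  by rewrite flpE; split; apply/andP; split => //=; lra.
have [vp [p1 [p2 [Wp Ap Vp Np bp]]]] := half _ _ _ (WDS OpO Ww) wL.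
have [vm [m1 [m2 [Wm Am Vm Nm bm]]]] := half _ _ _ (WDS OmF (WD_flp Ww)) wfL.
rewrite (nrm_flp lw) in bm.
have Wm' : WD [set z | I z.1] (fun z => vm (flp z)) (fun z => m1 (flp z)) (fun z => - m2 (flp z)).
  by apply: (WDS _ (WD_flp Wm)) => z Iz; suff : [set z | I z.1] (flp z) by []; rewrite flpE.
have Ws := WDD Wp Wm'; have ls := WD_L1 Ws.
set s := (fun z => vp z + vm (flp z)) in Ws ls.
set s1 := (fun z => p1 z + m1 (flp z)) in Ws ls.
set s2 := (fun z => p2 z + - m2 (flp z)) in Ws ls.
have bs : nrm s s1 s2 <= (K3 * (1 + K1) + K3 * (1 + K1)) * nrm u g1 g2.
  apply: le_trans (nrmD (WD_L1 Wp) (WD_L1 Wm')) _; rewrite (nrm_flp (WD_L1 Wm)) mulrDl -!mulrA.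
  apply: lerD; [apply: le_trans bp _|apply: le_trans bm _]; by rewrite ler_wpM2l.
have QI : rect (-1) 1 (-1) 1 `<=` [set z | I z.1] by move=> z [].
have [e [ee1 [ee2 [We Ae be]]]] := extQ _ _ _ (WD_patch mQ QI (@subset_refl _ _) Ws) (@vanish_patch _ _ s s1 s2).
exists (fun z => vL z + e z), (fun z => hL1 z + ee1 z), (fun z => hL2 z + ee2 z); split.
- exact: WDD WL We.
(* The flip preserves null sets, so the almost everywhere equality for [vm] may be read at
   [flp z]. *)
- have Am' : {ae mu2, forall z, Op (flp z) -> vm (flp z) = w z}.
    have [N [mN N0 AN]] := Am.
    exists (@flp R @^-1` N); split.
    + have mf : measurable_fun setT (@flp R : T1 * T1 -> T1 * T1) by apply: measurable_refl; exact: measurable_cst.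
      by rewrite -[_ @^-1` _]setTI; exact: mf.
    + by rewrite -[RHS]N0; apply: refl_mu2 => //; exact: measurable_cst.
    + move=> z /= nz; apply: AN => /= h; apply: nz => Oz.
      by rewrite h// flpK.
  apply: (aeS2 Ap Am') => z hp hm Oz; have [[/= q1 q2] nz] := Oz.
  move: q1 q2; rewrite !in_itv/= => q1 q2.
  have [-> _ _] := Ae z (conj q1 q2); rewrite patch_in; last by split.
  (* Left of 0 both half extensions vanish and [vL] equals [u]. On the right exactly one of them is
     [u - vL], and the other vanishes since it lives on the opposite side of the axis. *)
  rewrite /s; have [zneg|zpos] := ltP z.1 0.
    rewrite Np// Nm ?flpE//= !addr0.
    have Lz : L z by split => //; move: q1 => /andP[-> _].
    by have [-> _ _] := AL z Lz; rewrite patch_in.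
  have zF : Fgap z.1 < `|z.2|.
    rewrite ltNge; apply/negP => h; apply: nz => /=; rewrite zpos; move: q1 => /andP[_ /ltW->].
    by split => //; move: h; rewrite /Fgap /gap max_r.
  have F0 := Fgap_ge0 z.1.
  have [y0|y0] := leP 0 z.2.
    rewrite ger0_norm// in zF.
    rewrite hp; last by split => //; case/andP: q2.
    by rewrite Vm ?flpE/= ?oppr_lt0; [rewrite /w; ring|lra].
  rewrite ltr0_norm// in zF.
  rewrite (Vp z y0) hm; first by rewrite /w; ring.
  by rewrite flpE; split => //=; move: q2 => /andP[? ?]; lra.
- apply: le_trans (nrmD (WD_L1 WL) (WD_L1 We)) _.
  rewrite mulrDl; apply: lerD => //; apply: le_trans be _.
  rewrite -mulrA ler_wpM2l//; apply: le_trans _ bs; exact: nrm_patch.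
Qed.

End Assembly.

(** * Uniqueness of weak gradients *)

Section WeakGradientUniqueness.
Context (R : realType).
Local Notation T1 := (measurableTypeR R).
Local Notation lm := (@lebesgue_measure R).
Local Notation mu2 := (mu2 R).
Implicit Types (O P : set (R * R)) (u v f phi : R * R -> R).

Definition box (N : R) := rect (- N) N (- N) N.

Lemma test_plateau (p q p' q' : R) n m :
  test_function setT (fun z => plateau p q n z.1 * plateau p' q' m z.2).
Proof.
apply: (@test_intro _ _ (`[p, q] `*` `[p', q'])) => //.
- by apply: Sm_mul; [apply: (Sm_comp1 (smooth1_plateau _ _ _)); exact: Sm_fst|
    apply: (Sm_comp1 (smooth1_plateau _ _ _)); exact: Sm_snd].
- by apply: compact_setX; exact: segment_compact.
- move=> z nz; have [h1|h1] := boolP (p <= z.1 <= q); last first.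
    rewrite plateau_supp ?mul0r//; move: h1; rewrite negb_and -!ltNge => /orP[]/ltW; auto.
  have [h2|h2] := boolP (p' <= z.2 <= q'); last first.
    rewrite (@plateau_supp _ p') ?mulr0//; move: h2; rewrite negb_and -!ltNge => /orP[]/ltW; auto.
  by exfalso; apply: nz; split; rewrite /= in_itv.
Qed.

(** Products of rational plateaus suffice. [FL1] in [x], for each of the countably many plateaus in
    [y], leaves one null set of columns; on the other columns [FL1] is applied in [y]. *)
Lemma box_ae0 f N : measurable_fun setT (f : T1 * T1 -> R) -> L1 mu2 (f \_ (box N)) ->
  (forall phi, test_function setT phi -> Int mu2 (fun z => f z * phi z) = 0) ->
  {ae mu2, forall z, (f \_ (box N)) z = 0}.
Proof.
move=> mf hf h; set g := f \_ (box N) in hf *.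
pose J := [set x : R | - N < x < N].
have oJ : open J.
  rewrite (_ : J = `]- N, N[%classic); first exact: interval_open.
  by apply/seteqP; split => x /=; rewrite in_itv.
have gout z : ~ J z.1 \/ ~ J z.2 -> g z = 0.
  by move=> nz; rewrite /g patch_out// => -[h1 h2]; case: nz.
have gE (p q p' q' : R) n m : `[p, q] `<=` J -> `[p', q'] `<=` J -> forall z,
    f z * (plateau p q n z.1 * plateau p' q' m z.2) = g z * (plateau p q n z.1 * plateau p' q' m z.2).
  move=> pJ qJ z; have [bz|nbz] := pselect (box N z); first by rewrite /g patch_in.
  have [h1|h1] := boolP (p <= z.1 <= q); last first.
    rewrite plateau_supp ?mul0r ?mulr0//; move: h1; rewrite negb_and -!ltNge => /orP[]/ltW; auto.
  have [h2|h2] := boolP (p' <= z.2 <= q'); last first.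
    rewrite (@plateau_supp _ p') ?mulr0//; move: h2; rewrite negb_and -!ltNge => /orP[]/ltW; auto.
  exfalso; apply: nbz; split; [apply: (pJ z.1)|apply: (qJ z.2)]; by rewrite /= in_itv.
apply: fiber_ae0; first exact: L1_meas hf.
have mpl (p q : R) n : measurable_fun setT ((fun z => plateau p q n z.2) : T1 * T1 -> R).
  have c := smooth1_continuous (smooth1_plateau p q n).
  exact: (measurableT_comp (continuous_measurable_fun c) measurable_snd).
have mpl1 (p q : R) n : measurable_fun setT ((fun z => plateau p q n z.1) : T1 * T1 -> R).
  exact: measurable_fst1 (smooth1_continuous (smooth1_plateau p q n)).
have L2 (p' q' : R) m : L1 mu2 (fun z => g z * plateau p' q' m z.2).
  apply: (L1_mul (K := 1) hf (mpl p' q' m)) => z; exact: plateau_le1.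
have key : {ae lm, forall x, forall k : rat * rat * nat,
    J x -> `[ratr k.1.1, ratr k.1.2] `<=` J -> Int lm (fun y => g (x, y) * plateau (ratr k.1.1) (ratr k.1.2) k.2 y) = 0}.
  apply: ae_countable => -[[p' q'] m] /=.
  have [qJ|nqJ] := pselect (`[ratr p', ratr q'] `<=` J); last by apply: aeW.
  apply: (aeS (FL1 oJ (L1_marg (L2 (ratr p') (ratr q') m)) _)); last by move=> x hx Jx _; exact: hx.
  move=> p q pJ n.
  have := h _ (test_plateau (ratr p) (ratr q) (ratr p') (ratr q') n m).
  have L3 : L1 mu2 (fun z => g z * plateau (ratr p') (ratr q') m z.2 * plateau (ratr p) (ratr q) n z.1).
    by apply: (L1_mul (K := 1) (L2 _ _ _) (mpl1 _ _ _)) => z; exact: plateau_le1.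
  have -> : (fun z => f z * (plateau (ratr p) (ratr q) n z.1 * plateau (ratr p') (ratr q') m z.2)) =
     (fun z => g z * plateau (ratr p') (ratr q') m z.2 * plateau (ratr p) (ratr q) n z.1).
    by apply/funext => z; rewrite gE//; ring.
  rewrite (Int2 L3) => E; rewrite -[RHS]E.
  apply: Int_ae.
  - apply: measurable_funM; first exact: L1_meas (L1_marg (L2 _ _ _)).
    exact: continuous_measurable_fun (smooth1_continuous (smooth1_plateau _ _ _)).
  - exact: L1_meas (L1_marg L3).
  apply: (aeS (L1_fiber (L2 (ratr p') (ratr q') m))) => x hx /=.
  rewrite mulrC -(IntZ _ hx); congr Int; apply/funext => y; rewrite /=; ring.
apply: (aeS2 key (L1_fiber hf)) => x hx fx.
have [Jx|nJ] := pselect (J x); last by apply: aeW => y; apply: gout; left.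
have := FL1 oJ fx (fun p q pq n => hx (p, q, n) Jx pq).
move=> hy; apply: (aeS hy) => y hJ; have [Jy|nJ] := pselect (J y); first exact: hJ.
by apply: gout; right.
Qed.

Lemma weak_ae0 f : measurable_fun setT (f : T1 * T1 -> R) ->
  (forall N : nat, L1 mu2 (f \_ (box N%:R))) ->
  (forall phi, test_function setT phi -> Int mu2 (fun z => f z * phi z) = 0) ->
  {ae mu2, forall z, f z = 0}.
Proof.
move=> mf hf h.
have H : {ae mu2, forall z, forall N : nat, (f \_ (box N%:R)) z = 0}.
  by apply: ae_countable => N; exact: box_ae0.
apply: (aeS H) => z hz; pose x := `|z.1| + `|z.2|.
have x0 : 0 <= x by rewrite addr_ge0.
have := hz (Num.bound x); have := archi_boundP x0; set N := (Num.bound x)%:R => xN.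
rewrite patch_in//; have a1 := normr_ge0 z.1; have a2 := normr_ge0 z.2.
by split; rewrite -ltr_norml; move: xN; rewrite /x; lra.
Qed.

End WeakGradientUniqueness.

(** * From integrable weak gradients to the Sobolev norms *)

Section SobolevSpace.
Context (R : realType).
Local Notation T1 := (measurableTypeR R).
Local Notation lm := (@lebesgue_measure R).
Local Notation mu2 := (mu2 R).
Local Notation e1 := (e1 R).
Local Notation e2 := (e2 R).
Implicit Types (O P : set (R * R)) (u v f phi : R * R -> R).

Lemma enorm_ge (z : R * R) : `|z.1| <= enorm z /\ `|z.2| <= enorm z.
Proof.
by rewrite /enorm; split; rewrite -sqrtr_sqr ler_wsqrtr// ?lerDl ?lerDr sqr_ge0.
Qed.

Lemma enorm_le (z : R * R) : enorm z <= `|z.1| + `|z.2|.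
Proof.
rewrite /enorm -[leRHS]ger0_norm ?addr_ge0// -sqrtr_sqr ler_wsqrtr// sqrrD.
have h : 0 <= `|z.1| * `|z.2| by rewrite mulr_ge0.
by rewrite !real_normK ?num_real//; lra.
Qed.

Lemma enorm_ge0 (z : R * R) : 0 <= enorm z.
Proof. exact: sqrtr_ge0. Qed.

Lemma measurable_enorm (f g : R * R -> R) : measurable_fun setT (f : T1 * T1 -> R) ->
  measurable_fun setT (g : T1 * T1 -> R) -> measurable_fun setT ((fun z => enorm (f z, g z)) : T1 * T1 -> R).
Proof.
move=> mf mg; rewrite /enorm/=.
have ms : measurable_fun setT (@Num.sqrt R : T1 -> R) by apply: continuous_measurable_fun; exact: sqrt_continuous.
apply: (measurableT_comp ms).
by apply: measurable_funD; exact: measurable_funX.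
Qed.

Lemma Lp_norm1 O u : Lp_norm 1 O u = (\int[mu2]_z (`|(u \_ O) z|)%:E)%E.
Proof. by rewrite /Lp_norm Lnorm1. Qed.

Lemma Lp_norm_fin O u : measurable (O : set (T1 * T1)) -> loc_integrable O u ->
  (Lp_norm 1 O u < +oo)%E -> L1 mu2 (u \_ O) /\ Lp_norm 1 O u = (N1 (u \_ O))%:E.
Proof.
move=> mO [mu' _]; rewrite Lp_norm1 => fin.
have mu : measurable_fun setT (u \_ O : T1 * T1 -> R) by apply/(measurable_restrictT _ _).1.
have L : L1 mu2 (u \_ O).
  by apply/integrableP; split => //; exact/measurable_EFinP.
by split => //; rewrite EInt//; exact: L1_norm.
Qed.

Lemma weak_partial_Int O (v : R * R) u (g : R * R -> R) : measurable (O : set (T1 * T1)) -> weak_partial O v u g ->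
  forall phi, test_function O phi ->
  Int mu2 (fun z => (u \_ O) z * 'D_v phi z) = - Int mu2 (fun z => (g \_ O) z * phi z).
Proof.
move=> mO h phi t; have := h _ t.
have E (f psi : R * R -> R) : (\int[mu2]_(z in O) (f z * psi z)%:E = \int[mu2]_z ((f \_ O) z * psi z)%:E)%E.
  rewrite [LHS]integral_mkcond; apply: eq_integral => z _; rewrite !patchE.
  by case: ifP => //; rewrite mul0r.
by rewrite !E => /(congr1 fine); rewrite fineN.
Qed.

(** The factor 2 compares norms: each component of the gradient is bounded by its Euclidean
    length. *)
Lemma W1p_WD O u : open O -> W1p 1 O u -> exists g1 g2 : R * R -> R,
  WD O (u \_ O) g1 g2 /\ ((nrm (u \_ O) g1 g2)%:E <= 2%:E * W1p_norm 1 O u)%E.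
Proof.
move=> oO [lu eG]; have mO := open2_measurable oO; rewrite /W1p_norm.
have : is_weak_gradient O u (weak_gradient O u) by exact: (xgetPex _ eG).
set G := weak_gradient O u => -[l1 l2 w1 w2] fin.
have [m1 _] := l1; have [m2 _] := l2.
have ge0 (f : R * R -> R) : (0 <= Lp_norm 1 O f)%E by exact: Lnorm_ge0.
have [fu fG] : (Lp_norm 1 O u < +oo)%E /\ (Lp_norm 1 O (@enorm R \o G) < +oo)%E.
  by split; apply: le_lt_trans fin; [rewrite leeDl|rewrite leeDr].
have [Lu Eu] := Lp_norm_fin mO lu fu.
have sm (f : R * R -> R) : measurable_fun (O : set (T1 * T1)) f -> measurable_fun setT (f \_ O : T1 * T1 -> R).
  by move=> mf; apply/(measurable_restrictT _ _).1.
have EG : ((@enorm R \o G) \_ O) = (fun z => enorm (((fst \o G) \_ O) z, ((snd \o G) \_ O) z)).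
  apply/funext => z; rewrite !patchE; case: ifP => _ /=; first by rewrite -surjective_pairing.
  by rewrite /enorm/= expr0n/= addr0 sqrtr0.
have Lg : L1 mu2 ((@enorm R \o G) \_ O).
  apply/integrableP; split; last by move: fG; rewrite Lp_norm1.
  by apply/measurable_EFinP; rewrite EG; apply: measurable_enorm; exact: sm.
have EGn : Lp_norm 1 O (@enorm R \o G) = (N1 ((@enorm R \o G) \_ O))%:E.
  by rewrite Lp_norm1 EInt//; exact: L1_norm.
have b1 z : `|((fst \o G) \_ O) z| <= 1 * `|((@enorm R \o G) \_ O) z|.
  by rewrite mul1r !patchE; case: ifP => _ //=; rewrite [leRHS]ger0_norm ?enorm_ge0//; have [] := enorm_ge (G z).
have b2 z : `|((snd \o G) \_ O) z| <= 1 * `|((@enorm R \o G) \_ O) z|.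
  by rewrite mul1r !patchE; case: ifP => _ //=; rewrite [leRHS]ger0_norm ?enorm_ge0//; have [] := enorm_ge (G z).
have L1' : L1 mu2 ((fst \o G) \_ O).
  by apply: (L1_le (sm _ m1) Lg) => z; have := b1 z; rewrite mul1r.
have L2' : L1 mu2 ((snd \o G) \_ O).
  by apply: (L1_le (sm _ m2) Lg) => z; have := b2 z; rewrite mul1r.
exists ((fst \o G) \_ O), ((snd \o G) \_ O); split.
  by split => //; exact: weak_partial_Int.
rewrite Eu EGn -EFinD -EFinM lee_fin /nrm.
have := (N1_le L1' Lg b1, N1_le L2' Lg b2, N1_ge0 (u \_ O)) => -[[]]; rewrite !mul1r; lra.
Qed.

Lemma loc_integrable_test u phi : loc_integrable setT u -> test_function setT phi ->
  L1 mu2 (fun z => u z * phi z).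
Proof.
move=> [mu' lu] t; have [A [cA _ A0 _ _]] := test_supp t.
have mA := compact2_measurable cA.
have [K _ hK] := test_bounded t; have [mp _ _] := measurable_test t.
have LA : L1 mu2 (u \_ A).
  by have := lu A (@subsetT _ _) cA; rewrite (integrable_mkcond _ mA) restrict_EFin.
have := L1_mul (K := K) LA mp (fun z => let: And3 h _ _ := hK z in h).
congr (L1 _ _); apply/funext => z; have [Az|nA] := pselect (A z); first by rewrite patch_in.
by rewrite A0// !mulr0.
Qed.

(** The Sobolev norm is computed with a chosen weak gradient, of which only local integrability is
    known. Its difference to [h] integrates to zero against every test function, and [weak_ae0]
    applies. *)
Lemma weak_partial_unique (v : R * R) u (g h : R * R -> R) : loc_integrable setT g -> L1 mu2 h ->
  L1 mu2 u -> v = e1 \/ v = e2 -> weak_partial setT v u g ->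
  (forall phi, test_function setT phi -> Int mu2 (fun z => u z * 'D_v phi z) = - Int mu2 (fun z => h z * phi z)) ->
  {ae mu2, forall z, g z = h z}.
Proof.
move=> lg hh hu ve wg wh; have [mg ig] := lg.
have H : {ae mu2, forall z, g z - h z = 0}.
  apply: weak_ae0.
  - by apply: measurable_funB => //; exact: L1_meas hh.
  - move=> N; pose B := [set z : R * R | `|z.1| <= N%:R /\ `|z.2| <= N%:R].
    have cB : compact B by exact: box_compact.
    have mB := compact2_measurable cB.
    have Bb : box N%:R `<=` B.
      by move=> z [/andP[? ?] /andP[? ?]]; split; rewrite ler_norml; apply/andP; split; apply/ltW.
    have LB : L1 mu2 (g \_ B).
      by have := ig B (@subsetT _ _) cB; rewrite (integrable_mkcond _ mB) restrict_EFin.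
    have mb : measurable (box N%:R : set (T1 * T1)) by apply: open2_measurable; exact: open_rect.
    have := L1B (L1_patch mb LB) (L1_patch mb hh); congr (L1 _ _); apply/funext => z.
    have [bz|nb] := pselect (box N%:R z); last by rewrite !patch_out// subr0.
    by rewrite !patch_in//; exact: Bb.
  - move=> phi t; have Lg := loc_integrable_test lg t; have [Lh _ _] := L1_test t hh.
    transitivity (Int mu2 (fun z => g z * phi z - h z * phi z)).
      by congr Int; apply/funext => z; rewrite mulrBl.
    rewrite (IntB Lg Lh); have := wh _ t; have := wg _ t.
    have Lu : L1 mu2 (fun z => u z * 'D_v phi z).
      by have [_ h1 h2] := L1_test t hu; case: ve => ->.
    rewrite (EInt Lu) (EInt Lg) => -[->] /oppr_inj ->; exact: subrr.
by apply: (aeS H) => z /eqP; rewrite subr_eq0 => /eqP.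
Qed.

Lemma WD_W1p v (h1 h2 : R * R -> R) : WD setT v h1 h2 ->
  W1p 1 setT v /\ (W1p_norm 1 setT v <= (nrm v h1 h2)%:E)%E.
Proof.
move=> [Lv L1h L2h w1 w2].
have loc (f : R * R -> R) : L1 mu2 f -> loc_integrable setT f.
  move=> hf; split; first exact: L1_meas hf.
  by move=> K _ cK; apply: integrableS hf => //; exact: compact2_measurable.
have wp (e : R * R) (h : R * R -> R) : e = e1 \/ e = e2 -> L1 mu2 h ->
    (forall phi, test_function setT phi -> Int mu2 (fun z => v z * 'D_e phi z) = - Int mu2 (fun z => h z * phi z)) ->
    weak_partial setT e v h.
  move=> ee hh w phi t; have [Lh _ _] := L1_test t hh; have [_ A1 A2] := L1_test t Lv.
  have Lu : L1 mu2 (fun z => v z * 'D_e phi z) by case: ee => ->.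
  by rewrite (EInt Lu) (EInt Lh) (w _ t).
have ex : is_weak_gradient setT v (fun z => (h1 z, h2 z)).
  by split; [exact: loc|exact: loc|apply: wp => //; left|apply: wp => //; right].
have eG : exists G, is_weak_gradient setT v G by exists (fun z => (h1 z, h2 z)).
have : is_weak_gradient setT v (weak_gradient setT v) by exact: (xgetPex _ eG).
set G := weak_gradient setT v => -[l1 l2 p1 p2].
have q1 := weak_partial_unique l1 L1h Lv (or_introl erefl) p1 w1.
have q2 := weak_partial_unique l2 L2h Lv (or_intror erefl) p2 w2.
have mG : measurable_fun setT ((@enorm R \o G) : T1 * T1 -> R).
  have -> : @enorm R \o G = fun z => enorm ((fst \o G) z, (snd \o G) z).
    by apply/funext => z; rewrite /= -surjective_pairing.
  by case: l1 l2 => [? _] [? _]; exact: measurable_enorm.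
have bG : {ae mu2, forall z, `|enorm (G z)| <= `|h1 z| + `|h2 z|}.
  apply: (aeS2 q1 q2) => z e1' e2'; rewrite ger0_norm ?enorm_ge0//.
  by apply: le_trans (enorm_le _) _; move: e1' e2' => /= -> ->.
have Lhh := L1D (L1_norm L1h) (L1_norm L2h).
have LG : L1 mu2 (@enorm R \o G).
  apply: (L1_ae_le mG Lhh); apply: (aeS bG) => z h.
  by apply: le_trans h _; exact: ler_norm.
have N : (W1p_norm 1 setT v <= (nrm v h1 h2)%:E)%E.
  rewrite /W1p_norm !Lp_norm1 -/G !patch_setT.
  rewrite (EInt (L1_norm Lv)) (EInt (L1_norm LG)) -EFinD lee_fin /nrm -addrA lerD2l.
  rewrite /N1 -(IntD (L1_norm L1h) (L1_norm L2h)); apply: ae_le_Int => //; exact: L1_norm.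
split => //; split; [exact: loc|exact: eG|exact: le_lt_trans N (ltry _)].
Qed.

(** The operator chooses an element of the set [S u] of admissible extensions. This set depends only
    on the class of [u], so equal classes get the very same extension. The constant [1 + 2 K] is at
    least 1 and contains the loss 2 of [W1p_WD]. *)
Lemma extension_domain O K : open O -> O !=set0 -> connected O -> 0 <= K ->
  (forall u (g1 g2 : R * R -> R), WD O u g1 g2 -> exists v h1 h2,
    [/\ WD setT v h1 h2, {ae mu2, forall z, O z -> v z = u z} & nrm v h1 h2 <= K * nrm u g1 g2]) ->
  W1p_extension_domain 1%E O.
Proof.
move=> oO O0 cO K0 ext; split => //; have mO := open2_measurable oO.
pose C := 1 + K * 2.
pose S u := [set v | [/\ W1p 1 setT v, v = u %[ae mu2 in O] & (W1p_norm 1 setT v <= C%:E * W1p_norm 1 O u)%E]].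
exists C, (fun u => xget (cst 0) (S u)); split; first by rewrite /C lerDl mulr_ge0.
split.
  move=> u hu; suff : S u (xget (cst 0) (S u)) by [].
  apply: xgetPex; have [g1 [g2 [W b]]] := W1p_WD oO hu.
  have [v [h1 [h2 [Wv ev bv]]]] := ext _ _ _ W.
  have [Wv' bv'] := WD_W1p Wv; exists v; split => //.
    by apply: (aeS ev) => z h Oz; rewrite h// patch_in.
  apply: le_trans bv' _; apply: (@le_trans _ _ (K%:E * (2%:E * W1p_norm 1 O u))%E).
    apply: (@le_trans _ _ (K * nrm (u \_ O) g1 g2)%:E); first by rewrite lee_fin.
    by rewrite EFinM lee_wpmul2l// lee_fin.
  rewrite muleA -EFinM; apply: lee_wpmul2r; last by rewrite lee_fin /C lerDr.
  by rewrite /W1p_norm adde_ge0//; exact: Lnorm_ge0.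
move=> u v [[mu _] _ _] [[mv _] _ _] uv.
suff -> : S u = S v by apply: aeW.
have half (a b : R * R -> R) (e : R * R) g : measurable_fun (O : set (T1 * T1)) a ->
    measurable_fun (O : set (T1 * T1)) b -> a = b %[ae mu2 in O] -> e = e1 \/ e = e2 ->
    weak_partial O e a g -> weak_partial O e b g.
  move=> ma mb ab ee w phi t; rewrite -(w _ t).
  have [_ d1 d2] := measurable_test t.
  have md : measurable_fun (O : set (T1 * T1)) ('D_e phi) by apply: measurable_funTS; case: ee => ->.
  apply: ae_eq_integral => //.
  - by apply/measurable_EFinP; exact: measurable_funM.
  - by apply/measurable_EFinP; exact: measurable_funM.
  - by apply: (aeS ab) => z h Oz; rewrite h.
(* Weak gradients are defined by integrals over [O], so [u] and [v] have the same ones, and the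
   choice of [weak_gradient] is the same for both. *)
have G : is_weak_gradient O u = is_weak_gradient O v.
  have vu : v = u %[ae mu2 in O] by apply: (aeS uv) => z h Oz; rewrite h.
  apply/funext => g; apply/propext; split => -[l1 l2 w1 w2]; split => //.
  - by apply: half w1 => //; left.
  - by apply: half w2 => //; right.
  - by apply: half w1 => //; left.
  - by apply: half w2 => //; right.
have N : W1p_norm 1 O u = W1p_norm 1 O v.
  rewrite /W1p_norm /weak_gradient G; congr (_ + _)%E; rewrite !Lp_norm1.
  have mp (f : R * R -> R) : measurable_fun (O : set (T1 * T1)) f -> measurable_fun setT ((fun z => (`|(f \_ O) z|)%:E) : T1 * T1 -> \bar R).
    move=> mf; apply/measurable_EFinP; apply: measurableT_comp => //.
    exact/(measurable_restrictT _ _).1.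
  apply: ae_eq_integral => //; [exact: mp|exact: mp|].
  apply: (aeS uv) => z h _; rewrite !patchE; case: ifPn => // /set_mem Oz; by rewrite h.
have vu : v = u %[ae mu2 in O] by apply: (aeS uv) => z h Oz; rewrite h.
have tr (w a b : R * R -> R) : w = a %[ae mu2 in O] -> a = b %[ae mu2 in O] -> w = b %[ae mu2 in O].
  by move=> wa ab; apply: (aeS2 wa ab) => z h1 h2 Oz; rewrite (h1 Oz) (h2 Oz).
apply/seteqP; split => w [a b c].
  by split; [exact: a|exact: tr b uv|rewrite -N].
by split; [exact: a|exact: tr b vu|rewrite N].
Qed.

End SobolevSpace.

(** * The slit square is a domain *)

Section Domain.
Context (R : realType).
Implicit Types (A : set (R * R)).

Lemma connected_curve A (f : R -> R * R) (a b : R) : continuous f ->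
  (forall s, Num.min a b <= s -> s <= Num.max a b -> A (f s)) -> connected_component A (f a) (f b).
Proof.
move=> cf h; exists (f @` `[Num.min a b, Num.max a b]); last first.
  by exists b => //=; rewrite in_itv/= ge_min le_max !lexx !orbT.
split.
- by exists a => //=; rewrite in_itv/= ge_min le_max !lexx.
- by move=> _ [s /= + <-]; rewrite in_itv/= => /andP[]; exact: h.
- apply: connected_continuous_connected; first exact: segment_connected.
  exact: continuous_subspaceT.
Qed.

Lemma connected_vseg A (x y y' : R) :
  (forall s, y <= s \/ y' <= s -> s <= y \/ s <= y' -> A (x, s)) ->
  connected_component A (x, y) (x, y').
Proof.
move=> h; apply: (@connected_curve _ (fun s => (x, s))).
  by move=> s; exact: (cvg_pair (cvg_cst _) cvg_id).
by move=> s; rewrite ge_min le_max => /orP h1 /orP h2; exact: h.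
Qed.

Lemma connected_hseg A (x x' y : R) :
  (forall s, x <= s \/ x' <= s -> s <= x \/ s <= x' -> A (s, y)) ->
  connected_component A (x, y) (x', y).
Proof.
move=> h; apply: (@connected_curve _ (fun s => (s, y))).
  by move=> s; exact: (cvg_pair cvg_id (cvg_cst _)).
by move=> s; rewrite ge_min le_max => /orP h1 /orP h2; exact: h.
Qed.

Variables (C : set R) (c : R).
Hypotheses (cC : closed C) (Cc : C c) (c0 : 0 < c) (c1 : c < 1).

Let C0 : C !=set0. Proof. by exists c. Qed.

Lemma Omega2P (z : R * R) : Omega2 C z <->
  [/\ -1 < z.1 < 1, -1 < z.2 < 1 & z.1 < 0 \/ dist_to z.1 C < `|z.2|].
Proof.
split.
  move=> [[]]; rewrite /= !in_itv/= => h1 h2 h3; split => //.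
  have [z0|z0] := ltP z.1 0; [by left|right]; rewrite ltNge; apply/negP => h; apply: h3; split => //.
  by rewrite z0; move: h1 => /andP[_ /ltW].
move=> [h1 h2 h3]; split; first by split; rewrite /= in_itv.
move=> [h /andP[a b]]; case: h3; first by rewrite ltNge a.
by rewrite ltNge h.
Qed.

Lemma continuous_dist_to : continuous (fun x : R => dist_to x C).
Proof. exact: (lip_continuous (lexx 1) (dist_to_lip C0)). Qed.

Lemma open_Omega2 : open (Omega2 C).
Proof.
have cd := continuous_dist_to.
rewrite (_ : Omega2 C = rect (-1) 1 (-1) 1 `&` ([set z | z.1 < 0] `|` [set z | 0 < `|z.2| - dist_to z.1 C])); last first.
  apply/seteqP; split => z.
    by move=> /Omega2P[h1 h2 h3]; split => //; case: h3 => ?; [left|right]; rewrite /= ?subr_gt0.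
  move=> [[h1 h2]] h3; apply/Omega2P; split => //.
  by case: h3 => /= h3; [left|right; rewrite -subr_gt0].
apply: openI; first exact: open_rect.
apply: openU; first by apply: (@open_comp _ _ fst [set x : R | x < 0]); [move=> z _; exact: cvg_fst|exact: open_lt].
apply: (@open_comp _ _ (fun z : R * R => `|z.2| - dist_to z.1 C) [set y : R | 0 < y]); last exact: open_gt.
move=> z _; apply: cvgB.
  by apply: (@cvg_norm _ _ _ _ _ snd); exact: cvg_snd.
by apply: (@continuous_comp _ _ _ fst (fun x => dist_to x C)); [exact: cvg_fst|exact: cd].
Qed.

Let b := Num.max c (1 - c).
Let b01 : 0 < b /\ b < 1.
Proof.
have c0' := c0; have c1' := c1.
by split; [rewrite lt_max c0|rewrite gt_max c1/=; lra].
Qed.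

Lemma dist_to_bound x : 0 <= x -> x < 1 -> dist_to x C <= b.
Proof.
move=> x0 x1; apply: le_trans (dist_to_le x Cc) _.
rewrite /b le_max !ler_norml; have c0' := c0; have c1' := c1.
by have [xc|cx] := leP x c; apply/orP; [left|right]; apply/andP; split; lra.
Qed.

Lemma connected_Omega2 : connected (Omega2 C).
Proof.
have [b0 b1] := b01.
have h x y : -1 < x < 1 -> -1 < y < 1 -> x < 0 \/ dist_to x C < `|y| -> Omega2 C (x, y).
  by move=> h1 h2 h3; apply/Omega2P.
have d0 x : 0 <= dist_to x C by exact: dist_to_ge0.
pose p : R * R := (- (1 / 2), 0).
have Op : Omega2 C p by apply: h; [apply/andP; split; lra|apply/andP; split; lra|left; lra].
suff H z : Omega2 C z -> connected_component (Omega2 C) z p.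
  rewrite (_ : Omega2 C = connected_component (Omega2 C) p); first exact: component_connected.
  apply/seteqP; split; last exact: connected_component_sub.
  by move=> z /H /connected_component_sym.
move=> /Omega2P; case: z => x y /= [h1 h2 h3].
(* The last two moves. The horizontal one stays in the domain because it runs either at a height
   beyond [b] or entirely over [x < 0]. *)
have S k : -1 < k < 1 -> x < 0 \/ b < `|k| -> connected_component (Omega2 C) (x, k) p.
  move=> k1 xk; apply: (@connected_component_trans (R * R)%type _ (- (1 / 2), k)).
    apply: connected_hseg => s s1 s2; apply: h => //.
      by move: h1 s1 s2 => /andP[? ?] [?|?] [?|?]; apply/andP; split; lra.
    case: xk => [x0|kb]; first by left; case: s2 => ?; lra.
    have [sneg|spos] := ltP s 0; [by left|right]; apply: le_lt_trans kb.
    apply: dist_to_bound => //; move: h1 s1 s2 => /andP[? ?] [?|?] [?|?]; lra.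
  apply: connected_vseg => s s1 s2; apply: h; [by apply/andP; split; lra| |by left; lra].
  by move: k1 s1 s2 => /andP[? ?] [?|?] [?|?]; apply/andP; split; lra.
have [xneg|xpos] := ltP x 0; first by apply: S => //; left.
have {}h3 : dist_to x C < `|y| by case: h3 => // ?; lra.
have b' : b < (1 + b) / 2 < 1 by apply/andP; split; lra.
move: (h1) => /andP[xm1 x1].
have dx := d0 x.
have [y0|y0] := leP 0 y.
  rewrite ger0_norm// in h3.
  apply: (@connected_component_trans (R * R)%type _ (x, Num.max y ((1 + b) / 2))).
    apply: connected_vseg => s s1 s2.
    have ys : y <= s by case: s1 => //; apply: le_trans; rewrite le_max lexx.
    have s1' : s < 1.
      case: s2 => [sy|]; first by apply: le_lt_trans sy _; case/andP: h2.
      by move=> hs; apply: le_lt_trans hs _; rewrite gt_max; move: h2 b' => /andP[_ ->] /andP[_ ->].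
    apply: h => //; first by apply/andP; split; lra.
    by right; apply: lt_le_trans h3 _; apply: le_trans ys _; exact: ler_norm.
  have m1 : (1 + b) / 2 <= Num.max y ((1 + b) / 2) by rewrite le_max lexx orbT.
  have m2 : Num.max y ((1 + b) / 2) < 1 by rewrite gt_max; move: h2 b' => /andP[_ ->] /andP[_ ->].
  move: b' => /andP[b'1 b'2]; apply: S; first by apply/andP; split => //; lra.
  by right; apply: lt_le_trans b'1 _; apply: le_trans m1 _; exact: ler_norm.
rewrite ltr0_norm// in h3.
apply: (@connected_component_trans (R * R)%type _ (x, - Num.max (- y) ((1 + b) / 2))).
  apply: connected_vseg => s s1 s2.
  have ys : - y <= - s by rewrite lerN2; case: s2 => // h4; apply: le_trans h4 _; rewrite lerNl le_max lexx.
  have s1' : - s < 1.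
    case: s1 => [sy|]; first by move: h2 => /andP[? ?]; lra.
    rewrite lerNl => hs; apply: le_lt_trans hs _; rewrite gt_max; move: b' => /andP[_ ->]; rewrite andbT.
    by move: h2 => /andP[? ?]; lra.
  apply: h => //; first by apply/andP; split; lra.
  by right; apply: lt_le_trans h3 _; apply: le_trans ys _; rewrite -normrN; exact: ler_norm.
have m1 : (1 + b) / 2 <= Num.max (- y) ((1 + b) / 2) by rewrite le_max lexx orbT.
have m2 : Num.max (- y) ((1 + b) / 2) < 1.
  by rewrite gt_max; move: b' => /andP[_ ->]; rewrite andbT; move: h2 => /andP[? ?]; lra.
move: b' => /andP[b'1 b'2]; apply: S; first by apply/andP; split; lra.
by right; rewrite normrN; apply: lt_le_trans b'1 _; apply: le_trans m1 _; exact: ler_norm.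
Qed.

Lemma Omega2_neq0 : Omega2 C !=set0.
Proof.
exists (- (1 / 2), 0); apply/Omega2P.
by split => /=; [apply/andP; split; lra|apply/andP; split; lra|left; lra].
Qed.

End Domain.

Lemma Omega2_extension_domain (R : realType) (C : set R) (c : R) : closed C ->
  {ae @lebesgue_measure R, forall x, ~ C x} -> C c -> 0 < c -> c < 1 ->
  W1p_extension_domain 1%E (Omega2 C).
Proof.
move=> cC nC Cc c0 c1; have [K K0 h] := Omega2_extension cC Cc c0 c1 nC.
apply: (extension_domain (K := K)) => //.
- exact: open_Omega2 Cc.
- exact: Omega2_neq0.
- exact: connected_Omega2 Cc c0 c1.
Qed.

Lemma cantor_interior_point (R : realType) (C : set R) : C `<=` `[0, 1] -> cantor_set C ->
  closed C /\ exists c, [/\ C c, 0 < c & c < 1].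
Proof.
move=> C01 [[a Ca] _ [cC lC] _]; split => //.
have : limit_point C a by rewrite lC.
(* Radius 1: if [a] is an endpoint of [[0, 1]], a different point of [C] at distance less than 1 can
   be neither endpoint. *)
move=> /(_ _ (nbhsx_ballx a 1 ltr01)) [y [ya Cy]]; rewrite /ball/= => d.
have := C01 _ Ca; have := C01 _ Cy; rewrite /= !in_itv/= => /andP[y0 y1] /andP[a0 a1].
have [aa|naa] := boolP ((0 < a) && (a < 1)); first by exists a; move: aa => /andP[].
exists y; split => //.
  rewrite lt_neqAle y0 andbT eq_sym; apply/eqP => y00; move: naa d ya; rewrite y00 subr0 (ger0_norm a0).
  rewrite negb_and -!leNgt => /orP[]; last by lra.
  by move=> h h1 /eqP; apply; apply/le_anti; rewrite h a0.
rewrite lt_neqAle y1 andbT; apply/eqP => y00; move: naa d ya; rewrite y00 (ler0_norm (_ : a - 1 <= 0)); last by lra.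
rewrite negb_and -!leNgt => /orP[]; first by lra.
by move=> h h1 /eqP; apply; apply/le_anti; rewrite h a1.
Qed.

(** * Hausdorff dimension of the two-sided points *)

Section Cover.
Context (R : realType).
Local Open Scope ereal_scope.

Lemma hausdorff_term_ge0 (T : Type) (d : T -> T -> R) s U : 0 <= hausdorff_term d s U.
Proof. by rewrite /hausdorff_term; case: ifP => // _; exact: poweR_ge0. Qed.

Definition cover_le (T : Type) (d : T -> T -> R) (s delta e : R) (A : set T) :=
  exists2 U, hausdorff_cover d delta A U & \sum_(i <oo) hausdorff_term d s (U i) <= e%:E.

(** The vanishing of the Hausdorff measure in terms of single covers, so that sets can be added one
    by one without suprema and infima. *)
Definition null_cover (T : Type) (d : T -> T -> R) (s : R) (A : set T) :=
  forall delta e : R, (0 < delta)%R -> (0 < e)%R -> cover_le d s delta e A.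

Section OneMetric.
Context (T : Type) (d : T -> T -> R) (s : R).
Implicit Types A B V : set T.

Lemma null_cover_measure A : null_cover d s A -> hausdorff_measure d s A = 0.
Proof.
move=> h; have ge0 delta : 0 <= hausdorff_premeasure d s delta A.
  apply: le_ereal_inf_tmp => _ [U _ <-].
  by apply: nneseries_ge0 => i _ _; exact: hausdorff_term_ge0.
apply/le_anti/andP; split; last first.
  by apply: le_trans (ge0 1%R) _; apply: ereal_sup_ubound; exists 1%R => /=.
apply: ge_ereal_sup => _ [delta /= d0 <-]; apply/lee_addgt0Pr => e e0; rewrite add0e.
have [U cU sU] := h _ _ d0 e0; apply: le_trans sU.
by apply: ereal_inf_lbound; exists U.
Qed.

Lemma measure_null_cover A : hausdorff_measure d s A = 0 -> null_cover d s A.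
Proof.
move=> H delta e d0 e0.
have h1 : hausdorff_premeasure d s delta A <= 0.
  by rewrite -H; apply: ereal_sup_ubound; exists delta.
have h2 : hausdorff_premeasure d s delta A < e%:E by apply: le_lt_trans h1 _; rewrite lte_fin.
have [_ [U cU <-] hU] := ereal_inf_lt h2.
by exists U => //; exact: ltW.
Qed.

Lemma cover_leS delta e e' A B : A `<=` B -> (e <= e')%R -> cover_le d s delta e B -> cover_le d s delta e' A.
Proof.
move=> AB ee [U [BU dU] sU]; exists U; first by split => //; exact: subset_trans AB BU.
by apply: le_trans sU _; rewrite lee_fin.
Qed.

Lemma cover_le0 delta : (0 <= delta)%R -> cover_le d s delta 0 set0.
Proof.
move=> d0; exists (fun=> set0).
  split; first by move=> x.
  move=> i; apply: ge_ereal_sup => _ [->|[z [] //]]; by rewrite lee_fin.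
by rewrite eseries0// => i _ _; rewrite /hausdorff_term asboolT.
Qed.

Lemma cover_le_cons delta e a A V : cover_le d s delta e A -> diam d V <= delta%:E ->
  hausdorff_term d s V <= a%:E -> cover_le d s delta (e + a) (A `|` V).
Proof.
move=> [U [AU dU] sU] dV tV; exists (fun i => if i is j.+1 then U j else V).
  split; last by case.
  by move=> x [/AU[i _ Ux]|Vx]; [exists i.+1|exists 0%N].
have t0 i : 0 <= hausdorff_term d s (if i is j.+1 then U j else V) by exact: hausdorff_term_ge0.
rewrite nneseries_recl//= -(nneseries_addn 1)//.
rewrite EFinD addeC; apply: leeD => //; apply: le_trans sU.
by under eq_eseriesr do rewrite addn1.
Qed.

Lemma cover_le_bigcup delta e a A (V : nat -> set T) n : cover_le d s delta e A ->
  (forall k, (k < n)%N -> diam d (V k) <= delta%:E) ->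
  (forall k, (k < n)%N -> hausdorff_term d s (V k) <= a%:E) ->
  cover_le d s delta (e + a *+ n) (A `|` \bigcup_(k in [set k | (k < n)%N]) V k).
Proof.
move=> cA; elim: n => [|n IH] h1 h2.
  by apply: cover_leS cA; [move=> x [//|[k /=]]|rewrite mulr0n addr0].
have c := IH (fun k kn => h1 k (leqW kn)) (fun k kn => h2 k (leqW kn)).
apply: cover_leS (cover_le_cons c (h1 n (ltnSn n)) (h2 n (ltnSn n))); last first.
  by rewrite mulrSr addrA.
move=> x [Ax|[k /= kn Vx]]; first by left; left.
move: kn; rewrite ltnS leq_eqVlt => /orP[/eqP kn|kn]; first by right; rewrite -kn.
by left; right; exists k.
Qed.

End OneMetric.

Lemma diam_preimage (T S : Type) (dT : T -> T -> R) (dS : S -> S -> R) (f : S -> T) U :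
  (forall x y, dS x y <= dT (f x) (f y))%R -> diam dS (f @^-1` U) <= diam dT U.
Proof.
move=> h; apply: ge_ereal_sup => _ [->|[[x y] [/= Ux Uy] <-]]; first exact: diam_ge0.
by apply: le_trans (diam_le dT Ux Uy); rewrite lee_fin.
Qed.

(** Since [f] does not shrink distances, preimages of the cover have no larger diameter. Empty
    preimages are treated apart, because an empty set contributes 0 by convention even if
    [s = 0]. *)
Lemma null_cover_preimage (T S : Type) (dT : T -> T -> R) (dS : S -> S -> R) (f : S -> T) s A B :
  (0 <= s)%R -> (forall x y, dS x y <= dT (f x) (f y))%R -> A `<=` f @^-1` B ->
  null_cover dT s B -> null_cover dS s A.
Proof.
move=> s0 h AB nB delta e d0 e0; have [U [BU dU] sU] := nB _ _ d0 e0.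
exists (fun i => f @^-1` (U i)).
  split; first by move=> x /AB /BU[i _ Ux]; exists i.
  by move=> i; apply: le_trans (dU i); exact: diam_preimage.
apply: le_trans sU; apply: lee_nneseries => [i _ _|i _]; first exact: hausdorff_term_ge0.
rewrite {1}/hausdorff_term; case: ifPn => [_|/asboolPn n0]; first exact: hausdorff_term_ge0.
have n1 : U i <> set0 by move=> U0; apply: n0; rewrite U0 preimage_set0.
rewrite /hausdorff_term asboolF//; apply: gt0_ler_poweR => //.
- by rewrite in_itv/= diam_ge0 leey.
- by rewrite in_itv/= diam_ge0 leey.
- exact: diam_preimage.
Qed.

Lemma null_cover_point (T : Type) (d : T -> T -> R) s A p : (0 < s)%R -> d p p = 0%R ->
  null_cover d s A -> null_cover d s (A `|` [set p]).
Proof.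
move=> s0 dp nA delta e d0 e0.
have D : diam d [set p] = 0.
  apply/le_anti/andP; split; last exact: diam_ge0.
  by apply: ge_ereal_sup => _ [->//|[[x y] [/= -> ->] <-]]; rewrite dp.
rewrite -(addr0 e); apply: cover_le_cons; first exact: nA.
- by rewrite D lee_fin ltW.
- rewrite /hausdorff_term D; case: ifP => // _.
  by rewrite poweR0r// gt_eqF.
Qed.

(** About [m] pieces of diameter at most [4 / m] cover the curve, and their sum [m (4 / m)^s] tends
    to 0 for [s > 1]. *)
Lemma null_cover_curve (T : Type) (d : T -> T -> R) (f : R -> T) s A : (1 < s)%R ->
  (forall x y, d (f x) (f y) <= 2 * `|x - y|)%R ->
  null_cover d s A -> null_cover d s (A `|` f @` `[(-1)%R, 1%R]).
Proof.
move=> s1 lf nA delta e d0 e0.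
(* With [4 / m <= r] each term is at most [(4 / m) (e / 16)]; at most [2 m] pieces give [e / 2], and
   the other half of [e] covers [A]. *)
pose r := Num.min delta ((e / 16) `^ (s - 1)^-1)%R.
have e16 : (0 < e / 16)%R by rewrite divr_gt0.
have r0 : (0 < r)%R by rewrite lt_min d0 powR_gt0.
pose n := Num.bound (4 / r)%R; pose m := n.+1%:R : R.
have m0 : (0 < m)%R by rewrite ltr0n.
have rm : (4 / m <= r)%R.
  rewrite ler_pdivrMr// mulrC -ler_pdivrMr//; apply: (@le_trans _ _ n%:R); last by rewrite ler_nat.
  by apply/ltW/archi_boundP; rewrite divr_ge0// ltW.
pose V k := f @` `[(-1 + 2 * k%:R / m)%R, (-1 + 2 * k.+1%:R / m)%R].
have q0 : (0 < 4 / m)%R by rewrite divr_gt0.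
have dV k : diam d (V k) <= (4 / m)%:E.
  apply: ge_ereal_sup => _ [->|[[x y] [/= [a ha <-] [b hb <-]] <-]]; first by rewrite lee_fin ltW.
  rewrite lee_fin; apply: le_trans (lf a b) _.
  rewrite (_ : 4 / m = 2 * (2 / m))%R; last by ring.
  have E : (2 * k.+1%:R / m = 2 * k%:R / m + 2 / m)%R by rewrite -(addn1 k) natrD; ring.
  rewrite ler_wpM2l//; move: ha hb; rewrite /= !in_itv/= E.
  move: (2 * k%:R / m)%R (2 / m)%R => p q /andP[? ?] /andP[? ?].
  by rewrite ler_norml; apply/andP; split; lra.
have tV k : hausdorff_term d s (V k) <= ((4 / m) * (e / 16))%:E.
  rewrite /hausdorff_term; case: ifP => _; first by rewrite lee_fin mulr_ge0// ltW.
  apply: (@le_trans _ _ ((4 / m)%:E `^ s)).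
    apply: gt0_ler_poweR => //; first by lra.
    - by rewrite in_itv/= diam_ge0 leey.
    - by rewrite in_itv/= lee_fin leey andbT ltW.
  rewrite poweR_EFin lee_fin -mulr_powRB1; [|exact: ltW|by lra].
  apply: ler_wpM2l; first exact: ltW.
  apply: (@le_trans _ _ (((e / 16) `^ (s - 1)^-1) `^ (s - 1))%R).
    apply: ge0_ler_powR; [by lra|by rewrite nnegrE ltW|by rewrite nnegrE powR_ge0|].
    by apply: le_trans rm _; rewrite /r ge_min lexx orbT.
  by rewrite -powRrM mulVf ?powRr1// ?ltW//; rewrite subr_eq0 gt_eqF.
have c := cover_le_bigcup (nA delta (e / 2)%R d0 ltac:(by rewrite divr_gt0))
  (fun k (_ : (k < n.+2)%N) => le_trans (dV k) _) (fun k (_ : (k < n.+2)%N) => tV k).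
apply: cover_leS (c _).
- move=> x [Ax|[t /= ht <-]]; [by left|right].
  move: ht; rewrite in_itv/= => /andP[t1 t2].
  pose z := ((t + 1) * m / 2)%R; have z0 : (0 <= z)%R by apply: divr_ge0 => //; apply: mulr_ge0; [lra|exact: ltW].
  have := Num.Theory.trunc_itv z0; set k := Num.Def.trunc z => /andP[k1 k2].
  have tz : (t = -1 + 2 * z / m)%R by rewrite /z; field; rewrite gt_eqF.
  (* The endpoint [t = 1] has index [m = n + 1], which is why [n + 2] pieces are taken. *)
  exists k.
    rewrite /= ltnS -(ler_nat R); apply: le_trans k1 _; rewrite /z ler_pdivrMr// -/m.
    by rewrite mulrC ler_wpM2l ?(ltW m0)//; lra.
  exists t => //=; rewrite in_itv/= tz !lerD2l !ler_pM2r ?invr_gt0// !ler_pM2l// k1.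
  exact: ltW.
- rewrite -[X in (_ + X)%R]mulr_natr.
  have : (n.+2%:R <= 2 * m)%R by rewrite /m -natrM ler_nat mul2n -addnn addSn ltnS leq_addl.
  move=> h; have : (4 / m * (e / 16) * n.+2%:R <= 4 / m * (e / 16) * (2 * m))%R.
    by rewrite ler_wpM2l// mulr_ge0// ltW.
  have -> : (4 / m * (e / 16) * (2 * m) = e / 2)%R by field; rewrite gt_eqF.
  by move: (_ * n.+2%:R)%R => X hX; lra.
- by rewrite lee_fin; apply: le_trans rm _; rewrite /r ge_min lexx.
Qed.

End Cover.

(** * Two-sided points of the slit square *)

Section TwoSidedPoints.
Context (R : realType).
Variables (C : set R) (c : R).
Hypotheses (cC : closed C) (Cc : C c) (c0 : 0 < c) (c1 : c < 1) (C01 : C `<=` `[0, 1]).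

Let C0 : C !=set0. Proof. by exists c. Qed.

Lemma dist2_le (z w : R * R) : dist2 z w <= `|z.1 - w.1| + `|z.2 - w.2|.
Proof. exact: (enorm_le (z - w)). Qed.

Lemma dist2_ge (z w : R * R) : `|z.1 - w.1| <= dist2 z w /\ `|z.2 - w.2| <= dist2 z w.
Proof. exact: (enorm_ge (z - w)). Qed.

(** The two components are those of the points at height [r / 2] above and below [x]. A connected
    set containing both meets the axis, by the intermediate value theorem for the second coordinate,
    but near [(x, 0)] the domain has no point on the axis. *)
Lemma Omega2_axis x : C x -> 0 < x -> x < 1 -> two_sided (Omega2 C) (x, 0).
Proof.
move=> Cx x0 x1.
have dx : dist_to x C = 0 by exact: dist_to0.
have inO k : k != 0 -> `|k| < 1 -> Omega2 C (x, k).
  move=> k0 k1; apply/(Omega2P C); split => /=.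
  - by apply/andP; split; lra.
  - by rewrite -ltr_norml.
  - by right; rewrite dx normr_gt0.
have nO : ~ Omega2 C (x, 0).
  by move=> /(Omega2P C)[_ _] /= [|]; [lra|rewrite dx normr0 ltxx].
split.
  split; last by move=> /interior_subset.
  move=> B /nbhs_boxP[r r0 rB].
  have k0 : 0 < Num.min r 1 by rewrite lt_min r0 ltr01.
  have k1 : Num.min r 1 <= r /\ Num.min r 1 <= 1 by rewrite !ge_min !lexx orbT.
  pose k := Num.min r 1 / 2; exists (x, k); split.
    apply: inO; first by rewrite gt_eqF// divr_gt0.
    by rewrite gtr0_norm ?divr_gt0// /k; lra.
  by apply: rB; rewrite ?subrr ?normr0// sub0r normrN gtr0_norm ?divr_gt0// /k; lra.
(* Keeps the ball away from [x <= 0], where the axis belongs to the domain, and inside the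
   square. *)
pose r0 := Num.min x (1 - x).
have r00 : 0 < r0 by rewrite lt_min x0/=; lra.
have r0x : r0 <= x /\ r0 <= 1 - x by rewrite /r0 !ge_min !lexx orbT.
pose A r := Omega2 C `&` eball (x, 0) r.
have inA r k : r < r0 -> k != 0 -> `|k| < r -> A r (x, k).
  move=> rr k0 kr; split; first by apply: inO => //; lra.
  apply: le_lt_trans (dist2_le _ _) _; rewrite /= subrr normr0 add0r sub0r normrN; lra.
have AS s r : s <= r -> A s `<=` A r by move=> sr z [? zs]; split => //; exact: lt_le_trans zs sr.
have compS s r z : s <= r -> connected_component (A s) z `<=` connected_component (A r) z.
  by move=> sr w [B [Bz BA cB] Bw]; exists B => //; split => //; exact: subset_trans (AS _ _ sr).
exists r0 => //.
exists (fun r => connected_component (A r) (x, r / 2)), (fun r => connected_component (A r) (x, - (r / 2))).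
have half r : 0 < r -> r < r0 -> A r (x, r / 2) /\ A r (x, - (r / 2)).
  move=> rp rr; have h : 0 < r / 2 by rewrite divr_gt0.
  by split; apply: inA; rewrite ?oppr_eq0 ?gt_eqF// ?normrN gtr0_norm//; lra.
split.
  move=> r /andP[rp rr]; have [h1 h2] := half _ rp rr; split.
  - by exists (x, r / 2).
  - by exists (x, - (r / 2)).
  - apply/seteqP; split => // w [w1 w2].
    have [B [Bp BA cB] Bm] := connected_component_trans w1 (connected_component_sym w2).
    have : connected (snd @` B).
      apply: connected_continuous_connected => //; apply: continuous_subspaceT => z; exact: cvg_snd.
    move=> /connected_intervalP iB.
    have /iB : (snd @` B) (- (r / 2)) by exists (x, - (r / 2)).
    have Bp' : (snd @` B) (r / 2) by exists (x, r / 2).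
    move=> /(_ _ Bp' 0) []; first by apply/andP; split; lra.
    move=> z Bz z0; have [/(Omega2P C)[_ _ h3] zb] := BA _ Bz.
    have [b1 _] := dist2_ge (x, 0) z; have {}zb : dist2 (x, 0) z < r by exact: zb.
    have : `|x - z.1| < r by exact: le_lt_trans b1 zb.
    rewrite ltr_norml => /andP[? ?].
    case: h3 => [|]; first by case: r0x; lra.
    by rewrite z0 normr0 ltNge dist_to_ge0.
move=> s r sp sr rr; have sr' := ltW sr.
have kk (k : R) : s / 2 <= k \/ r / 2 <= k -> k <= s / 2 \/ k <= r / 2 -> 0 < k /\ k < r.
  by move=> [?|?] [?|?]; split; lra.
(* Nestedness: the base points at heights [s / 2] and [r / 2] are joined along the column over [x],
   which is free off the axis since [x] is in [C]. *)
split => w /(compS _ _ _ sr') hw; apply: connected_component_trans hw; apply: connected_vseg.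
  move=> k k1 k2; have [k3 k4] : 0 < k /\ k < r by apply: kk; [case: k1; auto|case: k2; auto].
  by apply: inA => //; rewrite ?gt_eqF// gtr0_norm.
move=> k k1 k2; have [k3 k4] : 0 < - k /\ - k < r.
  by apply: kk; [case: k2 => ?; [right|left]; lra|case: k1 => ?; [right|left]; lra].
by apply: inA => //; [rewrite -oppr_eq0 gt_eqF|rewrite -normrN gtr0_norm].
Qed.

Lemma dist_to_curve (sg x y : R) : `|sg| = 1 ->
  dist2 (x, sg * dist_to x C) (y, sg * dist_to y C) <= 2 * `|x - y|.
Proof.
move=> s1; apply: le_trans (dist2_le _ _) _; rewrite /= -mulrBr normrM s1 mul1r.
by have := dist_to_lip C0 x y; lra.
Qed.

(** An upper bound suffices for the dimension, so the whole segment [x = 0] is listed instead of the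
    left edge of the slit. The nesting from [set0] matches the curves being added one at a time. *)
Lemma Omega2_boundary : boundary (Omega2 C) `<=`
  ((((((set0 `|` (fun t => (t, 1)) @` `[-1, 1]) `|` (fun t => (t, -1)) @` `[-1, 1]) `|`
  (fun t => (1, t)) @` `[-1, 1]) `|` (fun t => (-1, t)) @` `[-1, 1]) `|`
  (fun t => (0, t)) @` `[-1, 1]) `|` (fun t => (t, 1 * dist_to t C)) @` `[-1, 1]) `|`
  (fun t => (t, -1 * dist_to t C)) @` `[-1, 1].
Proof.
move=> z [cz nz]; have cd := continuous_dist_to Cc.
have nO : ~ Omega2 C z.
  by move=> Oz; apply: nz; apply: open_nbhs_nbhs; split => //; exact: open_Omega2 Cc.
have meet B : open B -> B z -> Omega2 C `&` B !=set0.
  by move=> oB Bz; apply: cz; exact: open_nbhs_nbhs.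
have cl (f : R * R -> R) : continuous f -> (forall w, Omega2 C w -> 0 <= f w) -> 0 <= f z.
  move=> cf h; rewrite leNgt; apply/negP => fz.
  have [|w [/h Ow /= fw]] := meet [set w | f w < 0] _ fz; last by move: fw; rewrite ltNge Ow.
  by apply: (@open_comp _ _ f [set y : R | y < 0]); [move=> w _; exact: cf|exact: open_lt].
have c1' : continuous (fst : R * R -> R) by move=> w; exact: cvg_fst.
have c2' : continuous (snd : R * R -> R) by move=> w; exact: cvg_snd.
have b1 : 0 <= 1 - z.1.
  by apply: (cl (fun w => 1 - w.1)) => [w|w /(Omega2P C)[/andP[? ?] _ _]]; [apply: cvgB; [exact: cvg_cst|exact: c1']|lra].
have b2 : 0 <= 1 - z.2.
  by apply: (cl (fun w => 1 - w.2)) => [w|w /(Omega2P C)[_ /andP[? ?] _]]; [apply: cvgB; [exact: cvg_cst|exact: c2']|lra].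
have b3 : 0 <= 1 + z.1.
  by apply: (cl (fun w => 1 + w.1)) => [w|w /(Omega2P C)[/andP[? ?] _ _]]; [apply: cvgD; [exact: cvg_cst|exact: c1']|lra].
have b4 : 0 <= 1 + z.2.
  by apply: (cl (fun w => 1 + w.2)) => [w|w /(Omega2P C)[_ /andP[? ?] _]]; [apply: cvgD; [exact: cvg_cst|exact: c2']|lra].
have i1 : `[-1, 1]%classic z.1 by rewrite /= in_itv/=; apply/andP; split; lra.
have i2 : `[-1, 1]%classic z.2 by rewrite /= in_itv/=; apply/andP; split; lra.
have [e1|n1] := eqVneq z.2 1.
  by do 6 left; right; exists z.1 => //; rewrite -e1 -surjective_pairing.
have [e2|n2] := eqVneq z.2 (-1).
  by do 5 left; right; exists z.1 => //; rewrite -e2 -surjective_pairing.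
have [e3|n3] := eqVneq z.1 1.
  by do 4 left; right; exists z.2 => //; rewrite -e3 -surjective_pairing.
have [e4|n4] := eqVneq z.1 (-1).
  by do 3 left; right; exists z.2 => //; rewrite -e4 -surjective_pairing.
have [e5|n5] := eqVneq z.1 0.
  by do 2 left; right; exists z.2 => //; rewrite -e5 -surjective_pairing.
have s1 : -1 < z.1 < 1 by rewrite !lt_neqAle eq_sym n4 n3/=; apply/andP; split; lra.
have s2 : -1 < z.2 < 1 by rewrite !lt_neqAle eq_sym n2 n1/=; apply/andP; split; lra.
have z1p : 0 < z.1.
  rewrite lt_neqAle eq_sym n5 leNgt; apply/negP => h; apply: nO; apply/(Omega2P C); split => //; by left.
have le : `|z.2| <= dist_to z.1 C.
  by rewrite leNgt; apply/negP => h; apply: nO; apply/(Omega2P C); split => //; right.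
(* Strictly between the two graphs a whole neighbourhood misses the domain. *)
have E : `|z.2| = dist_to z.1 C.
  apply/le_anti; rewrite le/= leNgt; apply/negP => h.
  have [||w [/(Omega2P C)[_ _ h3] [/= w1 w2]]] := meet ([set w | 0 < w.1] `&` [set w | 0 < dist_to w.1 C - `|w.2|]).
  - apply: openI; first by apply: (@open_comp _ _ fst [set y : R | 0 < y]); [move=> w _; exact: c1'|exact: open_gt].
    apply: (@open_comp _ _ (fun w : R * R => dist_to w.1 C - `|w.2|) [set y : R | 0 < y]); last exact: open_gt.
    move=> w _; apply: cvgB; last by apply: (@cvg_norm _ _ _ _ _ snd); exact: cvg_snd.
    by apply: (@continuous_comp _ _ _ fst (fun x => dist_to x C)); [exact: cvg_fst|exact: cd].
  - by split => //=; rewrite subr_gt0.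
  - by case: h3; lra.
have [y0|y0] := leP 0 z.2.
  left; right; exists z.1 => //; rewrite mul1r -E ger0_norm//.
  by rewrite -surjective_pairing.
right; exists z.1 => //; rewrite mulN1r -E ltr0_norm// opprK.
by rewrite -surjective_pairing.
Qed.

Lemma null_cover_two_sided s : 1 < s -> null_cover (@dist2 R) s (two_sided (Omega2 C)).
Proof.
move=> s1; suff h : null_cover (@dist2 R) s (boundary (Omega2 C)).
  move=> delta e d0 e0; apply: cover_leS (h _ _ d0 e0) => //.
  by move=> x [].
move=> delta e d0 e0; apply: (cover_leS Omega2_boundary (lexx e)).
have v (a x y : R) : dist2 (a, x) (a, y) <= 2 * `|x - y|.
  by apply: le_trans (dist2_le _ _) _; rewrite /= subrr normr0 add0r; have := normr_ge0 (x - y); lra.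
have hz (a x y : R) : dist2 (x, a) (y, a) <= 2 * `|x - y|.
  by apply: le_trans (dist2_le _ _) _; rewrite /= subrr normr0 addr0; have := normr_ge0 (x - y); lra.
apply: (null_cover_curve s1 (fun x y => dist_to_curve x y (normrN1 R))) => //.
apply: (null_cover_curve s1 (fun x y => dist_to_curve x y (normr1 R))) => //.
apply: (null_cover_curve s1 (v 0)).
apply: (null_cover_curve s1 (v (-1))).
apply: (null_cover_curve s1 (v 1)).
apply: (null_cover_curve s1 (hz (-1))).
apply: (null_cover_curve s1 (hz 1)).
move=> delta' e' d0' e0'; apply: cover_leS (cover_le0 _ _ (ltW d0')) => //; exact: ltW.
Qed.

(** Above, every exponent larger than 1 is admissible because the boundary consists of Lipschitz
    curves. Below, [x -> (x, 0)] does not shrink distances and maps [C] without 0 and 1 into the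
    two-sided points, so an exponent admissible for them is admissible for [C]. *)
Lemma two_sided_dim : hausdorff_dim (@dist1 R) C = 1%E ->
  hausdorff_dim (@dist2 R) (two_sided (Omega2 C)) = 1%E.
Proof.
move=> dC; apply/le_anti/andP; split.
  apply/lee_addgt0Pr => e e0; rewrite -EFinD; apply: ereal_inf_lbound; exists (1 + e) => //=; split.
    by rewrite addr_ge0// ltW.
  by apply: null_cover_measure; apply: null_cover_two_sided; rewrite ltrDl.
apply: le_ereal_inf_tmp => _ [s [s0 Hs] <-]; rewrite -dC; apply: ereal_inf_lbound; exists s => //; split => //.
have nT := measure_null_cover Hs; have Tc := Omega2_axis Cc c0 c1.
(* For [s = 0] every nonempty set of a cover contributes 1, and the two-sided point over [c] has to
   be covered. *)
have sp : 0 < s.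
  rewrite lt_neqAle s0 andbT eq_sym; apply/eqP => s00.
  have [U [TU _] sU] := nT 1 (1 / 2) ltr01 ltac:(by rewrite divr_gt0).
  have [i _ Ui] := TU _ Tc.
  have t1 : hausdorff_term (@dist2 R) s (U i) = 1%E.
    rewrite /hausdorff_term asboolF; last by move=> U0; rewrite U0 in Ui.
    by rewrite s00 poweRe0.
  have t0 k : (0 <= hausdorff_term (@dist2 R) s (U k))%E by exact: hausdorff_term_ge0.
  have := le_trans (nneseries_lim_ge i.+1 (fun k _ _ => t0 k)) sU.
  rewrite big_nat_recr//= t1 => h.
  have : (1%E <= (1 / 2)%:E :> \bar R)%E.
    by apply: le_trans h; rewrite leeDr// sume_ge0.
  by rewrite lee_fin; lra.
apply: null_cover_measure.
have n1 : null_cover (@dist1 R) s (C `&` [set x | 0 < x < 1]).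
  apply: (null_cover_preimage (f := fun x => (x, 0)) s0 _ _ nT).
    by move=> x y; have [h _] := dist2_ge (x, 0) (y, 0).
  by move=> x [Cx /andP[x0 x1]]; exact: Omega2_axis.
have dp (p : R) : dist1 p p = 0 by rewrite /dist1 subrr normr0.
(* The set [C] may contain 0 and 1, about which [Omega2_axis] says nothing; single points cost
   nothing when [s > 0]. *)
have n3 := null_cover_point sp (dp 1) (null_cover_point sp (dp 0) n1).
move=> delta e d0 e0; apply: cover_leS (n3 _ _ d0 e0) => //.
move=> x Cx; have := C01 Cx; rewrite /= in_itv/= => /andP[x0 x1].
have [->|nx0] := eqVneq x 0; first by left; right.
have [->|nx1] := eqVneq x 1; first by right.
by left; left; split => //=; rewrite !lt_neqAle eq_sym nx0 nx1 x0 x1.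
Qed.

End TwoSidedPoints.

Theorem mainTheorem3 (R : realType) (C : set R)
    (C01 : C `<=` `[0, 1]) (Ccantor : cantor_set C)
    (Cdim : hausdorff_dim (@dist1 R) C = 1%E)
    (CH1 : hausdorff_measure (@dist1 R) 1 C = 0%E) :
  W1p_extension_domain 1%E (Omega2 C) /\
  hausdorff_dim (@dist2 R) (two_sided (Omega2 C)) = 1%E.
Proof.
have [cC [c [Cc c0 c1]]] := cantor_interior_point C01 Ccantor.
have nC := hausdorff_null (closed_measurable cC) CH1.
split; first exact: Omega2_extension_domain cC nC Cc c0 c1.
exact: two_sided_dim Cc c0 c1 C01 Cdim.
Qed.
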